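(* The set of (isomorphism classes of) $\Gamma$-equivariant $Q'$-modules whose underlying graded $Q'$-module is of the form $(M_{p,p+\xi}\oplus M_{p+\xi',p+\xi'+\xi})\otimes k^2$, where $p\in E$ and $\xi$ ranges over the non-zero points of $E[2]=\{o,\xi,\xi',\xi''\}$, is parametrized by $$\big(E/\langle\xi\rangle\big)\sqcup\big(E/\langle\xi'\rangle\big)\sqcup\big(E/\langle\xi''\rangle\big),$$ where $\{\xi,\xi',\xi''\}$ is the set of (non-zero) 2-torsion points on $E$.
   Context: Let $k$ be an algebraically closed field of characteristic not $2$, and let $\alpha_1=\alpha,\alpha_2=\beta,\alpha_3=\gamma\in k$ satisfy $\alpha+\beta+\gamma+\alpha\beta\gamma=0$ and $\{\alpha,\beta,\gamma\}\cap\{0,1,-1\}=\varnothing$. Let $Q$ be the quotient of the free algebra $k\langle x_0,x_1,x_2,x_3\rangle$ (graded, $\deg x_j=1$) by the six relations $x_0x_r-x_rx_0=\alpha_r(x_sx_t+x_tx_s)$, $x_0x_r+x_rx_0=x_sx_t-x_tx_s$, $(r,s,t)$ running over the cyclic permutations of $(1,2,3)$. Let $E\subset\mathbb P^3=\mathbb P(Q_1^* )$ be the elliptic curve $x_0^2+x_1^2+x_2^2+x_3^2=(1-\gamma)x_1^2+(1+\alpha\gamma)x_2^2+(1+\alpha)x_3^2=0$. The group $\Gamma=\{1,\gamma_1,\gamma_2,\gamma_3=\gamma_1\gamma_2\}\cong\mathbb Z/2\times\mathbb Z/2$ acts on $Q$ by: $\gamma_r$ fixes $x_0,x_r$ and negates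 $x_j$ for $j\in\{1,2,3\}\setminus\{r\}$. The induced action on $\mathbb P(Q_1^* )$ preserves $E$, and $E$ has an algebraic group law (identity $o$) for which each $\gamma_r$ acts on $E$ as translation by a point $\xi_r\in E[2]=\{o,\xi_1,\xi_2,\xi_3\}$, the 2-torsion subgroup. $\Gamma$ acts on $M_2(k)$ by $\gamma_j(a)=q_jaq_j^{-1}$ where, with $i^2=-1$, $q_1=\begin{pmatrix}i&0\\0&-i\end{pmatrix}$, $q_2=\begin{pmatrix}0&i\\i&0\end{pmatrix}$, $q_3=\begin{pmatrix}0&-1\\1&0\end{pmatrix}$, and diagonally on $Q'=Q\otimes M_2(k)$ ($M_2(k)$ in degree $0$). Put $\widetilde Q=(Q')^\Gamma$. For $p,q\in E$, $M_{p,q}=Q/(Qx+Qx')$, where $x=x'=0$ is the line in $\mathbb P(Q_1^* )$ whose scheme-theoretic intersection with $E$ is $(p)+(q)$. The space $k^2$ is the natural left $M_2(k)$-module. A $\Gamma$-equivariant $Q'$-module is a graded left $Q'$-module $M$ with a degree-preserving linear left $\Gamma$-action $(\delta,m)\mapsto m^\delta$ satisfying $(rm)^\delta=\delta(r)m^\delta$ ($r\in Q'$, $m\in M$, $\delta\in\Gamma$); morphisms are graded $Q'$-module maps commuting with $\Gamma$. On the word ''parametrized'': for each equivariant module $M$ in question, the module of invariants $M^\Gamma$ is a line module for $\widetilde Q$ (a cyclic graded left module with Hilbert series $(1-t)^{-2}$), so it has the form $\widetilde Q/(\widetilde Qy+\widetilde Qy')$ with $y,y'\in\widetilde Q_1$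 linearly independent, and it determines the line $y=y'=0$, a point of the Grassmannian $\mathbb G(1,3)$ of lines in $\mathbb P(\widetilde Q_1^* )$. The source uses ''parametrized'' with the understanding that the parametrizing space is a closed subvariety of this Grassmannian, the curve $E/\langle\xi\rangle$ corresponding to the equivariant modules whose underlying module is $(M_{p,p+\xi}\oplus M_{p+\xi',p+\xi'+\xi})\otimes k^2$ for some $p\in E$. *)

(* Defs.v *)
From HB Require Import structures.
From mathcomp Require Import all_boot all_algebra.
From mathcomp Require Import boolp finmap.
From mathcomp.multinomials Require mpoly.
From mathcomp.multinomials Require monalg.

Set Implicit Arguments.
Unset Strict Implicit.
Unset Printing Implicit Defensive.

Import GRing.Theory.
Local Open Scope ring_scope.
Local Open Scope quotient_scope.

Module Export Spaces.

(* Varieties are spaces with functions in the sense of Serre: a closed-set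
   predicate and, for open U, the functions that are regular on U.  Only the
   values of f on U matter in ks_regular U f. *)
Record kspace (k : fieldType) := KSpace {
  ks_pt :> Type;
  ks_closed : (ks_pt -> Prop) -> Prop;
  ks_regular : (ks_pt -> Prop) -> (ks_pt -> k) -> Prop }.

Import mpoly.
Section Spaces.
Variable k : fieldType.

Definition ks_open (X : kspace k) (U : X -> Prop) : Prop :=
  ks_closed (fun x => ~ U x).

Definition ks_morph (X Y : kspace k) (f : X -> Y) : Prop :=
  (forall Z : Y -> Prop, ks_closed Z -> ks_closed (fun x => Z (f x))) /\
  (forall (U : Y -> Prop) (g : Y -> k), ks_open U -> ks_regular U g ->
     ks_regular (fun x => U (f x)) (fun x => g (f x))).

Definition ks_iso (X Y : kspace k) (f : X -> Y) : Prop :=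
  exists g : Y -> X,
    [/\ cancel f g, cancel g f, ks_morph f & ks_morph g].

(* A set T embedded in a projective space, h x being homogeneous coordinates
   of x; nothing depends on the choice of these coordinates. *)
Definition pvar (T : Type) (n : nat) (h : T -> 'rV[k]_n) : kspace k :=
  @KSpace k T
    (fun Z => exists J : {mpoly k[n]} -> Prop,
       (forall p, J p -> exists d, p \is d.-homog) /\
       (forall x, Z x <-> forall p, J p -> p.@[h x 0] = 0))
    (fun U f => forall x, U x ->
       exists (d : nat) (a b : {mpoly k[n]}),
         [/\ a \is d.-homog, b \is d.-homog, b.@[h x 0] != 0
           & forall y, U y -> b.@[h y 0] != 0 -> f y = a.@[h y 0] / b.@[h y 0]]).

(* Segre coordinates *)
Definition segre (S T : Type) (m n : nat) (g : S -> 'rV[k]_m)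
    (h : T -> 'rV[k]_n) (x : S * T) : 'rV[k]_(m * n) :=
  mxvec ((g x.1)^T *m h x.2).

Definition classes (T : Type) (R : T -> T -> Prop) : Type :=
  {C : T -> Prop | exists x, C = R x}.
Definition class_of (T : Type) (R : T -> T -> Prop) (x : T) : classes R :=
  exist _ (R x) (ex_intro _ x erefl).

(* The quotient of X by an equivalence relation: quotient topology, and
   functions which are regular on X *)
Definition ks_quot (X : kspace k) (R : X -> X -> Prop) : kspace k :=
  @KSpace k (classes R)
    (fun Z => ks_closed (fun x : X => Z (class_of R x)))
    (fun U f => ks_regular (fun x : X => U (class_of R x))
                           (fun x : X => f (class_of R x))).

Definition ks_sum (J : Type) (X : J -> kspace k) : kspace k :=
  @KSpace k {j : J & X j}
    (fun Z => forall j, ks_closed (fun x : X j => Z (existT _ j x)))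
    (fun U f => forall j, ks_regular (fun x : X j => U (existT _ j x))
                                     (fun x : X j => f (existT _ j x))).

(* gr d n: the d-dimensional subspaces of k^n; gr 1 4 is P^3 and gr 2 4 is the
   Grassmannian G(1,3) of lines in P^3. *)
Definition gr (d n : nat) := {L : {vspace 'rV[k]_n} | \dim L == d}.

Definition plucker (L : gr 2 4) : 'rV[k]_6 :=
  let b r (j : nat) := (vbasis (val L))`_r 0 (inord j : 'I_4) in
  \row_(m < 6) let: (j, l) := nth (0%N, 0%N)
      [:: (0, 1); (0, 2); (0, 3); (1, 2); (1, 3); (2, 3)]%N m in
    b 0%N j * b 1%N l - b 0%N l * b 1%N j.

Definition dot (c v : 'rV[k]_4) : k := \sum_j c 0 j * v 0 j.

(* As \dim L = 2, the forms c and c' are linearly independent *)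
Definition is_line (c c' : 'rV[k]_4) (L : {vspace 'rV[k]_4}) : Prop :=
  \dim L = 2%N /\ forall v, v \in L <-> dot c v = 0 /\ dot c' v = 0.

End Spaces.
End Spaces.

Import monalg.

Section LeftQuotient.
Variables (R : nzRingType) (x x' : R).

Definition lideal : {pred R^o} :=
  fun a => `[< exists b b' : R, a = b * x + b' * x' >].

Lemma lideal_submod : submod_closed lideal.
Proof.
split; first by apply/asboolP; exists 0, 0; rewrite !mul0r addr0.
move=> a u v /asboolP[b [b' ->]] /asboolP[c [c' ->]].
apply/asboolP; exists (a * b + c), (a * b' + c').
by rewrite /GRing.scale /= mulrDr !mulrDl !mulrA addrACA.
Qed.
HB.instance Definition _ := GRing.isSubmodClosed.Build R R^o lideal
  lideal_submod.

Definition lquot : Type := Quotient.quot lideal.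
HB.instance Definition _ := GRing.Zmodule.on lquot.

Definition lquot_pi (v : R) : lquot := \pi_(Quotient.quot lideal) v.

Lemma lquot_piD u v : lquot_pi (u + v) = lquot_pi u + lquot_pi v.
Proof. exact: (@pi_addr _ _ _ _ _ (Quotient.quot lideal)). Qed.

Lemma lquot_piP u v : reflect (lquot_pi u = lquot_pi v) (u - v \in lideal).
Proof. by rewrite Quotient.idealrBE; apply: eqP. Qed.

Lemma lquot_reprK (v : lquot) : lquot_pi (repr v) = v.
Proof. exact: reprK. Qed.

Definition lquot_scale (a : R) (v : lquot) : lquot := lquot_pi (a * repr v).

Lemma lquot_scale_pi a v : lquot_scale a (lquot_pi v) = lquot_pi (a * v).
Proof.
apply/lquot_piP; rewrite -mulrBr.
apply: (@rpredZ _ R^o lideal a); by apply/lquot_piP; rewrite lquot_reprK.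
Qed.

Lemma lquot_scaleA a b v :
  lquot_scale a (lquot_scale b v) = lquot_scale (a * b) v.
Proof. by rewrite -[v]lquot_reprK !lquot_scale_pi mulrA. Qed.
Lemma lquot_scale1 : left_id 1 lquot_scale.
Proof. by move=> v; rewrite -[v]lquot_reprK lquot_scale_pi mul1r. Qed.
Lemma lquot_scaleDr : right_distributive lquot_scale +%R.
Proof.
move=> a u v; rewrite -[u]lquot_reprK -[v]lquot_reprK.
by rewrite -lquot_piD !lquot_scale_pi mulrDr lquot_piD.
Qed.
Lemma lquot_scaleDl v : {morph lquot_scale^~ v : a b / a + b}.
Proof.
by move=> a b; rewrite -[v]lquot_reprK !lquot_scale_pi mulrDl lquot_piD.
Qed.
HB.instance Definition _ := GRing.Zmodule_isLmodule.Build R lquot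
  lquot_scaleA lquot_scale1 lquot_scaleDr lquot_scaleDl.

End LeftQuotient.

(* The homogeneous parts are data here; that they form a grading of a module is
   the predicate is_graded. *)
Record gradedRing := GradedRing {
  gr_ring :> nzRingType;
  gr_deg : nat -> gr_ring -> Prop }.

Record gradedModule (R : gradedRing) := GradedModule {
  gm_mod :> lmodType R;
  gm_deg : int -> gm_mod -> Prop }.

Definition is_graded (R : gradedRing) (M : gradedModule R) : Prop :=
  [/\ forall n, gm_deg n (0 : M)
        /\ forall u v : M, gm_deg n u -> gm_deg n v -> gm_deg n (u - v),
      forall i n (a : R) (v : M),
        gr_deg i a -> gm_deg n v -> gm_deg (i%:Z + n) (a *: v),
      forall v : M, exists (s : seq int) (w : int -> M),
        (forall n, gm_deg n (w n)) /\ v = \sum_(n <- s) w n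
    & forall (s : seq int) (w : int -> M), uniq s ->
        (forall n, gm_deg n (w n)) -> \sum_(n <- s) w n = 0 ->
        forall n, n \in s -> w n = 0].

Definition graded_isom (R : gradedRing) (M N : gradedModule R) : Prop :=
  exists f : {linear M -> N},
    bijective f /\ forall n v, gm_deg n v <-> gm_deg n (f v).

Definition lquot2 (R : gradedRing) (x x' : R) : gradedModule R :=
  @GradedModule R (lquot x x')
    (fun n v => match n with
       | Posz j => exists a : R, gr_deg j a /\ v = lquot_pi x x' a
       | Negz _ => v = 0
       end).

Definition gsum (R : gradedRing) (M N : gradedModule R) : gradedModule R :=
  @GradedModule R (M * N)%type
    (fun n v => gm_deg n v.1 /\ gm_deg n v.2).

Section TwoSidedIdeal.
Variables (A : nzRingType) (S : seq A).

Definition tsideal : {pred A} :=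
  fun f => `[< exists s : seq (A * A * A),
    (forall u, u \in s -> u.1.2 \in S) /\
    f = \sum_(u <- s) u.1.1 * u.1.2 * u.2 >].

Lemma tsideal_zmod : zmod_closed tsideal.
Proof.
split; first by apply/asboolP; exists [::]; rewrite big_nil.
move=> f g /asboolP[s [sR ->]] /asboolP[t [tR ->]]; apply/asboolP.
exists (s ++ [seq (- u.1.1, u.1.2, u.2) | u <- t]); split=> [u|].
  by rewrite mem_cat => /orP[/sR //|/mapP[v /tR vR ->]].
rewrite big_cat big_map -sumrN; congr (_ + _); apply: eq_bigr => u _ /=.
by rewrite !mulNr.
Qed.
HB.instance Definition _ := GRing.isZmodClosed.Build A tsideal tsideal_zmod.

Lemma tsidealMl f g : g \in tsideal -> f * g \in tsideal.
Proof.
move=> /asboolP[s [sR ->]]; apply/asboolP.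
exists [seq (f * u.1.1, u.1.2, u.2) | u <- s]; split=> [u|].
  by move=> /mapP[v /sR vR ->].
by rewrite big_map mulr_sumr; apply: eq_bigr => u _ /=; rewrite !mulrA.
Qed.

Lemma tsidealMr f g : g \in tsideal -> g * f \in tsideal.
Proof.
move=> /asboolP[s [sR ->]]; apply/asboolP.
exists [seq (u.1.1, u.1.2, u.2 * f) | u <- s]; split=> [u|].
  by move=> /mapP[v /sR vR ->].
by rewrite big_map mulr_suml; apply: eq_bigr => u _ /=; rewrite !mulrA.
Qed.

Lemma tsideal_gen r : r \in S -> r \in tsideal.
Proof.
move=> rS; apply/asboolP; exists [:: (1, r, 1)]; split.
  by move=> u; rewrite inE => /eqP->.
by rewrite big_seq1 mul1r mulr1.
Qed.

Lemma tsideal_morph (B : nzRingType) (h : {rmorphism A -> B})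
    (J : zmodClosed B) :
  (forall f g, g \in J -> f * g \in J) ->
  (forall f g, g \in J -> g * f \in J) ->
  (forall r, r \in S -> h r \in J) -> forall f, f \in tsideal -> h f \in J.
Proof.
move=> Jl Jr hS f /asboolP[s [sS ->]].
rewrite rmorph_sum big_seq; apply: rpred_sum => u /sS uS.
by rewrite !rmorphM; apply/Jr/Jl/hS.
Qed.

Lemma tsideal_proper (B : nzRingType) (h : {rmorphism A -> B}) :
  (forall r, r \in S -> h r = 0) -> 1 \notin tsideal.
Proof.
move=> h0; apply/negP => /asboolP[s [sS]] /(congr1 h); apply/eqP.
rewrite rmorph1 rmorph_sum big_seq big1 ?oner_eq0 // => u /sS /h0 u0.
by rewrite !rmorphM /= u0 mulr0 mul0r.
Qed.

End TwoSidedIdeal.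

Section QuotientAlgebra.
Variables (k : comNzRingType) (A : algType k) (S : seq A).
Hypothesis S1 : 1 \notin tsideal S.

Lemma tsidealZ (c : k) g : g \in tsideal S -> c *: g \in tsideal S.
Proof. by rewrite -mulr_algl; apply: tsidealMl. Qed.

(* S1 is an argument only because the ring structure below depends on it *)
Definition tsquot (_ : 1 \notin tsideal S) : Type := Quotient.quot (tsideal S).
Local Notation Q := (tsquot S1).
HB.instance Definition _ := GRing.Zmodule.on Q.

Definition tsquot_pi (f : A) : Q := \pi_(Quotient.quot (tsideal S)) f.

Lemma tsquot_piD f g : tsquot_pi (f + g) = tsquot_pi f + tsquot_pi g.
Proof. exact: (@pi_addr _ _ _ _ _ (Quotient.quot (tsideal S))). Qed.

Lemma tsquot_piP f g : reflect (tsquot_pi f = tsquot_pi g) (f - g \in tsideal S).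
Proof. by rewrite Quotient.idealrBE; apply: eqP. Qed.

Lemma tsquot_reprK (u : Q) : tsquot_pi (repr u) = u.
Proof. exact: reprK. Qed.

Definition tsquot_one : Q := tsquot_pi 1.
Definition tsquot_mul (u v : Q) : Q := tsquot_pi (repr u * repr v).
Definition tsquot_scale (c : k) (u : Q) : Q := tsquot_pi (c *: repr u).

Lemma tsquot_mul_pi f g :
  tsquot_mul (tsquot_pi f) (tsquot_pi g) = tsquot_pi (f * g).
Proof.
apply/tsquot_piP; set f' := repr _; set g' := repr _.
have -> : f' * g' - f * g = (f' - f) * g' + f * (g' - g).
  by rewrite mulrBl mulrBr addrA subrK.
by apply: rpredD; [apply: tsidealMr | apply: tsidealMl];
   apply/tsquot_piP; rewrite tsquot_reprK.
Qed.

Lemma tsquot_scale_pi c f : tsquot_scale c (tsquot_pi f) = tsquot_pi (c *: f).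
Proof.
by apply/tsquot_piP; rewrite -scalerBr tsidealZ //; apply/tsquot_piP;
   rewrite tsquot_reprK.
Qed.

Lemma tsquot_mulA : associative tsquot_mul.
Proof.
by move=> u v w; rewrite -[u]tsquot_reprK -[v]tsquot_reprK -[w]tsquot_reprK
  !tsquot_mul_pi mulrA.
Qed.
Lemma tsquot_mul1 : left_id tsquot_one tsquot_mul.
Proof. by move=> u; rewrite -[u]tsquot_reprK tsquot_mul_pi mul1r. Qed.
Lemma tsquot_1mul : right_id tsquot_one tsquot_mul.
Proof. by move=> u; rewrite -[u]tsquot_reprK tsquot_mul_pi mulr1. Qed.
Lemma tsquot_mulDl : left_distributive tsquot_mul +%R.
Proof.
by move=> u v w; rewrite -[u]tsquot_reprK -[v]tsquot_reprK -[w]tsquot_reprK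
  -tsquot_piD !tsquot_mul_pi mulrDl tsquot_piD.
Qed.
Lemma tsquot_mulDr : right_distributive tsquot_mul +%R.
Proof.
by move=> u v w; rewrite -[u]tsquot_reprK -[v]tsquot_reprK -[w]tsquot_reprK
  -tsquot_piD !tsquot_mul_pi mulrDr tsquot_piD.
Qed.
Lemma tsquot_1neq0 : tsquot_one != 0.
Proof.
apply/negP => /eqP q10.
have : tsquot_pi 1 = tsquot_pi 0.
  by rewrite -[LHS]/tsquot_one q10; apply: (addrI (tsquot_pi 0));
     rewrite -tsquot_piD !addr0.
by move/tsquot_piP; rewrite subr0; apply/negP.
Qed.
HB.instance Definition _ := GRing.Zmodule_isNzRing.Build Q
  tsquot_mulA tsquot_mul1 tsquot_1mul tsquot_mulDl tsquot_mulDr tsquot_1neq0.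

Lemma tsquot_scaleA c d u :
  tsquot_scale c (tsquot_scale d u) = tsquot_scale (c * d) u.
Proof. by rewrite -[u]tsquot_reprK !tsquot_scale_pi scalerA. Qed.
Lemma tsquot_scale1 : left_id 1 tsquot_scale.
Proof. by move=> u; rewrite -[u]tsquot_reprK tsquot_scale_pi scale1r. Qed.
Lemma tsquot_scaleDr : right_distributive tsquot_scale +%R.
Proof.
by move=> c u v; rewrite -[u]tsquot_reprK -[v]tsquot_reprK
  -tsquot_piD !tsquot_scale_pi scalerDr tsquot_piD.
Qed.
Lemma tsquot_scaleDl u : {morph tsquot_scale^~ u : c d / c + d}.
Proof.
by move=> c d; rewrite -[u]tsquot_reprK !tsquot_scale_pi scalerDl tsquot_piD.
Qed.
HB.instance Definition _ := GRing.Zmodule_isLmodule.Build k Q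
  tsquot_scaleA tsquot_scale1 tsquot_scaleDr tsquot_scaleDl.

Lemma tsquot_scaleAl (c : k) (u v : Q) : c *: (u * v) = (c *: u) * v.
Proof.
rewrite -[u]tsquot_reprK -[v]tsquot_reprK /GRing.scale /GRing.mul /=.
by rewrite !(tsquot_mul_pi, tsquot_scale_pi) scalerAl.
Qed.
HB.instance Definition _ := GRing.Lmodule_isLalgebra.Build k Q tsquot_scaleAl.

Lemma tsquot_scaleAr (c : k) (u v : Q) : c *: (u * v) = u * (c *: v).
Proof.
rewrite -[u]tsquot_reprK -[v]tsquot_reprK /GRing.scale /GRing.mul /=.
by rewrite !(tsquot_mul_pi, tsquot_scale_pi) scalerAr.
Qed.
HB.instance Definition _ := GRing.Lalgebra_isAlgebra.Build k Q tsquot_scaleAr.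

Lemma tsquot_pi_zmod : zmod_morphism tsquot_pi.
Proof.
by move=> f g; apply: (addIr (tsquot_pi g)); rewrite -tsquot_piD !subrK.
Qed.
HB.instance Definition _ := GRing.isZmodMorphism.Build A Q tsquot_pi
  tsquot_pi_zmod.
Lemma tsquot_pi_monoid : monoid_morphism tsquot_pi.
Proof. by split=> // f g; rewrite -tsquot_mul_pi. Qed.
HB.instance Definition _ := GRing.isMonoidMorphism.Build A Q tsquot_pi
  tsquot_pi_monoid.
Lemma tsquot_pi_scale : scalable tsquot_pi.
Proof. by move=> c f; rewrite -tsquot_scale_pi. Qed.
HB.instance Definition _ := GRing.isScalable.Build k A Q *:%R tsquot_pi
  tsquot_pi_scale.

Section Lift.
Variable h : {lrmorphism A -> A}.
Hypothesis hS : forall r, r \in S -> h r \in tsideal S.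

Definition tsquot_map (u : Q) : Q := tsquot_pi (h (repr u)).

Lemma tsquot_map_pi f : tsquot_map (tsquot_pi f) = tsquot_pi (h f).
Proof.
apply/tsquot_piP; rewrite -rmorphB.
apply: (tsideal_morph (@tsidealMl _ _) (@tsidealMr _ _) hS).
by apply/tsquot_piP; rewrite tsquot_reprK.
Qed.

Lemma tsquot_map_zmod : zmod_morphism tsquot_map.
Proof.
by move=> u v; rewrite -[u]tsquot_reprK -[v]tsquot_reprK -rmorphB
  !tsquot_map_pi !rmorphB.
Qed.

Lemma tsquot_map_monoid : monoid_morphism tsquot_map.
Proof.
split=> [|u v]; first by rewrite -[1 in LHS](rmorph1 tsquot_pi) tsquot_map_pi
  !rmorph1.
by rewrite -[u]tsquot_reprK -[v]tsquot_reprK -rmorphM !tsquot_map_pi !rmorphM.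
Qed.

Lemma tsquot_map_scale : scalable tsquot_map.
Proof. by move=> c u; rewrite -[u]tsquot_reprK -linearZ !tsquot_map_pi !linearZ. Qed.

End Lift.
End QuotientAlgebra.

Lemma malg_scaleAr (K : monomType) (R : comNzRingType) (c : R)
    (u v : {malg R[K]}) : c *: (u * v) = u * (c *: v).
Proof.
apply/malgP => m; rewrite mcoeffZ.
have le : (msupp (c *: v) `<=` msupp v)%fset by exact: msuppZ_le.
rewrite (@mcoeffMlw _ _ _ _ u (c *: v) m (fsubset_refl _) le).
rewrite (@mcoeffMl _ _ u v m) mulr_sumr.
apply: eq_bigr => m1 _; rewrite mulr_sumr; apply: eq_bigr => m2 _.
by rewrite mcoeffZ mulrnAr mulrCA.
Qed.

Lemma malgC_comm (K : monomType) (R : comNzRingType) (c : R)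
    (u : {malg R[K]}) : GRing.comm (c%:MP) u.
Proof.
have cE : c%:MP = c *: (1 : {malg R[K]}) by rewrite -mul_malgC mulr1.
by rewrite /GRing.comm mul_malgC cE -malg_scaleAr mulr1.
Qed.

Section FreeAlgebra.
Variables (k : fieldType) (I : choiceType).

(* The library only makes {malg k[K]} an algebra for commutative K *)
Definition freeAlg : Type := {malg k[{fmonom I}]}.
HB.instance Definition _ := GRing.Lalgebra.on freeAlg.
HB.instance Definition _ := GRing.Lalgebra_isAlgebra.Build k freeAlg
  (@malg_scaleAr {fmonom I} k).
Local Notation F := freeAlg.

Definition fgen (j : I) : F := << fmu j >>.

Variable y : I -> F.

Definition fword (m : {fmonom I}) : F := \prod_(j <- m) y j.

Lemma fword_mm : mmorphism fword.
Proof.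
by split=> [m n|]; rewrite /fword ?fmM ?fm1 ?big_cat ?big_nil.
Qed.
HB.instance Definition _ := isMultiplicative.Build _ _ fword fword_mm.

Definition fsubst : F -> F := mmap (@malgC {fmonom I} k) fword.

HB.instance Definition _ := GRing.Additive.on fsubst.

Lemma fsubst_mul : multiplicative fsubst.
Proof.
by apply: commr_mmap_is_multiplicative => g m m'; apply: malgC_comm.
Qed.
HB.instance Definition _ := GRing.isMultiplicative.Build F F fsubst fsubst_mul.

Lemma fsubst_scale : scalable fsubst.
Proof. by move=> c u; rewrite /fsubst mmapZ mul_malgC. Qed.
HB.instance Definition _ := GRing.isScalable.Build k F F *:%R fsubst
  fsubst_scale.

Lemma fsubst_gen j : fsubst (fgen j) = y j.
Proof. by rewrite /fsubst mmapU mul_malgC scale1r /fword fmU big_seq1. Qed.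

End FreeAlgebra.

(* (a, b) stands for gamma_1^a gamma_2^b *)
Definition Gam : finType := (bool * bool)%type.
Definition gam1 : Gam := (false, false).
Definition gamM (d e : Gam) : Gam := (d.1 (+) e.1, d.2 (+) e.2).

Definition gam_neg (d : Gam) (j : 'I_4) : bool :=
  nth false [:: false; d.2; d.1; d.1 (+) d.2] j.

Section Relations.
Variables (k : fieldType) (A : algType k).

Definition sk_rel (a : k) (x0 xr xs xt : A) : seq A :=
  [:: x0 * xr - xr * x0 - a *: (xs * xt + xt * xs);
      x0 * xr + xr * x0 - (xs * xt - xt * xs)].

Lemma sk_rel0 (B : nzRingType) (h : {rmorphism A -> B}) a x0 xr xs xt :
  h x0 = 0 -> h xr = 0 -> h xs = 0 -> h xt = 0 ->
  forall r, r \in sk_rel a x0 xr xs xt -> h r = 0.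
Proof.
move=> h0 hr hs ht r; rewrite !inE -mulr_algl => /orP[] /eqP->.
  by rewrite !(rmorphB, rmorphD, rmorphM) /= h0 hr hs ht
    !(mulr0, subr0, addr0).
by rewrite !(rmorphB, rmorphD, rmorphM) /= h0 hr hs ht !(mulr0, subr0, addr0).
Qed.

Lemma sk_rel_sign (h : {lrmorphism A -> A}) a x0 xr xs xt (e f g : bool) :
  g = e (+) f ->
  h x0 = x0 -> h xr = (-1) ^+ e *: xr -> h xs = (-1) ^+ f *: xs ->
  h xt = (-1) ^+ g *: xt ->
  forall r, r \in sk_rel a x0 xr xs xt -> h r = (-1) ^+ e *: r.
Proof.
move=> -> h0 hr hs ht r; rewrite !inE => /orP[] /eqP->;
  rewrite !(linearB, linearD, linearZ, rmorphM) /= h0 hr hs ht;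
  case: e {hr ht}; case: f {hs} => /=;
  rewrite ?expr0 ?expr1 ?scale1r ?scaleN1r
    ?(mulrN, mulNr, opprK, opprD, scalerN, scalerDr) //.
Qed.

End Relations.

Section Sklyanin.
Variables (k : fieldType) (alpha beta gamma : k).
Local Notation F := (freeAlg k 'I_4).
Local Notation X j := (fgen k (inord j : 'I_4)).

Definition sk_rels : seq F :=
  sk_rel alpha (X 0) (X 1) (X 2) (X 3) ++
  sk_rel beta  (X 0) (X 2) (X 3) (X 1) ++
  sk_rel gamma (X 0) (X 3) (X 1) (X 2).

Lemma sk_rels_proper : 1 \notin tsideal sk_rels.
Proof.
pose h := (@mcoeff {fmonom 'I_4} k (@mone {fmonom 'I_4}) : {rmorphism F -> k}).
have X0 j : h (X j) = 0 by rewrite /h /= mcoeffU1 fm1_eq1.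
apply: (tsideal_proper (h := h)) => r; rewrite !mem_cat.
by case/orP=> [|/orP[]]; apply: sk_rel0.
Qed.

Definition skl : algType k := tsquot sk_rels_proper.

Definition skl_pi : F -> skl := @tsquot_pi k F sk_rels sk_rels_proper.

Definition skl_x (j : 'I_4) : skl := skl_pi (fgen k j).

Definition skl_deg (n : nat) (u : skl) : Prop :=
  exists f : F, (forall m : {fmonom 'I_4}, f@_m != 0 -> fdeg m = n) /\ u = skl_pi f.

Definition skl_graded : gradedRing := @GradedRing skl skl_deg.

Definition gam_subst (d : Gam) : F -> F :=
  fsubst (fun j => (-1) ^+ gam_neg d j *: fgen k j).

HB.instance Definition _ d := GRing.LRMorphism.on (gam_subst d).

Lemma gam_subst_rels d r : r \in sk_rels -> gam_subst d r \in tsideal sk_rels.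
Proof.
have hX j : (j < 4)%N -> gam_subst d (X j) =
    (-1) ^+ nth false [:: false; d.2; d.1; d.1 (+) d.2] j *: X j.
  by move=> j4; rewrite [LHS]fsubst_gen /gam_neg inordK.
have h0 : gam_subst d (X 0) = X 0 by rewrite hX //= expr0 scale1r.
have h1 := hX 1 isT; have h2 := hX 2 isT; have h3 := hX 3 isT.
rewrite /= in h1 h2 h3.
move=> rR; suff [e ->] : exists e : bool, gam_subst d r = (-1) ^+ e *: r.
  exact/tsidealZ/tsideal_gen.
move: rR; rewrite !mem_cat => /orP[|/orP[]] rR.
- by exists d.2; apply: (sk_rel_sign _ h0 h1 h2 h3 rR); rewrite addbC.
- by exists d.1; apply: (sk_rel_sign _ h0 h2 h3 h1 rR); rewrite addKb.
exists (d.1 (+) d.2); apply: (sk_rel_sign _ h0 h3 h1 h2 rR).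
by rewrite addbK.
Qed.

Definition skl_act (d : Gam) : skl -> skl :=
  @tsquot_map k F sk_rels sk_rels_proper (gam_subst d).

Lemma skl_act_x d j : skl_act d (skl_x j) = (-1) ^+ gam_neg d j *: skl_x j.
Proof.
rewrite /skl_act /skl_x /skl_pi.
rewrite (tsquot_map_pi _ (gam_subst_rels d)) -linearZ; congr tsquot_pi.
exact: fsubst_gen.
Qed.

Lemma skl_act_zmod d : zmod_morphism (skl_act d).
Proof. exact: (tsquot_map_zmod (gam_subst_rels d)). Qed.
HB.instance Definition _ d := GRing.isZmodMorphism.Build skl skl (skl_act d)
  (skl_act_zmod d).
Lemma skl_act_monoid d : monoid_morphism (skl_act d).
Proof. exact: (tsquot_map_monoid sk_rels_proper (gam_subst_rels d)). Qed.
HB.instance Definition _ d := GRing.isMonoidMorphism.Build skl skl (skl_act d)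
  (skl_act_monoid d).
Lemma skl_act_scale d : scalable (skl_act d).
Proof. exact: (tsquot_map_scale (gam_subst_rels d)). Qed.
HB.instance Definition _ d := GRing.isScalable.Build k skl skl *:%R (skl_act d)
  (skl_act_scale d).

End Sklyanin.

Definition sqrtN1 (k : fieldType) := {i : k | i ^+ 2 == -1}.

Section Quaternion.
Variables (k : fieldType) (i : sqrtN1 k).

Definition mx2 (T : Type) (a b c d : T) : 'M[T]_2 :=
  \matrix_(r < 2, s < 2)
    if r == 0 then (if s == 0 then a else b) else (if s == 0 then c else d).

(* q_0 = 1, q_1, q_2, q_3, indexed like the elements 1, gamma_1, gamma_2,
   gamma_3 = gamma_1 gamma_2 of Gamma *)
Definition qmx (d : Gam) : 'M[k]_2 :=
  let i := val i in
  match d with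
  | (false, false) => 1%:M
  | (true, false)  => mx2 i 0 0 (- i)
  | (false, true)  => mx2 0 i i 0
  | (true, true)   => mx2 0 (-1) 1 0
  end.

Lemma qmx_unit d : qmx d \in unitmx.
Proof.
have /eqP ii := valP i; rewrite expr2 in ii.
suff : qmx d *m (if d == gam1 then 1%:M else - qmx d) = 1%:M.
  by case/mulmx1_unit.
case: d => [[] []]; rewrite /qmx /= ?mulmx1 //;
  apply/matrixP => -[[|[|?]] ?] [[|[|?]] ?] //;
  rewrite !mxE !big_ord_recl big_ord0 !mxE /=;
  rewrite ?(mulrN, mulNr, mul0r, mulr0, mul1r, mulr1, opprK, oppr0, addr0, add0r);
  by rewrite ?ii ?opprK.
Qed.

End Quaternion.

Section ConjMorphism.
Variables (R : nzRingType) (n : nat) (P P' : 'M[R]_n.+1).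
Variable (h : {rmorphism R -> R}).
Hypotheses (PP' : P *m P' = 1%:M) (P'P : P' *m P = 1%:M).

Lemma conj_mx_zmod : zmod_morphism (fun A => P *m map_mx h A *m P').
Proof. by move=> A B; rewrite map_mxB mulmxBr mulmxBl. Qed.

Lemma conj_mx_monoid : monoid_morphism (fun A => P *m map_mx h A *m P').
Proof.
split=> [|A B]; first by rewrite map_mx1 mulmx1.
rewrite -[A * B]/(A *m B) map_mxM -[RHS]/(_ *m _) -!mulmxA.
by rewrite (mulmxA P' P) P'P mul1mx.
Qed.
End ConjMorphism.

Section QPrime.
Variables (k : fieldType) (alpha beta gamma : k) (i : sqrtN1 k).
Local Notation Q := (skl alpha beta gamma).

(* Q' = Q (x) M_2(k) is identified with M_2(Q), u (x) m being the matrix with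
   entries u m_rs; then delta acts by A |-> q_delta delta(A) q_delta^-1, where
   delta(A) is entrywise. *)
Definition Qp_graded : gradedRing :=
  @GradedRing 'M[Q]_2 (fun n A => forall r s, skl_deg n (A r s)).

Definition Qp_act (d : Gam) (A : 'M[Q]_2) : 'M[Q]_2 :=
  map_mx (in_alg Q) (qmx i d) *m map_mx (skl_act d) A *m
  map_mx (in_alg Q) (invmx (qmx i d)).

Lemma Qp_act_zmod d : zmod_morphism (Qp_act d).
Proof. exact: conj_mx_zmod. Qed.
HB.instance Definition _ d := GRing.isZmodMorphism.Build 'M[Q]_2 'M[Q]_2
  (Qp_act d) (Qp_act_zmod d).

Lemma Qp_act_monoid d : monoid_morphism (Qp_act d).
Proof.
by apply: conj_mx_monoid; rewrite -map_mxM ?mulmxV ?mulVmx ?qmx_unit ?map_mx1.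
Qed.
HB.instance Definition _ d := GRing.isMonoidMorphism.Build 'M[Q]_2 'M[Q]_2
  (Qp_act d) (Qp_act_monoid d).

Definition Qt_inv : {pred 'M[Q]_2} := fun A => [forall d, Qp_act d A == A].

Lemma Qt_inv_subring : subring_closed Qt_inv.
Proof.
split=> [|A B|A B]; first by apply/forallP => d; rewrite rmorph1.
  move=> /forallP hA /forallP hB; apply/forallP => d.
  by apply/eqP; rewrite -[in RHS](eqP (hA d)) -[in RHS](eqP (hB d));
     exact: rmorphB.
move=> /forallP hA /forallP hB; apply/forallP => d.
by apply/eqP; rewrite -[in RHS](eqP (hA d)) -[in RHS](eqP (hB d));
   exact: rmorphM.
Qed.
HB.instance Definition _ := GRing.isSubringClosed.Build 'M[Q]_2 Qt_inv
  Qt_inv_subring.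

Record Qt := QtElt { Qt_val : 'M[Q]_2; _ : Qt_val \in Qt_inv }.
HB.instance Definition _ := [isSub for Qt_val].
HB.instance Definition _ := [Choice of Qt by <:].
HB.instance Definition _ := [SubChoice_isSubNzRing of Qt by <:].

Definition Qt_graded : gradedRing :=
  @GradedRing Qt (fun n y => @gr_deg Qp_graded n (val y)).

(* N (x) k^2 is identified with N^2 (columns), on which M_2(Q) acts *)
Section Column.
Variable N : lmodType Q.
Definition column : Type := 'cV[N]_2.
HB.instance Definition _ := GRing.Zmodule.on column.

Definition column_scale (A : 'M[Q]_2) (v : column) : column :=
  \col_r \sum_s A r s *: v s 0.

Lemma column_scaleA A B v :
  column_scale A (column_scale B v) = column_scale (A * B) v.
Proof.
apply/colP => r; rewrite !mxE.
under eq_bigr do rewrite mxE scaler_sumr.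
rewrite exchange_big; apply: eq_bigr => s _ /=.
by rewrite mxE scaler_suml; apply: eq_bigr => t _; rewrite scalerA.
Qed.
Lemma column_scale1 : left_id 1 column_scale.
Proof.
move=> v; apply/colP => r; rewrite !mxE (bigD1 r) //= mxE eqxx scale1r.
by rewrite big1 ?addr0 // => s sr; rewrite mxE eq_sym (negPf sr) scale0r.
Qed.
Lemma column_scaleDr : right_distributive column_scale +%R.
Proof.
move=> A u v; apply/colP => r; rewrite !mxE -big_split.
by apply: eq_bigr => s _; rewrite mxE scalerDr.
Qed.
Lemma column_scaleDl v : {morph column_scale^~ v : A B / A + B}.
Proof.
move=> A B; apply/colP => r; rewrite !mxE -big_split.
by apply: eq_bigr => s _; rewrite mxE scalerDl.
Qed.
HB.instance Definition _ := GRing.Zmodule_isLmodule.Build 'M[Q]_2 column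
  column_scaleA column_scale1 column_scaleDr column_scaleDl.
End Column.

Definition gcolumn (N : gradedModule (skl_graded alpha beta gamma)) :
    gradedModule Qp_graded :=
  @GradedModule Qp_graded (column N) (fun n v => forall r, @gm_deg _ N n (v r 0)).

Record eqModule := EqModule {
  em_mod :> gradedModule Qp_graded;
  em_graded : is_graded em_mod;
  em_act : Gam -> em_mod -> em_mod;
  em_act1 : forall m, em_act gam1 m = m;
  em_actM : forall d e m, em_act d (em_act e m) = em_act (gamM d e) m;
  em_actD : forall d m n, em_act d (m + n) = em_act d m + em_act d n;
  em_act_deg : forall d n m, gm_deg n m -> gm_deg n (em_act d m);
  em_act_semi : forall d (r : Qp_graded) m,
    em_act d (r *: m) = (Qp_act d r : Qp_graded) *: em_act d m }.

Definition eq_isom (M N : eqModule) : Prop :=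
  exists f : {linear M -> N},
    [/\ bijective f,
        forall n m, gm_deg n m <-> gm_deg n (f m)
      & forall d m, f (em_act d m) = em_act d (f m)].

Section Invariants.
Variable M : eqModule.

Definition em_inv : {pred M} := fun m => [forall d, em_act d m == m].

Lemma em_inv_zmod : zmod_closed em_inv.
Proof.
have h d (m n : M) : em_act d (m - n) = em_act d m - em_act d n.
  by apply: (addIr (em_act d n)); rewrite -em_actD !subrK.
split=> [|m n /forallP hm /forallP hn]; apply/forallP => d.
  by have := h d 0 0; rewrite !subrr => ->.
by rewrite h (eqP (hm d)) (eqP (hn d)).
Qed.
HB.instance Definition _ := GRing.isZmodClosed.Build M em_inv em_inv_zmod.

Record invs := InvElt { invs_val : M; _ : invs_val \in em_inv }.
HB.instance Definition _ := [isSub for invs_val].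
HB.instance Definition _ := [Choice of invs by <:].
HB.instance Definition _ := [SubChoice_isSubZmodule of invs by <:].

Lemma invs_scale_subproof (y : Qt) (m : invs) :
  (val y : Qp_graded) *: val m \in em_inv.
Proof.
apply/forallP => d; rewrite em_act_semi.
by rewrite (eqP (forallP (valP y) d)) (eqP (forallP (valP m) d)).
Qed.

Definition invs_scale (y : Qt) (m : invs) : invs :=
  InvElt (invs_scale_subproof y m).

Lemma invs_scaleA x y m : invs_scale x (invs_scale y m) = invs_scale (x * y) m.
Proof. by apply: val_inj; rewrite /= scalerA. Qed.
Lemma invs_scale1 : left_id 1 invs_scale.
Proof. by move=> m; apply: val_inj; rewrite /= scale1r. Qed.
Lemma invs_scaleDr : right_distributive invs_scale +%R.
Proof. by move=> x m n; apply: val_inj; rewrite /= scalerDr. Qed.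
Lemma invs_scaleDl m : {morph invs_scale^~ m : x y / x + y}.
Proof. by move=> x y; apply: val_inj; rewrite /= scalerDl. Qed.
HB.instance Definition _ := GRing.Zmodule_isLmodule.Build Qt invs
  invs_scaleA invs_scale1 invs_scaleDr invs_scaleDl.

Definition em_invs : gradedModule Qt_graded :=
  @GradedModule Qt_graded invs (fun n m => gm_deg n (val m)).

End Invariants.

End QPrime.

Section Curve.
Variables (k : fieldType) (alpha beta gamma : k).

Definition quad1 (v : 'rV[k]_4) : k := \sum_j v 0 j ^+ 2.
Definition quad2 (v : 'rV[k]_4) : k :=
  let x (j : nat) := v 0 (inord j) in
  (1 - gamma) * x 1 ^+ 2 + (1 + alpha * gamma) * x 2 ^+ 2
  + (1 + alpha) * x 3 ^+ 2.

Definition on_curve (p : gr k 1 4) : bool :=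
  (quad1 (vpick (val p)) == 0) && (quad2 (vpick (val p)) == 0).

Definition curve : Type := {p : gr k 1 4 | on_curve p}.
Definition cpt (p : curve) : {vspace 'rV[k]_4} := val (val p).
Definition ccoord (p : curve) : 'rV[k]_4 := vpick (cpt p).

Definition curve_space : kspace k := pvar ccoord.
Definition curve2_space : kspace k := pvar (segre ccoord ccoord).

Record groupLaw := GroupLaw {
  go : curve;
  ga : curve -> curve -> curve;
  gn : curve -> curve;
  gaA : associative ga;
  gaC : commutative ga;
  ga0 : left_id go ga;
  gaN : left_inverse go gn ga;
  ga_morph : @ks_morph k curve2_space curve_space (fun x => ga x.1 x.2);
  gn_morph : @ks_morph k curve_space curve_space gn }.

(* The action on P(Q_1^* ) induced by that of Gamma on Q_1; the matrices are
   their own inverses *)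
Definition gam_pt (d : Gam) (p : {vspace 'rV[k]_4}) : {vspace 'rV[k]_4} :=
  (linfun (mulmxr (diag_mx (\row_j (-1) ^+ gam_neg d j))) @: p)%VS.

(* The scheme-theoretic intersection of E with the line c = c' = 0 is
   (p) + (q). In coordinates (a : b) on the line, the binary quadratic forms
   quad1 and quad2 define the subscheme (p) + (q) of P^1 iff they span the
   line generated by the product of the linear forms vanishing at p and q. *)
Definition cuts (c c' : 'rV[k]_4) (p q : curve) : Prop :=
  exists b0 b1 : 'rV[k]_4,
    is_line c c' <<[:: b0; b1]>>%VS /\
    exists s t : k * k,
      [/\ cpt p = <[s.1 *: b0 + s.2 *: b1]>%VS,
          cpt q = <[t.1 *: b0 + t.2 *: b1]>%VS
        & exists e : k * k, e != (0, 0) /\ forall a b,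
            let l := (a * s.2 - b * s.1) * (a * t.2 - b * t.1) in
            quad1 (a *: b0 + b *: b1) = e.1 * l /\
            quad2 (a *: b0 + b *: b1) = e.2 * l].

Definition tors2 (G : groupLaw) : Type :=
  {xi : curve | (xi <> go G) /\ (ga G xi xi = go G)}.

Definition coset (G : groupLaw) (xi p q : curve) : Prop :=
  q = p \/ q = ga G p xi.

Definition curve_quot (G : groupLaw) (xi : tors2 G) : kspace k :=
  @ks_quot k curve_space (coset G (sval xi)).

End Curve.

Section Lines.
Variables (k : fieldType) (alpha beta gamma : k) (i : sqrtN1 k).
Local Notation Q := (skl_graded alpha beta gamma).
Local Notation E := (curve alpha gamma).
Variable G : groupLaw alpha gamma.

Definition skl_lin (c : 'rV[k]_4) : Q :=
  \sum_j c 0 j *: skl_x alpha beta gamma j.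

(* M is isomorphic to (M_{p,p+xi} + M_{p+xi',p+xi'+xi}) (x) k^2 for some p and
   some xi' in E[2] - {o, xi}, as a graded Q'-module *)
Definition of_type (xi : tors2 G) (M : eqModule alpha beta gamma i) : Prop :=
  exists (p : E) (xi' : tors2 G), sval xi' <> sval xi /\
  exists c1 c1' c2 c2' : 'rV[k]_4,
    let p' := ga G p (sval xi') in
    [/\ cuts c1 c1' p (ga G p (sval xi)),
        cuts c2 c2' p' (ga G p' (sval xi))
      & graded_isom M
          (gcolumn (gsum (@lquot2 Q (skl_lin c1) (skl_lin c1'))
                         (@lquot2 Q (skl_lin c2) (skl_lin c2'))))].

(* Gamma acts on x_j and on q_j = qmx (gamma_j) by the same character, so the
   elements y_j = x_j (x) q_j form a basis of Qtilde_1; it serves as the system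
   of coordinates on P(Qtilde_1^* ). *)
Definition Qt_y (j : 'I_4) : 'M[skl alpha beta gamma]_2 :=
  let q := qmx i
    (nth gam1 [:: gam1; (true, false); (false, true); (true, true)] j) in
  \matrix_(r, s) (q r s *: skl_x alpha beta gamma j).

Definition Qt_lin (c : 'rV[k]_4) : 'M[skl alpha beta gamma]_2 :=
  \matrix_(r, s) \sum_j c 0 j *: Qt_y j r s.

Definition has_line (M : eqModule alpha beta gamma i) (L : gr k 2 4) : Prop :=
  exists (c c' : 'rV[k]_4) (y y' : Qt alpha beta gamma i),
    [/\ val y = Qt_lin c, val y' = Qt_lin c', is_line c c' (val L)
      & graded_isom (em_invs M)
          (@lquot2 (Qt_graded alpha beta gamma i) y y')].

Definition locus (L : gr k 2 4) : Prop :=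
  exists xi M, of_type xi M /\ has_line M L.

Definition locus_space : kspace k :=
  pvar (fun L : {L : gr k 2 4 | locus L} => plucker (sval L)).

End Lines.

(* Main.v *)
(* For p in E with coordinates v, the chord through p and p + xi_r is cut out by
   v_r x_0 - v_0 x_r and v_t x_s - v_s x_t.  As Q' is the direct sum of the q_d Qtilde
   (Gamma-averaging), an equivariant module whose invariants form a line module is
   Q'/(Q'y + Q'y') for its line y = y' = 0, and is determined by that line.  For
   y = i v_r y_0 + v_0 y_r and y' = i v_t y_s - v_s y_t, diagonalizing q_r shows that the
   left ideal (y, y') consists of the matrices whose first column lies in the ideal of
   the chord of p and whose second column lies in that of the chord of p + xi_s, so
   Q'/(Q'y + Q'y') is of type xi_r.  Conversely a generator of an equivariant module of
   this type is fixed by Gamma, and its annihilator is one of the two left ideals obtained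
   in this way from p and p + xi_s.

   The line y = y' = 0 is spanned by v_0 e_0 - i v_r e_r and v_s e_s + i v_t e_t.  Its
   Plucker coordinates are the mixed products of {v_0, v_r} and {v_s, v_t}; by the
   equations of E, the forms of degree divisible by 4 which are invariant under
   translation by xi_r are polynomials in them.  Hence p |-> line identifies E/<xi_r>
   with a closed curve, given by the vanishing of two Plucker coordinates and a quadric,
   and products of two of the remaining coordinates separate the three curves. *)

Require Import Defs.
From HB Require Import structures.
From mathcomp Require Import all_boot all_algebra.
From mathcomp Require Import boolp finmap ring zify.
From mathcomp.multinomials Require mpoly.
From mathcomp.multinomials Require monalg.
Set Implicit Arguments.
Unset Strict Implicit.
Unset Printing Implicit Defensive.
Import GRing.Theory.
Local Open Scope ring_scope.

(** * The grading of Q *)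

Section FreeAlgebra.
Import monalg.

(** The algebra Q is known only through its presentation, so facts about it come from homomorphisms
    out of it: x_j -> x_j X into Q[X] yields the grading, and matrices with zero products yield the
    independence of 1 and the x_j. The left ideals in play are generated in degree 1, so membership
    reduces to linear algebra in degrees 0 and 1.

    The conditions on alpha, beta, gamma enter as the distinctness of the coefficients [ev] of
    [quad2]. At a point of E at most one coordinate then vanishes ([good]). This keeps chords and
    lines two-dimensional, makes the two chords of a module differ, and makes one of the separating
    products non-zero at each point.

    The obstacle in the descent to E/<xi_r> is that an invariant regular function is locally a
    fraction a/b with a and b not invariant. Invariance of the value allows a and b to be raised to
    degree 4m and symmetrized, but the symmetrized denominator may vanish at the given point; hence
    two candidates for it. A factor vanishing on the other two curves then extends the fraction to
    the whole locus. *)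

Lemma sk_rel_eq0 (k : fieldType) (A B : algType k) (h : {lrmorphism A -> B})
    (a : k) (x0 xr xs xt : A) :
  (forall f, f \in sk_rel a x0 xr xs xt -> h f = 0) ->
  h x0 * h xr - h xr * h x0 = a *: (h xs * h xt + h xt * h xs) /\
  h x0 * h xr + h xr * h x0 = h xs * h xt - h xt * h xs.
Proof.
move=> h0; split; apply/eqP; rewrite -subr_eq0; apply/eqP.
  rewrite -[RHS](h0 _ (mem_head _ _)).
  rewrite !rmorphB !rmorphM /=; congr (_ - _).
  by rewrite linearZ_LR rmorphD !rmorphM.
rewrite -[RHS](h0 (x0 * xr + xr * x0 - (xs * xt - xt * xs))).
  by rewrite !(rmorphB, rmorphD, rmorphM).
by rewrite !inE eqxx orbT.
Qed.

Lemma sk_rel_eval (k : fieldType) (A : algType k) (B : nzRingType)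
    (s : k -> B) (h : {rmorphism A -> B}) (a : k) (x0 xr xs xt : A) :
  (forall c u, h (c *: u) = s c * h u) ->
  h x0 * h xr - h xr * h x0 = s a * (h xs * h xt + h xt * h xs) /\
  h x0 * h xr + h xr * h x0 = h xs * h xt - h xt * h xs ->
  forall f, f \in sk_rel a x0 xr xs xt -> h f = 0.
Proof.
move=> hZ [e1 e2] f; rewrite !inE => /orP[]/eqP->.
  by rewrite !rmorphB !rmorphM hZ rmorphD !rmorphM e1 subrr.
by rewrite !(rmorphB, rmorphD, rmorphM) e2 subrr.
Qed.

Section Lift.
Variables (k : fieldType) (alpha beta gamma : k).
Local Notation Q := (skl alpha beta gamma).
Local Notation F := (freeAlg k 'I_4).
Local Notation x := (skl_x alpha beta gamma).

Definition skl_rel (a : k) (r s t : nat) : Prop :=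
  x (inord 0) * x (inord r) - x (inord r) * x (inord 0) =
    a *: (x (inord s) * x (inord t) + x (inord t) * x (inord s)) /\
  x (inord 0) * x (inord r) + x (inord r) * x (inord 0) =
    x (inord s) * x (inord t) - x (inord t) * x (inord s).

Lemma skl_rel_eq (a : k) (r s t : nat) :
  {subset sk_rel a (fgen k (inord 0 : 'I_4)) (fgen k (inord r))
      (fgen k (inord s)) (fgen k (inord t)) <= sk_rels alpha beta gamma} ->
  skl_rel a r s t.
Proof.
move=> sub.
apply: (@sk_rel_eq0 _ _ _ (@tsquot_pi k F _ (sk_rels_proper alpha beta gamma))).
move=> f /sub /tsideal_gen fS.
rewrite -(raddf0 (@tsquot_pi k F _ (sk_rels_proper alpha beta gamma))).
by apply/tsquot_piP; rewrite subr0.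
Qed.

Section Universal.
Variables (B : nzRingType) (s : {rmorphism k -> B}) (y : 'I_4 -> B).
Hypothesis sC : forall c b, GRing.comm (s c) b.

Let word (m : {fmonom 'I_4}) : B := \prod_(j <- m) y j.

Let word_mm : mmorphism word.
Proof.
by split=> [m n|]; rewrite /word ?fmM ?fm1 ?big_cat ?big_nil.
Qed.
HB.instance Definition _ := isMultiplicative.Build _ _ word word_mm.

Let fl : F -> B := mmap s word.
HB.instance Definition _ := GRing.Additive.on fl.
Let fl_mul : multiplicative fl.
Proof. by apply: commr_mmap_is_multiplicative => g m m'; apply: sC. Qed.
HB.instance Definition _ := GRing.isMultiplicative.Build F B fl fl_mul.

Let flZ c f : fl (c *: f) = s c * fl f.
Proof. exact: mmapZ. Qed.
Let fl_gen j : fl (fgen k j) = y j.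
Proof. rewrite /fl mmapU (_ : _ 1 = 1) ?mul1r; last exact: (rmorph1 s).
 by rewrite /word fmU big_seq1. Qed.

Let relB a r u v :=
  y (inord 0) * y (inord r) - y (inord r) * y (inord 0) =
    s a * (y (inord u) * y (inord v) + y (inord v) * y (inord u)) /\
  y (inord 0) * y (inord r) + y (inord r) * y (inord 0) =
    y (inord u) * y (inord v) - y (inord v) * y (inord u).
Hypotheses (r1 : relB alpha 1 2 3) (r2 : relB beta 2 3 1) (r3 : relB gamma 3 1 2).

Let fl_rel f : f \in sk_rels alpha beta gamma -> fl f = 0.
Proof.
have H a r u v : relB a r u v -> f \in sk_rel a (fgen k (inord 0 : 'I_4))
    (fgen k (inord r)) (fgen k (inord u)) (fgen k (inord v)) -> fl f = 0.
  move=> rB; apply: (@sk_rel_eval _ F B s fl) => //.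
  by rewrite /= !fl_gen.
by rewrite !mem_cat => /orP[/(H _ _ _ _ r1)|/orP[/(H _ _ _ _ r2)|/(H _ _ _ _ r3)]].
Qed.

Let fl_ideal f : f \in tsideal (sk_rels alpha beta gamma) -> fl f = 0.
Proof.
move=> /asboolP[l [lS ->]]; rewrite rmorph_sum big_seq big1 // => u /lS /fl_rel u0.
by rewrite !rmorphM /= u0 mulr0 mul0r.
Qed.

Let ql (u : Q) : B := fl (repr u).
Let ql_pi f : ql (skl_pi alpha beta gamma f) = fl f.
Proof.
apply/eqP; rewrite -subr_eq0 -rmorphB; apply/eqP/fl_ideal.
apply/(tsquot_piP (sk_rels_proper alpha beta gamma)).
exact: (tsquot_reprK (skl_pi alpha beta gamma f)).
Qed.

(** The universal property of Q. The target is a ring with a central image of k rather than a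
    k-algebra, so that [{poly Q}] and matrix rings can be used as they stand. *)
Lemma skl_lift : exists h : {rmorphism Q -> B},
  (forall f : F, h (skl_pi alpha beta gamma f) =
     mmap s (fun m : {fmonom 'I_4} => \prod_(j <- m) y j) f) /\
  (forall j, h (x j) = y j) /\ (forall c u, h (c *: u) = s c * h u).
Proof.
have qz : zmod_morphism ql.
  move=> u v; rewrite -[u]tsquot_reprK -[v]tsquot_reprK -rmorphB !ql_pi.
  by rewrite rmorphB.
have qm : monoid_morphism ql.
  split=> [|u v]; first by rewrite -[1](rmorph1 (skl_pi alpha beta gamma)) ql_pi rmorph1.
  by rewrite -[u]tsquot_reprK -[v]tsquot_reprK -rmorphM !ql_pi rmorphM.
pose h : {rmorphism Q -> B} := HB.pack ql (GRing.isZmodMorphism.Build _ _ ql qz)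
  (GRing.isMonoidMorphism.Build _ _ ql qm).
exists h; split; first exact: ql_pi.
split=> [j|c u]; first by rewrite [LHS]ql_pi fl_gen.
by rewrite -[u]tsquot_reprK -linearZ; rewrite [LHS]ql_pi flZ [h _]ql_pi.
Qed.
End Universal.
End Lift.

(** The relations are homogeneous of degree 2 and 'X is central, so replacing each x by x 'X
    multiplies both sides by 'X^2. *)
Lemma rel_poly (k : fieldType) (A : algType k) (a : k) (x0 xr xu xv : A) :
  x0 * xr - xr * x0 = a *: (xu * xv + xv * xu) /\
  x0 * xr + xr * x0 = xu * xv - xv * xu ->
  let y (z : A) : {poly A} := z%:P * 'X in
  y x0 * y xr - y xr * y x0 = (a%:A)%:P * (y xu * y xv + y xv * y xu) /\
  y x0 * y xr + y xr * y x0 = y xu * y xv - y xv * y xu.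
Proof.
move=> [e1 e2] y.
have yy u v : y u * y v = (u * v)%:P * 'X^2.
  by rewrite /y polyCM expr2 !mulrA -[_ * 'X * _]mulrA -commr_polyX !mulrA.
split.
  rewrite !(yy x0) !(yy xr) !(yy xu) !(yy xv) -mulrBl -mulrDl -polyCB -polyCD e1.
  by rewrite [RHS]mulrA -polyCM -scalerAl mul1r.
by rewrite !(yy x0) !(yy xr) !(yy xu) !(yy xv) -mulrBl -mulrDl -polyCB -polyCD e2.
Qed.

Lemma polyC_scaleMXn (k : fieldType) (A : algType k) (c : k) (v : A) n :
  (c%:A)%:P * (v%:P * 'X^n) = (c *: v)%:P * 'X^n.
Proof. by rewrite mulrA -polyCM -scalerAl mul1r. Qed.

Section Grading.
Variables (k : fieldType) (alpha beta gamma : k).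
Local Notation Q := (skl alpha beta gamma).
Local Notation F := (freeAlg k 'I_4).
Local Notation x := (skl_x alpha beta gamma).
Local Notation pi := (skl_pi alpha beta gamma).

Definition skl_word (s : seq 'I_4) : Q := \prod_(j <- s) x j.

Let piD f g : pi (f + g) = pi f + pi g. Proof. exact: tsquot_piD. Qed.
Let pi0 : pi 0 = 0. Proof. exact: (raddf0 (@tsquot_pi k F _ (sk_rels_proper alpha beta gamma))). Qed.
Let piM f g : pi (f * g) = pi f * pi g.
Proof. exact: (rmorphM (@tsquot_pi k F _ (sk_rels_proper alpha beta gamma))). Qed.
Let pi1 : pi 1 = 1. Proof. by []. Qed.
Let piZ c f : pi (c *: f) = c *: pi f.
Proof. exact: (linearZ_LR (@tsquot_pi k F _ (sk_rels_proper alpha beta gamma))). Qed.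
Let piK u : exists f, u = pi f.
Proof. by exists (repr u); rewrite [RHS]tsquot_reprK. Qed.

Let pi_word (m : {fmonom 'I_4}) : pi << m >> = skl_word m.
Proof.
case: m => s; rewrite /skl_word /=; elim: s => [|j s IH].
  by rewrite big_nil -pi1; congr pi; rewrite -fmE.
rewrite big_cons -IH -piM; congr pi.
rewrite (_ : FMonom (j :: s) = mmul (fmu j) (FMonom s)); last first.
  by rewrite -!fmE /mmul /= /fmmul !fmE /fmu fmE.
apply: esym; transitivity (fgmul (fgen k j) (<< FMonom s >> : F)).
  exact: malgM_def.
by rewrite /fgen fgmulUU mulr1.
Qed.

Let pi_sum f : pi f = \sum_(m <- msupp f) f@_m *: skl_word m.
Proof.
rewrite {1}[f]monalgE (big_morph _ piD pi0); apply: eq_bigr => m _.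
rewrite -pi_word -piZ; congr pi; apply/malgP => m'.
by rewrite [RHS]mcoeffZ [in LHS]mcoeffU [in RHS]mcoeffU mulr_natr.
Qed.

(** Moves the definition of degree from the free algebra to words in Q itself, where products of
    homogeneous elements are concatenations. *)
Lemma skl_degP n (u : Q) : skl_deg n u <-> exists2 l : seq (k * seq 'I_4),
  forall w, w \in l -> size w.2 = n & u = \sum_(w <- l) w.1 *: skl_word w.2.
Proof.
split=> [[f [fn ->]]|[l ln ->]].
  exists [seq (f@_m, fmonom_val m) | m <- msupp f] => [w /mapP[m mf ->]|].
    by apply: fn; rewrite mcoeff_neq0.
  by rewrite big_map pi_sum.
elim: l ln => [|w l IH] ln.
  by exists 0; rewrite big_nil pi0; split=> // m; rewrite mcoeff0 eqxx.
have [|f [fn fE]] := IH; first by move=> v vl; apply: ln; rewrite inE vl orbT.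
exists (w.1 *: << FMonom w.2 >> + f); split=> [m|].
  rewrite mcoeffD mcoeffZ mcoeffU1; have [<- _|_] := eqVneq (FMonom w.2) m.
    by rewrite /fdeg /= ln ?mem_head.
  by rewrite mulr0 add0r; apply: fn.
by rewrite big_cons piD piZ pi_word fE.
Qed.

Lemma skl_words u : exists l : seq (k * seq 'I_4),
  u = \sum_(w <- l) w.1 *: skl_word w.2.
Proof.
have [f ->] := piK u; exists [seq (f@_m, fmonom_val m) | m <- msupp f].
by rewrite big_map pi_sum.
Qed.

Lemma skl_deg0 n : skl_deg n (0 : Q).
Proof. by apply/skl_degP; exists [::]; rewrite ?big_nil. Qed.

Lemma skl_degD n (u v : Q) : skl_deg n u -> skl_deg n v -> skl_deg n (u + v).
Proof.
move=> /skl_degP[l ln ->] /skl_degP[l' ln' ->]; apply/skl_degP.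
exists (l ++ l') => [w|]; last by rewrite big_cat.
by rewrite mem_cat => /orP[/ln|/ln'].
Qed.

Lemma skl_degZ n c (u : Q) : skl_deg n u -> skl_deg n (c *: u).
Proof.
move=> /skl_degP[l ln ->]; apply/skl_degP.
exists [seq (c * w.1, w.2) | w <- l] => [w /mapP[v /ln vn ->] //|].
by rewrite big_map scaler_sumr; apply: eq_bigr => w _; rewrite scalerA.
Qed.

Lemma skl_deg_sum n (I : Type) (r : seq I) (P : pred I) (f : I -> Q) :
  (forall i, P i -> skl_deg n (f i)) -> skl_deg n (\sum_(i <- r | P i) f i).
Proof.
move=> fn; elim/big_ind: _ => //; [exact: skl_deg0|exact: skl_degD].
Qed.

Lemma skl_deg_word s : skl_deg (size s) (skl_word s).
Proof.
apply/skl_degP; exists [:: (1, s)]; first by move=> w; rewrite inE => /eqP ->.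
by rewrite big_seq1 scale1r.
Qed.

Lemma skl_deg_x j : skl_deg 1 (x j).
Proof. by have := skl_deg_word [:: j]; rewrite /skl_word big_seq1. Qed.

Lemma skl_deg1 : skl_deg 0 (1 : Q).
Proof. by have := skl_deg_word [::]; rewrite /skl_word big_nil. Qed.

Lemma skl_degM m n (u v : Q) :
  skl_deg m u -> skl_deg n v -> skl_deg (m + n) (u * v).
Proof.
move=> /skl_degP[l ln ->] /skl_degP[l' ln' ->].
rewrite mulr_suml big_seq; apply: skl_deg_sum => w /ln wn.
rewrite mulr_sumr big_seq; apply: skl_deg_sum => w' /ln' wn'.
rewrite -scalerAl -scalerAr; do 2!apply: skl_degZ.
by rewrite -wn -wn' -size_cat /skl_word -big_cat; apply: skl_deg_word.
Qed.

Lemma skl_ind (P : Q -> Prop) :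
  P 1 -> (forall u v, P u -> P v -> P (u + v)) -> (forall c u, P u -> P (c *: u)) ->
  (forall j u, P u -> P (x j * u)) -> forall u, P u.
Proof.
move=> P1 PD PZ Px u; have [l ->] := skl_words u.
elim: l => [|w l IH]; first by rewrite big_nil -(scale0r 1); apply: PZ.
rewrite big_cons; apply: (PD) => //; apply: PZ.
elim: w.2 => [|j s IHs]; first by rewrite /skl_word big_nil.
by rewrite /skl_word big_cons; apply: Px.
Qed.

Lemma skl_deg0P (u : Q) : skl_deg 0 u -> exists c : k, u = c%:A.
Proof.
move=> /skl_degP[l l0 ->]; elim: l l0 => [|[a s] l IH] l0.
  by exists 0; rewrite big_nil scale0r.
have [|c cE] := IH; first by move=> v vl; apply: l0; rewrite inE vl orbT.
have := l0 _ (mem_head _ _); case: s {l0} => //= _.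
exists (a + c); rewrite big_cons cE /skl_word big_nil.
exact: (esym (scalerDl (1 : Q) a c)).
Qed.

Local Notation rel := (skl_rel alpha beta gamma).

Lemma skl_rels : [/\ rel alpha 1 2 3, rel beta 2 3 1 & rel gamma 3 1 2].
Proof.
split; apply: skl_rel_eq => f fS.
- by rewrite /sk_rels mem_cat; apply/orP; left.
- by rewrite /sk_rels !mem_cat; apply/orP; right; apply/orP; left.
- by rewrite /sk_rels !mem_cat; apply/orP; right; apply/orP; right.
Qed.

Opaque skl.

(** The map x_j -> x_j 'X; it separates the degrees, because a word of length n goes to itself times
    'X^n. *)
Lemma skl_gradingE : exists h : {rmorphism Q -> {poly Q}},
  forall n (u : Q), skl_deg n u -> h u = u%:P * 'X^n.
Proof.
pose s : {rmorphism k -> {poly Q}} := polyC \o in_alg Q.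
have sC c b : GRing.comm (s c) b.
  apply/polyP => n; rewrite coefCM coefMC /=.
  by rewrite /= -scalerAl -scalerAr mul1r mulr1.
pose y j := (x j)%:P * 'X.
have R (a : k) r u v : rel a r u v ->
    y (inord 0) * y (inord r) - y (inord r) * y (inord 0) =
    s a * (y (inord u) * y (inord v) + y (inord v) * y (inord u)) /\
  y (inord 0) * y (inord r) + y (inord r) * y (inord 0) =
    y (inord u) * y (inord v) - y (inord v) * y (inord u).
  exact: rel_poly.
have [/R r1 /R r2 /R r3] := skl_rels.
have [h [_ [hx hZ]]] := skl_lift sC r1 r2 r3.
have hw w : h (skl_word w) = (skl_word w)%:P * 'X^(size w).
  rewrite /skl_word; elim: w => [|j w IH]; first by rewrite !big_nil rmorph1 mulr1.
  rewrite !big_cons rmorphM IH hx /y /= polyCM exprS !mulrA; congr (_ * _).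
  by rewrite -!mulrA; congr (_ * _); rewrite commr_polyX.
exists h => n u /skl_degP[l ln ->]; rewrite rmorph_sum rmorph_sum mulr_suml.
rewrite !big_seq; apply: eq_bigr => w /ln <-.
by rewrite hZ hw; exact: polyC_scaleMXn.
Qed.

Lemma skl_indep (a : k) (c : 'I_4 -> k) :
  a%:A + \sum_j c j *: x j = 0 :> Q -> a = 0 /\ forall j, c j = 0.
Proof.
pose s : {rmorphism k -> 'M[k]_5} := @scalar_mx k 5.
have sC a' b : GRing.comm (s a') b by apply: esym; exact: scalar_mxC.
(* All products of these matrices vanish, so both sides of every relation are 0; the first row of
   the image then displays all the coefficients. *)
pose y (j : 'I_4) : 'M[k]_5 := delta_mx 0 (lift 0 j).
have yy i j : y i * y j = 0 by apply: mul_delta_mx_0.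
have R a' r u v : y (inord 0) * y (inord r) - y (inord r) * y (inord 0) =
    s a' * (y (inord u) * y (inord v) + y (inord v) * y (inord u)) /\
  y (inord 0) * y (inord r) + y (inord r) * y (inord 0) =
    y (inord u) * y (inord v) - y (inord v) * y (inord u).
  by rewrite !yy !subr0 !addr0 mulr0.
have [h [_ [hx hZ]]] := skl_lift sC (R alpha 1 2 3)%N (R beta 2 3 1)%N (R gamma 3 1 2)%N.
move=> /(congr1 h); rewrite raddf0 rmorphD hZ rmorph1 mulr1 rmorph_sum /=.
under eq_bigr do rewrite hZ hx.
move=> e.
have e' : a%:M + \sum_j c j *: y j = 0 :> 'M[k]_5.
  by rewrite -[RHS]e; congr (_ + _); apply: eq_bigr => j _; rewrite -mul_scalar_mx.
have entry j : (a%:M + \sum_j c j *: y j) 0 j = 0 by rewrite e' mxE.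
split=> [|j].
  have := entry 0; rewrite !mxE eqxx summxE big1 ?addr0 // => j _.
  by rewrite !mxE mulr0.
have := entry (lift 0 j); rewrite !mxE mulr0n add0r summxE (bigD1 j) //=.
rewrite /y !mxE !eqxx /= mulr1 big1 ?addr0 // => i ij.
by rewrite !mxE (inj_eq lift_inj) eq_sym (negPf ij) mulr0.
Qed.

End Grading.

End FreeAlgebra.

(** * Quotients by two elements *)

Section LeftQuotientTheory.
Variables (R : nzRingType) (x x' : R).

Lemma lidealP (a : R) :
  reflect (exists b b', a = b * x + b' * x') (a \in lideal x x').
Proof. exact: asboolP. Qed.

Lemma lidealD a b : a \in lideal x x' -> b \in lideal x x' -> a + b \in lideal x x'.
Proof. by have [h0 hD] := lideal_submod x x'; move=> aI bI; rewrite -[a]mul1r; apply: hD. Qed.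

Lemma lideal0 : 0 \in lideal x x'.
Proof. by have [] := lideal_submod x x'. Qed.

Lemma lidealMl a b : b \in lideal x x' -> a * b \in lideal x x'.
Proof.
have [h0 hD] := lideal_submod x x'.
by move=> bI; rewrite -[_ * _]addr0; apply: hD.
Qed.

Lemma lideal_l : x \in lideal x x'.
Proof. by apply/lidealP; exists 1, 0; rewrite mul1r mul0r addr0. Qed.

Lemma lideal_r : x' \in lideal x x'.
Proof. by apply/lidealP; exists 0, 1; rewrite mul1r mul0r add0r. Qed.

Lemma lideal_sum (I : Type) (r : seq I) (P : pred I) (f : I -> R) :
  (forall i, P i -> f i \in lideal x x') -> \sum_(i <- r | P i) f i \in lideal x x'.
Proof. by move=> fI; elim/big_ind: _ => //; [exact: lideal0|exact: lidealD]. Qed.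

Lemma lideal_kill (N : lmodType R) (m : N) a :
  x *: m = 0 -> x' *: m = 0 -> a \in lideal x x' -> a *: m = 0.
Proof.
move=> xm x'm /lidealP[b [b' ->]].
by rewrite scalerDl -!scalerA xm x'm !scaler0 addr0.
Qed.

Lemma lquot_pi_eq a b : lquot_pi x x' a = lquot_pi x x' b <-> a - b \in lideal x x'.
Proof. by split=> /(lquot_piP x x' a b). Qed.

Lemma lquot_pi_eq0 a : lquot_pi x x' a = 0 <-> a \in lideal x x'.
Proof.
rewrite -[a in X in _ <-> X]subr0 -lquot_pi_eq; split=> ->.
  by apply: (addIr (lquot_pi x x' 0)); rewrite -lquot_piD !addr0 add0r.
by apply: (addIr (lquot_pi x x' 0)); rewrite -lquot_piD !addr0 add0r.
Qed.

Lemma lquot_pi0 : lquot_pi x x' 0 = 0.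
Proof. exact/lquot_pi_eq0/lideal0. Qed.

Lemma lquot_piB a b : lquot_pi x x' (a - b) = lquot_pi x x' a - lquot_pi x x' b.
Proof. by apply: (addIr (lquot_pi x x' b)); rewrite -lquot_piD !subrK. Qed.

Lemma lquot_piZ a b : a *: lquot_pi x x' b = lquot_pi x x' (a * b).
Proof. exact: lquot_scale_pi. Qed.

Lemma lquot_pi_surj (v : lquot x x') : exists a, v = lquot_pi x x' a.
Proof. by exists (repr v); rewrite lquot_reprK. Qed.

Lemma lquot_pi_sum (I : Type) (r : seq I) (P : pred I) (f : I -> R) :
  lquot_pi x x' (\sum_(i <- r | P i) f i) = \sum_(i <- r | P i) lquot_pi x x' (f i).
Proof. exact: (big_morph _ (lquot_piD x x') lquot_pi0). Qed.

Lemma lquot_lift (N : lmodType R) (m : N) : x *: m = 0 -> x' *: m = 0 ->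
  exists f : {linear lquot x x' -> N}, forall a, f (lquot_pi x x' a) = a *: m.
Proof.
move=> xm x'm; pose f (v : lquot x x') : N := repr v *: m.
have fE a : f (lquot_pi x x' a) = a *: m.
  apply/eqP; rewrite -subr_eq0 -scalerBl.
  have /lidealP[b [b' ->]] : repr (lquot_pi x x' a) - a \in lideal x x'.
    by apply/lquot_pi_eq; rewrite lquot_reprK.
  by rewrite scalerDl -!scalerA xm x'm !scaler0 addr0.
have f_lin : linear f.
  move=> a u v; have [b ->] := lquot_pi_surj u; have [c ->] := lquot_pi_surj v.
  by rewrite lquot_piZ -lquot_piD !fE scalerDl scalerA.
pose g : {linear lquot x x' -> N} := HB.pack f (GRing.isLinear.Build _ _ _ _ f f_lin).
by exists g.
Qed.

End LeftQuotientTheory.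

Lemma lideal_sub (R : nzRingType) (x x' y y' : R) :
  y \in lideal x x' -> y' \in lideal x x' -> {subset lideal y y' <= lideal x x'}.
Proof.
move=> yI y'I a /lidealP[b [b' ->]].
by apply: lidealD; apply: lidealMl.
Qed.

(** * Gradings presented by their projections, and graded left quotients *)

Record grading (R : gradedRing) (pr : nat -> R -> R) : Prop := Grading {
  prD : forall n a b, pr n (a + b) = pr n a + pr n b;
  pr_deg : forall n a, gr_deg n (pr n a);
  pr_id : forall n m a, gr_deg n a -> pr m a = if n == m then a else 0;
  pr_sum : forall a, exists N, a = \sum_(n < N) pr n a;
  grdeg1 : gr_deg 0 (1 : R);
  grdegM : forall m n (a b : R), gr_deg m a -> gr_deg n b -> gr_deg (m + n) (a * b) }.

Section Graded.
Variables (R : gradedRing) (pr : nat -> R -> R).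
Hypothesis prR : grading pr.

Lemma pr0 n : pr n 0 = 0.
Proof. by apply: (addIr (pr n 0)); rewrite -(prD prR) !add0r. Qed.

Lemma grdeg_pr n a : gr_deg n a <-> pr n a = a.
Proof.
split=> [/(pr_id prR n) ->|<-]; first by rewrite eqxx.
exact: (pr_deg prR).
Qed.

Lemma grdeg0 n : gr_deg n (0 : R).
Proof. by apply/grdeg_pr/pr0. Qed.

Lemma grdegD n (a b : R) : gr_deg n a -> gr_deg n b -> gr_deg n (a + b).
Proof. by rewrite !grdeg_pr (prD prR) => -> ->. Qed.

Lemma prN n a : pr n (- a) = - pr n a.
Proof. by apply: (addIr (pr n a)); rewrite -(prD prR) !addNr pr0. Qed.

Lemma grdegB n (a b : R) : gr_deg n a -> gr_deg n b -> gr_deg n (a - b).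
Proof. by rewrite !grdeg_pr (prD prR) prN => -> ->. Qed.

Lemma pr_big n (I : Type) (r : seq I) (P : pred I) (f : I -> R) :
  pr n (\sum_(i <- r | P i) f i) = \sum_(i <- r | P i) pr n (f i).
Proof. exact: (big_morph _ (prD prR n) (pr0 n)). Qed.

Lemma prS n (a y : R) : gr_deg 1 y -> pr n.+1 (a * y) = pr n a * y.
Proof.
move=> y1; have [N ->] := pr_sum prR a; rewrite mulr_suml !pr_big mulr_suml.
apply: eq_bigr => m _; rewrite (pr_id prR n.+1 (grdegM prR (pr_deg prR m a) y1)).
rewrite addn1 eqSS (pr_id prR n (pr_deg prR m a)).
by case: eqP => // _; rewrite mul0r.
Qed.

Lemma prS0 (a y : R) : gr_deg 1 y -> pr 0 (a * y) = 0.
Proof.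
move=> y1; have [N ->] := pr_sum prR a; rewrite mulr_suml pr_big big1 // => m _.
by rewrite (pr_id prR 0 (grdegM prR (pr_deg prR m a) y1)) addn1.
Qed.

Section Quotient.
Variables y y' : R.
Hypotheses (y1 : gr_deg 1 y) (y1' : gr_deg 1 y').

Lemma pr_lideal n a : a \in lideal y y' -> pr n a \in lideal y y'.
Proof.
move=> /lidealP[b [b' ->]]; apply/lidealP; rewrite (prD prR).
case: n => [|n]; first by exists 0, 0; rewrite !prS0 // !mul0r.
by exists (pr n b), (pr n b'); rewrite !prS.
Qed.

Lemma deg0_lideal a : gr_deg 0 a -> a \in lideal y y' -> a = 0.
Proof.
move=> /grdeg_pr a0 /lidealP[b [b' e]].
by rewrite -a0 e (prD prR) !prS0 // addr0.
Qed.

(** The generators have degree 1, so the degree 1 part of an equation only sees the degree 0 parts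
    of the coefficients. *)
Lemma deg1_lideal a : gr_deg 1 a -> a \in lideal y y' ->
  exists b b', [/\ gr_deg 0 b, gr_deg 0 b' & a = b * y + b' * y'].
Proof.
move=> /grdeg_pr a0 /lidealP[b [b' e]]; exists (pr 0 b), (pr 0 b').
by split; rewrite -1?a0 ?e ?(prD prR) ?prS //; apply: (pr_deg prR).
Qed.

Lemma lquot2_graded : is_graded (@lquot2 R y y').
Proof.
have z n : gm_deg n (0 : @lquot2 R y y').
  by case: n => //= n; exists 0; rewrite lquot_pi0; split=> //; apply: grdeg0.
split.
- move=> n; split=> // u v; case: n => [n|n] /=; last by move=> -> ->; rewrite subr0.
  move=> [a [an ->]] [b [bn ->]]; exists (a - b); split; first exact: grdegB.
  apply: (addIr (lquot_pi y y' b)); rewrite -lquot_piD !subrK //.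
- move=> i n a v ai; case: n => [n|n] /=; last by move=> ->; rewrite scaler0; apply: z.
  move=> [b [bn ->]]; exists (a * b); rewrite lquot_piZ; split=> //.
  exact: (grdegM prR).
- move=> v; have [a ->] := lquot_pi_surj v; have [N aE] := pr_sum prR a.
  exists [seq Posz n | n <- iota 0 N].
  exists (fun n => if n is Posz n then lquot_pi y y' (pr n a) else 0); split.
    by case=> [n|n] //=; exists (pr n a); split=> //; apply: (pr_deg prR).
  rewrite big_map {1}aE -lquot_pi_sum; congr lquot_pi.
  by rewrite -(big_mkord xpredT (fun n => pr n a)) /index_iota subn0.
move=> s w us wd w0 n ns.
(* The disjunction says that [a] has degree m when m is a natural number; in negative degrees the
   representative is 0. *)
have /choice[a aP] : forall m : int, exists a : R, w m = lquot_pi y y' a /\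
    (forall j, gr_deg j a \/ m <> Posz j) /\ (if m is Posz _ then True else a = 0).
  move=> m; have := wd m; case: m => [m|m] /= => [[a [am ->]]|->].
    exists a; split=> //; split=> // j; case: (eqVneq m j) => [<-|mj]; first by left.
    by right; case; apply/eqP.
  by exists 0; rewrite lquot_pi0; split=> //; split=> // j; left; exact: grdeg0.
have := wd n; case: n ns => [n|n] //= ns _.
have sI : \sum_(m <- s) a m \in lideal y y'.
  apply/lquot_pi_eq0; rewrite lquot_pi_sum -[RHS]w0; apply: eq_bigr => m _.
  by case: (aP m) => <-.
have [-> _] := aP (Posz n); apply/lquot_pi_eq0.
(* The sum of the representatives lies in the ideal, and the ideal is homogeneous, so each component
   of the sum lies in it too. *)
suff -> : a (Posz n) = pr n (\sum_(m <- s) a m) by apply: pr_lideal.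
rewrite pr_big (bigD1_seq (Posz n)) //= big1 ?addr0 => [|m mn].
  case: (aP (Posz n)) => _ [] /(_ n) [|//] an _.
  by rewrite (pr_id prR n an) eqxx.
case: (aP m) => _ []; case: m mn => [m|m] mn; last by move=> _ ->; rewrite pr0.
move=> /(_ m)[|//] am _; rewrite (pr_id prR n am); case: eqP => // mn'.
by rewrite mn' eqxx in mn.
Qed.

End Quotient.
End Graded.

(** Projecting the finite decomposition shows that all components beyond its bound vanish. The bound
    can thus be enlarged, for instance to a common one for several elements. *)
Lemma grading_vanish (R : gradedRing) (pr : nat -> R -> R) : grading pr ->
  forall a, exists N, forall M, (N <= M)%N -> a = \sum_(n < M) pr n a.
Proof.
move=> prR a; have [N aE] := pr_sum prR a; exists N => M NM.
rewrite -(big_mkord xpredT (fun n => pr n a)) (big_cat_nat (leq0n N) NM) /=.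
rewrite big_mkord -aE big_nat big1 ?addr0 // => m /andP[Nm _].
rewrite aE (pr_big prR) big1 // => j _.
rewrite (pr_id prR _ (pr_deg prR j a)); case: eqP => // jm.
by have := ltn_ord j; rewrite jm ltnNge Nm.
Qed.

Section SklGrading.
Variables (k : fieldType) (alpha beta gamma : k).
Local Notation Q := (skl alpha beta gamma).
Local Notation x := (skl_x alpha beta gamma).

Lemma skl_grading : exists pr, @grading (skl_graded alpha beta gamma) pr.
Proof.
have [h hdeg] := skl_gradingE alpha beta gamma.
(* The degree n component is the coefficient of 'X^n in the image under x_j -> x_j 'X. *)
pose pr n (u : Q) := (h u)`_n.
have prD n u v : pr n (u + v) = pr n u + pr n v by rewrite /pr rmorphD coefD.
have prid n m u : skl_deg n u -> pr m u = if n == m then u else 0.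
  by move=> /hdeg hu; rewrite /pr hu coefCM coefXn eq_sym; case: eqP; rewrite ?mulr1 ?mulr0.
have pr0 n : pr n 0 = 0 by rewrite /pr rmorph0 coef0.
have words u : exists l : seq Q, (forall v, v \in l -> exists n, skl_deg n v) /\
    u = \sum_(v <- l) v.
  have [l ->] := skl_words u; exists [seq w.1 *: skl_word alpha beta gamma w.2 | w <- l].
  rewrite big_map; split=> // v /mapP[w _ ->]; exists (size w.2).
  exact/skl_degZ/skl_deg_word.
exists pr; split=> //.
- move=> n u; have [l [ld ->]] := words u.
  rewrite (big_morph _ (prD n) (pr0 n)) big_seq; apply: skl_deg_sum => v /ld[m vm].
  rewrite (prid _ _ _ vm); case: eqP => [<- //|_]; exact: skl_deg0.
- move=> u; have [l [ld ->]] := words u; elim: l ld => [|v l IH] ld.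
    by exists 0; rewrite big_ord0 big_nil.
  have [|N NE] := IH; first by move=> w wl; apply: ld; rewrite inE wl orbT.
  have [m vm] := ld _ (mem_head _ _).
  have van M : (N <= M)%N -> pr M (\sum_(v <- l) v) = 0.
    move=> NM; rewrite NE (big_morph _ (prD M) (pr0 M)) big1 // => j _.
    have pd : skl_deg j (pr j (\sum_(v <- l) v)).
      rewrite (big_morph _ (prD j) (pr0 j)) big_seq; apply: skl_deg_sum => w wl.
      have [|p wp] := ld w; first by rewrite inE wl orbT.
      rewrite (prid _ _ _ wp); case: eqP => [<- //|_]; exact: skl_deg0.
    rewrite (prid _ _ _ pd); case: eqP => // jM.
    by have := ltn_ord j; rewrite jM ltnNge NM.
  exists (N + m.+1)%N; rewrite big_cons.
  transitivity (\sum_(n < N + m.+1) (pr n v + pr n (\sum_(w <- l) w))); last first.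
    by apply: eq_bigr => n _; rewrite -prD.
  rewrite big_split /=; congr (_ + _).
    have mlt : (m < N + m.+1)%N by rewrite addnS ltnS leq_addl.
    rewrite (bigD1 (Ordinal mlt)) //= (prid _ _ _ vm) eqxx big1 ?addr0 // => j.
    rewrite (prid _ _ _ vm); case: (m =P j) => // mj.
    by move=> /negP[]; apply/eqP/val_inj.
  rewrite big_split_ord /= [X in _ = _ + X]big1 ?addr0 // => j _.
  by apply: van; rewrite leq_addr.
- exact: skl_deg1.
- move=> m n a b; exact: skl_degM.
Qed.

Lemma skl_actZ d c (u : Q) : skl_act d (c *: u) = c *: skl_act d u.
Proof. exact: linearZ_LR. Qed.

Lemma skl_actD d (u v : Q) : skl_act d (u + v) = skl_act d u + skl_act d v.
Proof. exact: raddfD. Qed.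

Opaque skl skl_act.

Lemma skl_act_deg d n (u : Q) : skl_deg n u -> skl_deg n (skl_act d u).
Proof.
move=> /skl_degP[l ln ->]; rewrite rmorph_sum big_seq; apply: skl_deg_sum => w /ln wn.
rewrite /= skl_actZ; apply: skl_degZ; rewrite -wn.
elim: {w wn}(w.2) => [|j s IH].
  by rewrite /skl_word big_nil rmorph1; apply: skl_deg1.
rewrite /skl_word big_cons rmorphM /= skl_act_x -scalerAl.
by apply/skl_degZ/(skl_degM (skl_deg_x _ _ _ _)).
Qed.

Lemma skl_ext (f g : {lrmorphism Q -> Q}) :
  (forall j, f (x j) = g (x j)) -> f =1 g.
Proof.
move=> fg; elim/skl_ind => [|u v IHu IHv|c u IH|j u IH].
- by rewrite !rmorph1.
- by rewrite !rmorphD /= IHu IHv.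
- by rewrite !linearZ_LR /= IH.
- by rewrite !rmorphM /= IH fg.
Qed.

Lemma skl_actM d e (u : Q) : skl_act d (skl_act e u) = skl_act (gamM d e) u.
Proof.
move: u; apply: (@skl_ext (skl_act d \o skl_act e) (skl_act (gamM d e))) => j.
rewrite /= [in LHS]skl_act_x [in RHS]skl_act_x skl_actZ skl_act_x scalerA.
have -> // : (-1) ^+ gam_neg (gamM d e) j = (-1) ^+ gam_neg e j * (-1) ^+ gam_neg d j :> k.
rewrite -signr_addb; congr (_ ^+ (nat_of_bool _)).
by case: j => [[|[|[|[|?]]]] ?] //; case: d e => [[] []] [[] []].
Qed.

Lemma skl_act_1 (u : Q) : skl_act gam1 u = u.
Proof.
move: u; apply: (@skl_ext (skl_act gam1) idfun) => j.
rewrite /= skl_act_x (_ : gam_neg gam1 j = false) ?expr0 ?scale1r //.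
by case: j => [[|[|[|[|?]]]] ?].
Qed.

End SklGrading.

(** * Averaging over Gamma *)

(** The alternating form on Gamma, seen as a plane over the field with two elements: (-1)^chi is the
    commutator of q_d and q_e. As a function of d it is the character by which Gamma acts on q_e. *)
Definition chi (d e : Gam) : bool := (d.1 && e.2) (+) (d.2 && e.1).

Lemma sum_Gam (V : nmodType) (f : Gam -> V) :
  \sum_(d : Gam) f d =
  f (true, true) + f (true, false) + (f (false, true) + f (false, false)).
Proof.
transitivity (\sum_(d : bool * bool) f (d.1, d.2)).
  by apply: eq_bigr => -[].
by rewrite -(pair_bigA _ (fun a b => f (a, b))) /= !big_bool.
Qed.

Lemma sum_chi (R : comNzRingType) (e : Gam) :
  \sum_(d : Gam) (-1) ^+ chi d e = if e == gam1 then 4%:R else 0 :> R.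
Proof. by rewrite sum_Gam; case: e => [[] []] /=; ring. Qed.

Lemma sum_chi' (R : comNzRingType) (d : Gam) :
  \sum_(e : Gam) (-1) ^+ chi d e = if d == gam1 then 4%:R else 0 :> R.
Proof.
rewrite -(sum_chi R d); apply: eq_bigr => e _; congr (_ ^+ (nat_of_bool _)).
by case: d e => [[] []] [[] []].
Qed.

Section QMatrices.
Variables (k : fieldType) (i : sqrtN1 k).
Local Notation q := (qmx i).

Lemma qmx_comm d e : q d *m q e = (-1) ^+ chi d e *: (q e *m q d).
Proof.
case: d e => [[] []] [[] []]; rewrite /qmx /chi /= ?(mulmx1, mul1mx, expr0, scale1r) //;
  apply/matrixP => -[[|[|?]] ?] [[|[|?]] ?] //;
  rewrite !mxE !big_ord_recl !big_ord0 !mxE /=;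
  rewrite ?(mulrN, mulNr, mul0r, mulr0, mul1r, mulr1, opprK, oppr0, addr0, add0r) //.
Qed.

Lemma qmx_mul d e : exists b : bool, q d *m q e = (-1) ^+ b *: q (gamM d e).
Proof.
have /eqP ii := valP i; rewrite expr2 in ii.
pose s := ((d.1 && e.1) (+) (d.2 && e.2)) (+) (d.2 && e.1).
exists s; rewrite {}/s.
case: d e => [[] []] [[] []]; rewrite /qmx /= ?(mulmx1, mul1mx, expr0, scale1r) //;
  apply/matrixP => -[[|[|?]] ?] [[|[|?]] ?] //;
  rewrite !mxE ?big_ord_recl ?big_ord0 !mxE /=;
  rewrite ?(mulrN, mulNr, mul0r, mulr0, mul1r, mulr1, opprK, oppr0, addr0, add0r, ii) //.
Qed.
End QMatrices.

Lemma gamMM d e : gamM d (gamM d e) = e.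
Proof. by case: d e => [[] []] [[] []]. Qed.

Lemma gamMeq1 d e : (gamM d e == gam1) = (d == e).
Proof. by case: d e => [[] []] [[] []]. Qed.

Lemma reindex_gamM (V : nmodType) (e : Gam) (f : Gam -> V) :
  \sum_(d : Gam) f (gamM e d) = \sum_d f d.
Proof.
rewrite [RHS](reindex (gamM e)) //; exists (gamM e) => d _; exact: gamMM.
Qed.

Section GammaAction.
Variables (k : fieldType) (i : sqrtN1 k) (R : nzRingType).
Variables (act : Gam -> R -> R) (iota : {rmorphism 'M[k]_2 -> R}).
Local Notation q := (qmx i).
Local Notation q' d := (invmx (qmx i d)).
Hypothesis hk : (2%:R : k) != 0.
Hypothesis iotaC : forall c r, iota c%:M * r = r * iota c%:M.
Hypothesis act_iota : forall d B, act d (iota B) = iota (q d *m B *m q' d).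

Lemma four_neq0 : (4%:R : k) != 0.
Proof. by rewrite (natrM _ 2 2) mulf_neq0. Qed.

Lemma qV d : q d *m q' d = 1%:M. Proof. by rewrite mulmxV ?qmx_unit. Qed.
Lemma Vq d : q' d *m q d = 1%:M. Proof. by rewrite mulVmx ?qmx_unit. Qed.

Lemma iotaM A B : iota (A *m B) = iota A * iota B.
Proof. exact: rmorphM. Qed.
Lemma iotaZ c A : iota (c *: A) = iota c%:M * iota A.
Proof. by rewrite -iotaM mul_scalar_mx. Qed.
Lemma iota1 : iota 1%:M = 1. Proof. exact: rmorph1. Qed.

Lemma qmx_conj d e : q d *m q e *m q' d = (-1) ^+ chi d e *: q e.
Proof. by rewrite qmx_comm -scalemxAl -mulmxA qV mulmx1. Qed.

Lemma qmx_conjV d e : q d *m q' e *m q' d = (-1) ^+ chi d e *: q' e.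
Proof.
have e1 : q d *m q' e = (-1) ^+ chi d e *: (q' e *m q d).
  have C : q e *m q d = (-1) ^+ chi d e *: (q d *m q e).
    by rewrite (qmx_comm i d e) scalerA -signr_addb addbb scale1r.
  transitivity (q' e *m (q e *m q d) *m q' e); first by rewrite !mulmxA Vq mul1mx.
  by rewrite C -scalemxAr -scalemxAl -!mulmxA qV mulmx1.
by rewrite e1 -scalemxAl -mulmxA qV mulmx1.
Qed.

Lemma iota_scale0 (V : lmodType R) (c : k) (m : V) :
  c != 0 -> iota c%:M *: m = 0 -> m = 0.
Proof.
move=> c0 e; rewrite -[m]scale1r -iota1 -(mulVf c0) scalar_mxM iotaM -scalerA e.
exact: scaler0.
Qed.

Section Module.
Variables (V : lmodType R) (vact : Gam -> V -> V).
Hypothesis vact1 : forall v, vact gam1 v = v.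
Hypothesis vactM : forall d e v, vact d (vact e v) = vact (gamM d e) v.
Hypothesis vactD : forall d u v, vact d (u + v) = vact d u + vact d v.
Hypothesis vact_semi : forall d r v, vact d (r *: v) = act d r *: vact d v.

Definition fixed (v : V) := forall d, vact d v = v.
(** The projection to the invariants. As V is a module over R only, the scalar 1/4 acts through
    [iota]. *)
Definition avg (v : V) : V := iota (4%:R^-1)%:M *: \sum_d vact d v.

Lemma vact0 d : vact d 0 = 0.
Proof. by apply: (addIr (vact d 0)); rewrite -vactD !add0r. Qed.

Lemma vact_sum d (I : Type) (r : seq I) (P : pred I) (f : I -> V) :
  vact d (\sum_(j <- r | P j) f j) = \sum_(j <- r | P j) vact d (f j).
Proof. exact: (big_morph _ (vactD d) (vact0 d)). Qed.

Lemma avgD u v : avg (u + v) = avg u + avg v.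
Proof.
rewrite /avg -scalerDr -big_split; congr (_ *: _).
by apply: eq_bigr => d _; rewrite vactD.
Qed.

Lemma avg0 : avg 0 = 0.
Proof. by apply: (addIr (avg 0)); rewrite -avgD !add0r. Qed.

Lemma avg_sum (I : Type) (r : seq I) (P : pred I) (f : I -> V) :
  avg (\sum_(j <- r | P j) f j) = \sum_(j <- r | P j) avg (f j).
Proof. exact: (big_morph _ avgD avg0). Qed.

Lemma act_scalar d c : act d (iota c%:M) = iota c%:M.
Proof.
by rewrite act_iota scalar_mxC -mulmxA qV mulmx1.
Qed.

Lemma avg_fixed v : fixed (avg v).
Proof.
move=> e; rewrite /avg vact_semi act_scalar vact_sum; congr (_ *: _).
by rewrite -[RHS](reindex_gamM e); apply: eq_bigr => d _; rewrite vactM.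
Qed.

Lemma avg_id v : fixed v -> avg v = v.
Proof.
move=> fv; rewrite /avg (eq_bigr (fun=> v)) => [|d _]; last exact: fv.
rewrite sumr_const (_ : #|Gam| = 4%N) ?card_prod ?card_bool //.
have e4 : iota (4%:R)%:M = 4%:R by rewrite (rmorph_nat (@scalar_mx k 2)) rmorph_nat.
by rewrite -scaler_nat -e4 scalerA -iotaM -scalar_mxM mulVf ?four_neq0 // iota1 scale1r.
Qed.

Lemma avgZ r v : (forall d, act d r = r) -> avg (r *: v) = r *: avg v.
Proof.
move=> fr; rewrite /avg scalerA -iotaC -scalerA; congr (_ *: _); rewrite scaler_sumr.
by apply: eq_bigr => d _; rewrite vact_semi fr.
Qed.

Definition ravg (r : R) : R := iota (4%:R^-1)%:M * \sum_d act d r.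

Lemma avgZr r v : fixed v -> avg (r *: v) = ravg r *: v.
Proof.
move=> fv; rewrite /avg /ravg -scalerA; congr (_ *: _); rewrite scaler_suml.
by apply: eq_bigr => d _; rewrite vact_semi fv.
Qed.

(** Fourier inversion on Gamma: the term of index e is the projection to the component on which
    Gamma acts by the character of q_e, and by orthogonality the sum over e keeps only the summand d
    = 1. *)
Lemma avg_decomp v : v = \sum_e iota (q e) *: avg (iota (q' e) *: v).
Proof.
have E e : iota (q e) *: avg (iota (q' e) *: v) =
    iota (4%:R^-1)%:M *: \sum_d iota ((-1) ^+ chi d e)%:M *: vact d v.
  rewrite /avg scalerA -iotaC -scalerA; congr (_ *: _); rewrite scaler_sumr.
  apply: eq_bigr => d _; rewrite vact_semi scalerA act_iota -iotaM qmx_conjV.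
  by rewrite -scalemxAr qV scalemx1.
rewrite (eq_bigr _ (fun e _ => E e)) -scaler_sumr exchange_big /=.
have Z d : \sum_e iota ((-1) ^+ chi d e)%:M *: vact d v =
    iota (if d == gam1 then 4%:R else 0)%:M *: vact d v.
  by rewrite -scaler_suml -rmorph_sum -rmorph_sum sum_chi'.
rewrite (eq_bigr _ (fun d _ => Z d)) (bigD1 gam1) //= vact1.
rewrite [X in _ *: (_ + X)]big1 ?addr0 => [|d /negPf ->]; last first.
  by rewrite !raddf0 scale0r.
rewrite scalerA -iotaM.
by rewrite -scalar_mxM mulVf ?four_neq0 // iota1 scale1r.
Qed.

Lemma ravg_q e : ravg (iota (q e)) = if e == gam1 then 1 else 0.
Proof.
rewrite /ravg; under eq_bigr do rewrite act_iota qmx_conj iotaZ.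
rewrite -mulr_suml -rmorph_sum -rmorph_sum sum_chi; case: eqP => [->|_].
  by rewrite mulrA -(iotaM _%:M _%:M) -scalar_mxM mulVf ?four_neq0 // iota1 ?mul1r ?iota1 ?mulr1.
by rewrite !raddf0 mul0r mulr0.
Qed.

(** Multiplying the relation by q_f and averaging isolates m_f: q_f q_e is a sign times the q of the
    product, whose average is 0 unless e = f. *)
Lemma avg_indep (m : Gam -> V) : (forall e, fixed (m e)) ->
  \sum_e iota (q e) *: m e = 0 -> forall e, m e = 0.
Proof.
move=> fm s0 f; have := congr1 (fun v => avg (iota (q f) *: v)) s0.
rewrite scaler0 avg0 scaler_sumr avg_sum (bigD1 f) //= big1 ?addr0.
  have [b qb] := qmx_mul i f f.
  rewrite scalerA -iotaM qb iotaZ -scalerA avgZ ?avgZr // => [|d]; last first.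
    exact: act_scalar.
  rewrite ravg_q gamMeq1 eqxx scale1r => /(congr1 (fun v => iota ((-1) ^+ b)%:M *: v)).
  rewrite scaler0 scalerA -iotaM -scalar_mxM -signr_addb addbb iota1 scale1r //.
move=> e ef; have [b qb] := qmx_mul i f e.
rewrite scalerA -iotaM qb iotaZ -scalerA avgZ ?avgZr // => [|d]; last exact: act_scalar.
by rewrite ravg_q gamMeq1 eq_sym (negPf ef) scale0r scaler0.
Qed.

End Module.

Section LinearForms.
Variables (J : finType) (g : J -> Gam) (X : J -> R).
Hypothesis actD : forall d r s, act d (r + s) = act d r + act d s.
Hypothesis actMr : forall d r s, act d (r * s) = act d r * act d s.
Hypothesis actX : forall d j, act d (X j) = iota ((-1) ^+ chi d (g j))%:M * X j.
Implicit Type c : J -> k.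

Lemma form_fixed c d :
  act d (\sum_j iota (c j *: q (g j)) * X j) = \sum_j iota (c j *: q (g j)) * X j.
Proof.
have act0 : act d 0 = 0 by apply: (addIr (act d 0)); rewrite -actD !add0r.
rewrite (big_morph _ (actD d) act0); apply: eq_bigr => j _.
rewrite actMr act_iota actX mulrA -iotaM; congr (iota _ * _).
rewrite -scalemxAr -scalemxAl qmx_conj scalar_mxC mul_scalar_mx !scalerA.
by case: (chi _ _); rewrite ?(mulN1r, mulrN1, mul1r, mulr1, opprK) ?mulrN ?mulr1 ?opprK.
Qed.

Lemma form_comb a b c c' :
  \sum_j iota ((a * c j + b * c' j) *: q (g j)) * X j =
  iota a%:M * (\sum_j iota (c j *: q (g j)) * X j) +
  iota b%:M * (\sum_j iota (c' j *: q (g j)) * X j).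
Proof.
rewrite !mulr_sumr -big_split; apply: eq_bigr => j _ /=.
by rewrite !mulrA -!iotaM -mulrDl -rmorphD !mul_scalar_mx !scalerA scalerDl.
Qed.
End LinearForms.

Section Regular.
Hypothesis act1 : forall r, act gam1 r = r.
Hypothesis actM : forall d e r, act d (act e r) = act (gamM d e) r.
Hypothesis actD : forall d r s, act d (r + s) = act d r + act d s.
Hypothesis actMr : forall d r s, act d (r * s) = act d r * act d s.

Lemma ravg_fixed r d : act d (ravg r) = ravg r.
Proof. exact: (@avg_fixed R^o act actM actD actMr r d). Qed.

Lemma ravg_decomp r : r = \sum_e iota (q e) * ravg (iota (q' e) * r).
Proof. exact: (@avg_decomp R^o act act1 actMr r). Qed.

(** Averaging an equation between fixed elements averages its coefficients. Hence a left ideal of R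
    generated by invariants meets the invariants in the left ideal generated there. *)
Lemma ravg_comb a b b' r r' : (forall d, act d a = a) -> (forall d, act d b = b) ->
  (forall d, act d b' = b') -> a = r * b + r' * b' -> a = ravg r * b + ravg r' * b'.
Proof.
move=> fa fb fb' e; rewrite -[LHS](@avg_id R^o act a fa) e.
rewrite (@avgD R^o act actD); congr (_ + _).
  exact: (@avgZr R^o act actMr r b fb).
exact: (@avgZr R^o act actMr r' b' fb').
Qed.
End Regular.
End GammaAction.

Section MatrixAlgebra.
Variables (k : fieldType) (A : algType k).
Local Notation iota := (map_mx (in_alg A)).

Lemma in_alg_comm (c : k) (u : A) : c%:A * u = u * c%:A.
Proof. by rewrite -scalerAl -scalerAr mul1r mulr1. Qed.

Lemma iota_mx_comm (c : k) (X : 'M[A]_2) : iota c%:M *m X = X *m iota c%:M.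
Proof.
rewrite map_scalar_mx; apply/matrixP => r s.
by rewrite -diag_const_mx mul_diag_mx mul_mx_diag !mxE in_alg_comm.
Qed.

Lemma mx_alg_comm (B : 'M[k]_2) (u : A) : iota B *m u%:M = u%:M *m iota B.
Proof.
rewrite -diag_const_mx mul_diag_mx mul_mx_diag; apply/matrixP => r s.
by rewrite !mxE in_alg_comm.
Qed.

Lemma map_iota (f : {lrmorphism A -> A}) (B : 'M[k]_2) :
  map_mx f (iota B) = iota B.
Proof. by apply/matrixP => r s; rewrite !mxE /= linearZ_LR rmorph1. Qed.

(** Here [c] is the sign in q_d q_e = c q_de. It occurs on both sides of the conjugation and
    cancels, which is why Gamma itself acts although the q_d multiply only up to sign. *)
Lemma twist_comp (f g h : {lrmorphism A -> A}) (c : k) (P P' S S' T T' : 'M[k]_2)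
    (X : 'M[A]_2) :
  (forall u, f (g u) = h u) -> c * c = 1 -> P *m S = c *: T -> S' *m P' = c *: T' ->
  iota P *m map_mx f (iota S *m map_mx g X *m iota S') *m iota P' =
  iota T *m map_mx h X *m iota T'.
Proof.
move=> fg cc PS SP.
have eS (B C : 'M[k]_2) : iota B *m iota C = iota (B *m C) by rewrite map_mxM.
have eX : map_mx f (map_mx g X) = map_mx h X.
  by apply/matrixP => r s; rewrite !mxE fg.
rewrite !map_mxM /= !map_iota eX !mulmxA eS PS -(mulmxA _ (iota S')) eS SP.
have sc B : iota (c *: B) = iota c%:M *m iota B by rewrite -mul_scalar_mx map_mxM.
rewrite !sc -(mulmxA _ (iota T)); move: (iota T *m _) => Z.
rewrite !mulmxA -(mulmxA _ Z) -iota_mx_comm !mulmxA -map_mxM -scalar_mxM cc.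
by rewrite map_mx1 mul1mx.
Qed.

Lemma twist_scalar (f : A -> A) (c : k) (P P' : 'M[k]_2) (u : A) :
  f 0 = 0 -> f u = c *: u -> P *m P' = 1%:M ->
  iota P *m map_mx f u%:M *m iota P' = iota c%:M *m u%:M.
Proof.
move=> f0 fu PP.
have -> : map_mx f u%:M = iota c%:M *m u%:M :> 'M_2.
  rewrite -diag_const_mx mul_mx_diag; apply/matrixP => r s; rewrite !mxE.
  case: (r == s); rewrite ?mulr1n ?mulr0n /= ?fu -?scalerAl ?mul1r //.
  by rewrite scale0r.
rewrite !mulmxA -(iota_mx_comm c) -!mulmxA.
by rewrite -(mx_alg_comm _ u) (mulmxA (iota P)) -map_mxM PP map_mx1 mul1mx.
Qed.

End MatrixAlgebra.

(** * Q' and its invariants *)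

Section QPrimeTheory.
Variables (k : fieldType) (alpha beta gamma : k) (i : sqrtN1 k).
Local Notation Q := (skl alpha beta gamma).
Local Notation R := (Qp_graded alpha beta gamma).
Local Notation act := (@Qp_act k alpha beta gamma i).
Local Notation iota := (map_mx (in_alg Q) : 'M[k]_2 -> R).
Local Notation q := (qmx i).
Local Notation q' d := (invmx (qmx i d)).

Lemma Qp_iotaC (c : k) (r : R) : iota c%:M * r = r * iota c%:M.
Proof. exact: iota_mx_comm. Qed.

Lemma Qp_act_iota d B : act d (iota B) = iota (q d *m B *m q' d).
Proof. by rewrite /Qp_act (map_iota (skl_act d)) !map_mxM. Qed.

Lemma Qp_actM d e X : act d (act e X) = act (gamM d e) X.
Proof.
have [b qb] := qmx_mul i d e.
have qb' : q' e *m q' d = (-1) ^+ b *: q' (gamM d e).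
  apply: (can_inj (mulKmx (qmx_unit i (gamM d e)))).
  rewrite -scalemxAr mulmxV ?qmx_unit //.
  transitivity ((-1) ^+ b *: (q d *m q e) *m (q' e *m q' d)).
    by rewrite qb scalerA -signr_addb addbb scale1r.
  rewrite -scalemxAl -!mulmxA (mulmxA (q e)) mulmxV ?qmx_unit // mul1mx.
  by rewrite mulmxV ?qmx_unit.
apply: (twist_comp X _ _ qb qb') => [u|]; first exact: skl_actM.
by rewrite -signr_addb addbb.
Qed.

Lemma Qp_act1 X : act gam1 X = X.
Proof.
rewrite /Qp_act /qmx /= invmx1 map_mx1 mul1mx mulmx1.
by apply/matrixP => r s; rewrite mxE; apply: skl_act_1.
Qed.

Lemma Qp_actD d X Y : act d (X + Y) = act d X + act d Y.
Proof. exact: raddfD. Qed.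

Lemma Qp_actMr d X Y : act d (X * Y) = act d X * act d Y.
Proof. exact: rmorphM. Qed.

Lemma Qp_deg_iota B : @gr_deg R 0 (iota B).
Proof. by move=> r s; rewrite mxE; apply/skl_degZ/skl_deg1. Qed.

Lemma Qp_degM m n (X Y : R) : gr_deg m X -> gr_deg n Y -> gr_deg (m + n) (X * Y).
Proof.
move=> Xm Yn r s; rewrite [X * Y]/(X *m Y) mxE; apply: skl_deg_sum => j _.
exact: skl_degM.
Qed.

Lemma Qp_act_deg d n (X : R) : gr_deg n X -> @gr_deg R n (act d X).
Proof.
move=> Xn; have Yn : @gr_deg R n (map_mx (skl_act d) X).
  by move=> r s; rewrite mxE; apply: skl_act_deg.
have := Qp_degM (Qp_degM (Qp_deg_iota (q d)) Yn) (Qp_deg_iota (q' d)).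
by rewrite addn0.
Qed.

Lemma Qp_grading : exists pr, @grading R pr.
Proof.
have [pr prP] := skl_grading alpha beta gamma.
exists (fun n (X : 'M[Q]_2) => \matrix_(r, s) pr n (X r s)); split.
- by move=> n X Y; apply/matrixP => r s; rewrite !mxE (prD prP).
- by move=> n X r s; rewrite mxE; apply: (pr_deg prP).
- move=> n m X Xn; apply/matrixP => r s; rewrite mxE (pr_id prP _ (Xn r s)).
  by case: eqP; rewrite ?mxE.
- move=> X; have /choice[N NP] : forall u : 'I_2 * 'I_2, exists N, forall M, (N <= M)%N ->
    X u.1 u.2 = \sum_(n < M) pr n (X u.1 u.2) by move=> u; exact: (grading_vanish prP (X u.1 u.2)).
  exists (\max_u N u)%N; apply/matrixP => r s; rewrite summxE.
  rewrite [LHS](NP (r, s) (\max_u N u)%N) /=; last exact: (leq_bigmax (r, s)).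
  by apply: eq_bigr => n _; rewrite mxE.
- move=> r s; rewrite mxE mulrb; case: (r == s); first exact: skl_deg1.
  exact: skl_deg0.
- move=> m n X Y; exact: Qp_degM.
Qed.

End QPrimeTheory.

(** * Graded isomorphisms and cyclic graded modules *)

Lemma linear_inverse (R : nzRingType) (U V : lmodType R) (f : {linear U -> V}) :
  bijective f -> exists g : {linear V -> U}, cancel f g /\ cancel g f.
Proof.
case=> g fK gK.
have gl : linear g.
  by move=> a u v; apply: (can_inj fK); rewrite linearP !gK.
pose g' : {linear V -> U} := HB.pack g (GRing.isLinear.Build _ _ _ _ g gl).
by exists g'.
Qed.

Lemma graded_isom_sym (R : gradedRing) (M N : gradedModule R) :
  graded_isom M N -> graded_isom N M.
Proof.
move=> [f [/linear_inverse[g [fK gK]] fd]]; exists g; split; first by exists f.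
by move=> n v; rewrite fd gK.
Qed.

Lemma graded_isom_trans (R : gradedRing) (M N P : gradedModule R) :
  graded_isom M N -> graded_isom N P -> graded_isom M P.
Proof.
move=> [f [fb fd]] [g [gb gd]]; exists (g \o f : {linear M -> P}); split.
  exact: bij_comp.
by move=> n v; rewrite fd gd.
Qed.

Section LiftGraded.
Variables (R : gradedRing) (pr : nat -> R -> R).
Hypothesis prR : grading pr.
Variables (y y' : R) (N : gradedModule R).
Hypotheses (y1 : gr_deg 1 y) (y1' : gr_deg 1 y') (Ngr : is_graded N).

Lemma gm_deg0 n : gm_deg n (0 : N).
Proof. by case: Ngr => /(_ n)[]. Qed.

Lemma gm_degB n (u v : N) : gm_deg n u -> gm_deg n v -> gm_deg n (u - v).
Proof. by case: Ngr => /(_ n)[_ h] _ _ _; apply: h. Qed.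

Lemma gm_degZ j n (a : R) (v : N) : gr_deg j a -> gm_deg n v -> gm_deg (j%:Z + n) (a *: v).
Proof. by case: Ngr => _ h _ _; apply: h. Qed.

(** The images of the homogeneous parts of a representative decompose [f v]. If [f v] is
    homogeneous, uniqueness of decompositions in [N] leaves only the part of its own degree. *)
Lemma lquot_deg_reflect (f : {linear lquot y y' -> N}) :
  injective f -> (forall n (v : lquot2 y y'), gm_deg n v -> gm_deg n (f v)) ->
  forall n (v : lquot2 y y'), gm_deg n (f v) -> gm_deg n v.
Proof.
move=> fI fd n v fvn; have [a vE] := lquot_pi_surj v.
have [N0 aE] := grading_vanish prR a.
pose w j : N := f (lquot_pi y y' (pr j a)).
have wd j : gm_deg j%:Z (w j).
  by apply: (fd j%:Z); exists (pr j a); split=> //; apply: (pr_deg prR).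
have fvE M : (N0 <= M)%N -> f v = \sum_(j < M) w j.
  by move=> NM; rewrite vE {1}(aE M NM) lquot_pi_sum raddf_sum.
have [_ _ _ uniqN] := Ngr.
have iotaE p : iota 0 p = index_iota 0 p by rewrite /index_iota subn0.
case: n fvn => n fvn; last first.
  (* The quotient has no negative degrees, so [f v] must be shown to be 0: its opposite is added as
     an extra component in degree [Negz n], and the components then sum to 0. *)
  pose W (m : int) : N := if m is Posz j then w j else if m == Negz n then - f v else 0.
  have := uniqN (Negz n :: [seq Posz j | j <- iota 0 N0]) W.
  move=> /(_ _ _ _ (Negz n)); rewrite /W eqxx mem_head => H.
  have /eqP : - f v = 0.
    apply: H => //.
    - rewrite /= map_inj_uniq ?iota_uniq ?andbT; last by move=> ? ? [].
      by apply/mapP => -[].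
    - case=> [j|j] //; case: eqP => [->|_]; last exact: gm_deg0.
      by rewrite -sub0r; apply: gm_degB => //; apply: gm_deg0.
    by rewrite big_cons eqxx big_map iotaE big_mkord -fvE // addNr.
  rewrite oppr_eq0 => /eqP fv0; apply: fI.
  by rewrite fv0 raddf0.
exists (pr n a); split; first exact: (pr_deg prR).
(* [M] exceeds n as well as [N0], so that the component of degree n, from which [f v] is subtracted,
   occurs in the sum. *)
apply: fI; pose M := (N0 + n.+1)%N.
pose W (m : int) : N := if m is Posz j then w j - (if j == n then f v else 0) else 0.
have := uniqN [seq Posz j | j <- iota 0 M] W.
move=> /(_ _ _ _ (Posz n)); rewrite /W eqxx => H.
apply/esym/eqP; rewrite -subr_eq0; apply/eqP; apply: H.
- by rewrite map_inj_uniq ?iota_uniq // => ? ? [].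
- case=> [j|j]; last exact: gm_deg0.
  by apply: gm_degB => //; case: eqP => [->//|_]; apply: gm_deg0.
- rewrite big_map iotaE big_mkord.
  rewrite sumrB -fvE ?leq_addr //.
  have nM : (n < M)%N by rewrite /M addnS ltnS leq_addl.
  rewrite (bigD1 (Ordinal nM)) //= eqxx big1 ?addr0 ?subrr // => j jn.
  case: eqP => // jn'; case/eqP: jn; exact: val_inj.
by apply: map_f; rewrite mem_iota /= add0n /M addnS ltnS leq_addl.
Qed.

Lemma cyclic_graded (m : N) : gm_deg 0 m -> (forall v : N, exists a, v = a *: m) ->
  (forall a, a *: m = 0 <-> a \in lideal y y') ->
  exists f : {linear lquot2 y y' -> N}, [/\ bijective f,
    forall n v, gm_deg n v <-> gm_deg n (f v) & forall a, f (lquot_pi y y' a) = a *: m].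
Proof.
move=> m0 gen ann.
have [|| f fE] := @lquot_lift R y y' N m.
  by apply/ann; exact: lideal_l.
  by apply/ann; exact: lideal_r.
have fI : injective f.
  move=> u v; have [a ->] := lquot_pi_surj u; have [b ->] := lquot_pi_surj v.
  rewrite !fE => e; apply/lquot_pi_eq/ann.
  by rewrite scalerBl e subrr.
have fd n (v : lquot2 y y') : gm_deg n v -> gm_deg n (f v).
  case: n => [j|j] /=; last by move=> ->; rewrite raddf0; apply: gm_deg0.
  by move=> [a [aj ->]]; rewrite fE -[Posz j]addr0; apply: gm_degZ.
exists f; split=> // [|n v]; last by split; [exact: fd|exact: lquot_deg_reflect].
have /choice[g gP] : forall v : N, exists u, f u = v.
  by move=> v; have [a ->] := gen v; exists (lquot_pi y y' a).
exists g => // u; apply: fI; exact: gP.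
Qed.

End LiftGraded.

Section QuotientAction.
Variables (R : gradedRing) (act : Gam -> R -> R).
Hypothesis act1 : forall r, act gam1 r = r.
Hypothesis actM : forall d e r, act d (act e r) = act (gamM d e) r.
Hypothesis actD : forall d r s, act d (r + s) = act d r + act d s.
Hypothesis actMr : forall d r s, act d (r * s) = act d r * act d s.
Hypothesis act_deg : forall d n r, gr_deg n r -> gr_deg n (act d r).
Variables y y' : R.
Hypotheses (y1 : gr_deg 1 y) (y1' : gr_deg 1 y').
Hypotheses (fy : forall d, act d y = y) (fy' : forall d, act d y' = y').

Lemma act_lideal d a : a \in lideal y y' -> act d a \in lideal y y'.
Proof.
move=> /lidealP[b [b' ->]]; apply/lidealP; exists (act d b), (act d b').
by rewrite actD (actMr d b) (actMr d b') fy fy'.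
Qed.

Definition quot_act d (v : lquot2 y y') : lquot2 y y' :=
  lquot_pi y y' (act d (repr (v : lquot y y'))).

Lemma act0 d : act d (0 : R) = 0.
Proof. by apply: (addIr (act d 0)); rewrite -actD !add0r. Qed.

Lemma actN d (r : R) : act d (- r) = - act d r.
Proof.
by apply: (addIr (act d r)); rewrite -actD !addNr act0.
Qed.

Lemma quot_actE d a : quot_act d (lquot_pi y y' a) = lquot_pi y y' (act d a).
Proof.
apply/lquot_pi_eq; rewrite -actN -actD; apply: act_lideal.
by apply/(@lquot_pi_eq R); rewrite lquot_reprK.
Qed.

Lemma quot_act1 (v : lquot2 y y') : quot_act gam1 v = v.
Proof. by have [a ->] := lquot_pi_surj v; rewrite quot_actE act1. Qed.

Lemma quot_actM d e (v : lquot2 y y') :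
  quot_act d (quot_act e v) = quot_act (gamM d e) v.
Proof. by have [a ->] := lquot_pi_surj v; rewrite !quot_actE actM. Qed.

Lemma quot_actD d (u v : lquot2 y y') :
  quot_act d (u + v) = quot_act d u + quot_act d v.
Proof.
have [a ->] := lquot_pi_surj u; have [b ->] := lquot_pi_surj v.
by rewrite -lquot_piD !quot_actE actD lquot_piD.
Qed.

Lemma quot_act_deg d n (v : lquot2 y y') : gm_deg n v -> gm_deg n (quot_act d v).
Proof.
case: n => [n|n] /=.
  by move=> [a [an ->]]; exists (act d a); rewrite quot_actE; split=> //; apply: act_deg.
by move=> ->; have := quot_actE d 0; rewrite act0 lquot_pi0.
Qed.

Lemma quot_act_semi d (r : R) (v : lquot2 y y') :
  quot_act d (r *: v) = (act d r) *: quot_act d v.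
Proof.
have [a ->] := lquot_pi_surj v.
by rewrite lquot_piZ !quot_actE lquot_piZ actMr.
Qed.

End QuotientAction.

Section Modules.
Variables (k : fieldType) (alpha beta gamma : k) (i : sqrtN1 k).
Hypothesis hk : (2%:R : k) != 0.
Local Notation Q := (skl alpha beta gamma).
Local Notation R := (Qp_graded alpha beta gamma).
Local Notation T := (Qt_graded alpha beta gamma i).
Local Notation eqMod := (eqModule alpha beta gamma i).
Local Notation act := (@Qp_act k alpha beta gamma i : Gam -> R -> R).
Local Notation q := (qmx i).
Local Notation q' d := (invmx (qmx i d)).

Definition embM : {rmorphism 'M[k]_2 -> R} := map_mx (in_alg Q).

Lemma iotaC (c : k) (r : R) : embM c%:M * r = r * embM c%:M.
Proof. exact: Qp_iotaC. Qed.

Lemma act_iota d B : act d (embM B) = embM (q d *m B *m q' d).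
Proof. exact: Qp_act_iota. Qed.

Lemma act1 (r : R) : act gam1 r = r. Proof. exact: Qp_act1. Qed.
Lemma actM d e (r : R) : act d (act e r) = act (gamM d e) r.
Proof. exact: Qp_actM. Qed.
Lemma actD d (r s : R) : act d (r + s) = act d r + act d s.
Proof. exact: Qp_actD. Qed.
Lemma actMr d (r s : R) : act d (r * s) = act d r * act d s.
Proof. exact: Qp_actMr. Qed.
Lemma act_deg d n (r : R) : gr_deg n r -> gr_deg n (act d r).
Proof. exact: Qp_act_deg. Qed.
Lemma deg_iota B : gr_deg 0 (embM B). Proof. exact: Qp_deg_iota. Qed.
Lemma R_grading : exists pr, @grading R pr. Proof. exact: Qp_grading. Qed.
Lemma Qt_valP (a : T) d : act d (val a) = val a.
Proof. by case: a => a aP; exact: (eqP (forallP aP d)). Qed.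
Lemma Qt_of (r : R) : (forall d, act d r = r) -> exists a : T, val a = r.
Proof.
move=> fr; have rP : (r : 'M[Q]_2) \in Qt_inv i.
  by apply/forallP => d; apply/eqP; exact: fr.
by exists (QtElt rP).
Qed.
Lemma Qt_valM (a b : T) : val (a * b) = val a * val b :> R.
Proof. by []. Qed.
Lemma Qt_valD (a b : T) : val (a + b) = val a + val b :> R.
Proof. by []. Qed.

Section Quot.
Variables y y' : R.
Hypotheses (y1 : gr_deg 1 y) (y1' : gr_deg 1 y').
Hypotheses (fy : forall d, act d y = y) (fy' : forall d, act d y' = y').

Lemma quot_graded : is_graded (lquot2 y y').
Proof. by have [pr prP] := R_grading; apply: (lquot2_graded prP). Qed.

Definition quotMod : eqMod :=
  @EqModule _ _ _ _ _ (lquot2 y y') quot_graded (@quot_act _ act y y')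
    (quot_act1 act1 actD actMr fy fy') (quot_actM actM actD actMr fy fy')
    (quot_actD actD actMr fy fy') (quot_act_deg actD actMr act_deg fy fy')
    (quot_act_semi actD actMr fy fy').

End Quot.

Section AvgM.
Variable M : eqMod.
Local Notation eavg := (@avg k R embM (em_mod M) (@em_act _ _ _ _ _ M)).

Lemma em_avg_inv (v : M) : eavg v \in @em_inv _ _ _ _ _ M.
Proof.
apply/forallP => d; apply/eqP.
exact: (avg_fixed act_iota (@em_actM _ _ _ _ _ M) (@em_actD _ _ _ _ _ M) (@em_act_semi _ _ _ _ _ M) v d).
Qed.

Lemma em_inv_fixed (v : M) : v \in @em_inv _ _ _ _ _ M -> forall d, em_act d v = v.
Proof. by move=> /forallP vP d; apply/eqP. Qed.

Lemma em_decomp (v : M) : v = \sum_e embM (q e) *: eavg (embM (q' e) *: v).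
Proof.
exact: (avg_decomp hk iotaC act_iota (@em_act1 _ _ _ _ _ M) (@em_act_semi _ _ _ _ _ M)).
Qed.

Lemma em_indep (m : Gam -> M) : (forall e, m e \in @em_inv _ _ _ _ _ M) ->
  \sum_e embM (q e) *: m e = 0 -> forall e, m e = 0.
Proof.
move=> mP; apply: (avg_indep hk iotaC act_iota (@em_actD _ _ _ _ _ M)
  (@em_act_semi _ _ _ _ _ M)) => e d.
exact: em_inv_fixed.
Qed.

End AvgM.

Lemma ravg_deg n (r : R) : gr_deg n r -> gr_deg n (ravg act embM r).
Proof.
have [pr prP] := R_grading => rn; apply: (grdegM prP (deg_iota _)).
by elim/big_ind: _ => [||d _]; [exact: (grdeg0 prP)|exact: (grdegD prP)|exact: act_deg].
Qed.

Lemma R_decomp (r : R) : exists a : Gam -> T, r = \sum_e embM (q e) * val (a e) /\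
  forall n, gr_deg n r -> forall e, gr_deg n (a e).
Proof.
have /choice[a aP] : forall e, exists a : T, val a = ravg act embM (embM (q' e) * r).
  by move=> e; apply: Qt_of => d; exact: (ravg_fixed act_iota actM actD actMr).
exists a; split.
  under eq_bigr do rewrite aP.
  exact: (ravg_decomp hk iotaC act_iota act1 actMr).
have [pr prP] := R_grading => n rn e; rewrite /= aP; apply: ravg_deg.
exact: (grdegM prP (deg_iota _) rn).
Qed.

Lemma R_avg_T (a b b' : T) (r r' : R) : val a = r * val b + r' * val b' ->
  exists s s' : T, a = s * b + s' * b'.
Proof.
move=> e.
have av (u : R) : exists s : T, val s = ravg act embM u.
  by apply: Qt_of => d; exact: (ravg_fixed act_iota actM actD actMr).
have [s sE] := av r; have [s' sE'] := av r'; exists s, s'; apply: val_inj.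
rewrite Qt_valD (Qt_valM s) (Qt_valM s') sE sE'.
exact: (ravg_comb embM hk actD actMr (Qt_valP a) (Qt_valP b) (Qt_valP b') e).
Qed.

End Modules.

Lemma act_pr (R : gradedRing) (pr : nat -> R -> R) (f : R -> R) : grading pr ->
  (forall r s, f (r + s) = f r + f s) -> (forall n r, gr_deg n r -> gr_deg n (f r)) ->
  forall n r, f (pr n r) = pr n (f r).
Proof.
move=> prR fD fd n r.
have f0 : f 0 = 0 by apply: (addIr (f 0)); rewrite -fD !add0r.
have [N rE] := pr_sum prR r.
rewrite {2}rE (big_morph f fD f0) (pr_big prR) {1}rE (pr_big prR) (big_morph f fD f0).
apply: eq_bigr => m _; have dm := pr_deg prR m r.
by rewrite (pr_id prR n dm) (pr_id prR n (fd _ _ dm)); case: eqP.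
Qed.

Lemma dot_linear (k : fieldType) (a b : k) (c d v : 'rV[k]_4) :
  dot (a *: c + b *: d) v = a * dot c v + b * dot d v.
Proof.
rewrite /dot !mulr_sumr -big_split; apply: eq_bigr => j _.
by rewrite !mxE mulrDl !mulrA.
Qed.

Lemma dotE (k : fieldType) (c v : 'rV[k]_4) : dot c v = (c *m v^T) 0 0.
Proof. by rewrite mxE; apply: eq_bigr => j _; rewrite mxE. Qed.

(** The columns of the cokernel of the matrix with rows c and c' are common zeros of c and c'; so
    they lie in L and d kills them, which puts d in the row space. *)
Lemma is_line_span (k : fieldType) (c c' d : 'rV[k]_4) (L : {vspace 'rV[k]_4}) :
  is_line c c' L -> (forall v, v \in L -> dot d v = 0) ->
  exists a b, d = a *: c + b *: c'.
Proof.
move=> [_ Lcc] dL; pose B := col_mx c c'.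
have : (d <= B)%MS.
  rewrite submxE; apply/eqP/matrixP => r s; rewrite ord1 [RHS]mxE.
  pose v : 'rV[k]_4 := (col s (cokermx B))^T.
  have vB : B *m v^T = 0 by rewrite trmxK colE mulmxA mulmx_coker mul0mx.
  have : dot d v = 0.
    apply/dL/Lcc; rewrite !dotE.
    move: vB; rewrite /B mul_col_mx => /(congr1 (fun X => (usubmx X, dsubmx X))).
    by rewrite col_mxKu col_mxKd !linear0 => -[-> ->]; rewrite !mxE.
  by rewrite dotE trmxK colE mulmxA -colE mxE.
move=> /submxP[D ->]; exists (D 0 (lshift 1 0)), (D 0 (rshift 1 0)).
apply/rowP => j; rewrite mxE big_split_ord /= !big_ord1 !mxE.
case: splitP => [a|a] /= ae; last by case: a ae => -[].
case: splitP => [b|b] /= be; first by case: b be => -[].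
by rewrite [a]ord1 [b]ord1.
Qed.

Section QtLin.
Variables (k : fieldType) (alpha beta gamma : k) (i : sqrtN1 k).
Hypothesis hk : (2%:R : k) != 0.
Local Notation Q := (skl alpha beta gamma).
Local Notation R := (Qp_graded alpha beta gamma).
Local Notation T := (Qt_graded alpha beta gamma i).
Local Notation eqMod := (eqModule alpha beta gamma i).
Local Notation act := (@Qp_act k alpha beta gamma i : Gam -> R -> R).
Local Notation q := (qmx i).
Local Notation q' d := (invmx (qmx i d)).
Local Notation x := (skl_x alpha beta gamma).

Definition gj (j : 'I_4) : Gam :=
  nth gam1 [:: gam1; (true, false); (false, true); (true, true)] j.

Definition lin (c : 'rV[k]_4) : R := Qt_lin alpha beta gamma i c.

Lemma chi_gj d j : chi d (gj j) = gam_neg d j.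
Proof. by case: j => [[|[|[|[|?]]]] ?] //; case: d => [[] []]. Qed.

Lemma lin_entry c r s : (lin c : 'M[Q]_2) r s = \sum_j (c 0 j * q (gj j) r s) *: x j.
Proof. by rewrite mxE; apply: eq_bigr => j _; rewrite mxE scalerA. Qed.

Lemma lin_deg c : gr_deg 1 (lin c).
Proof.
move=> r s; rewrite lin_entry; apply: skl_deg_sum => j _.
exact/skl_degZ/skl_deg_x.
Qed.

(* [y_j = x_j (x) q_j], as the product of [x_j] and [q_j] *)
Lemma linE c : lin c = \sum_j embM alpha beta gamma (c 0 j *: q (gj j)) * (x j)%:M.
Proof.
apply/matrixP => r s; rewrite lin_entry summxE; apply: eq_bigr => j _.
rewrite -[RHS]/((map_mx (in_alg Q) (c 0 j *: q (gj j)) *m (x j)%:M) r s).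
rewrite -diag_const_mx mul_mx_diag !mxE /=.
by rewrite -scalerAl mul1r.
Qed.

Lemma act_x d j : act d ((x j)%:M : 'M[Q]_2) =
  embM alpha beta gamma ((-1) ^+ gam_neg d j)%:M * (x j)%:M.
Proof.
apply: twist_scalar; [exact: raddf0|exact: skl_act_x|].
by rewrite mulmxV ?qmx_unit.
Qed.

Lemma act_lin c d : act d (lin c) = lin c.
Proof.
rewrite linE; apply: (@form_fixed k i R act (embM alpha beta gamma) _ _ gj (fun j => (x j)%:M : R)).
- exact: act_iota.
- exact: actD.
- exact: actMr.
- by move=> d' j; rewrite chi_gj; exact: act_x.
Qed.

Lemma lin_comb a b c c' : lin (a *: c + b *: c') =
  embM alpha beta gamma a%:M * lin c + embM alpha beta gamma b%:M * lin c'.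
Proof.
rewrite !linE; have := @form_comb k i R (embM alpha beta gamma) _ gj
  (fun j => (x j)%:M : R) a b (fun j => c 0 j) (fun j => c' 0 j).
by move <-; apply: eq_bigr => j _; rewrite !mxE.
Qed.

Lemma lin_inj c : lin c = 0 -> c = 0.
Proof.
move=> c0; apply/rowP => j; rewrite mxE.
have e r s : c 0 j * q (gj j) r s = 0.
  have := congr1 (fun X : 'M[Q]_2 => X r s) c0; rewrite lin_entry mxE => h.
  have [|_ /(_ j)] := @skl_indep k alpha beta gamma 0 (fun j => c 0 j * q (gj j) r s) => //.
  by rewrite scale0r add0r.
apply/eqP/negPn/negP => cj; suff /eqP : q (gj j) = 0.
  have := qmx_unit i (gj j); case: eqP => // -> .
  by rewrite unitmxE det0 ?unitr0 // /unitmx.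
apply/matrixP => r s; rewrite [RHS]mxE; apply/eqP.
by have /eqP := e r s; rewrite mulf_eq0 (negPf cj).
Qed.

Definition linT c : T := QtElt (introT forallP (fun d => introT eqP (act_lin c d))).

Lemma embM_inj B : embM alpha beta gamma B = 0 -> B = 0.
Proof.
move=> B0; apply/matrixP => r s; rewrite [RHS]mxE.
have := congr1 (fun X : 'M[Q]_2 => X r s) B0; rewrite !mxE /= => h.
suff /skl_indep[-> _] : (B r s)%:A + \sum_j (0 : k) *: x j = 0 by [].
have s0 : \sum_j (0 : k) *: x j = 0 by apply: big1 => j _; exact: scale0r.
by rewrite s0 addr0; exact: h.
Qed.

(** Commuting with q_1 = diag(i, -i) kills the off-diagonal entries, since 2i is invertible, and
    commuting with q_2 equates the diagonal ones. It follows that Qtilde is k in degree 0. *)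
Lemma qmx_center (C : 'M[k]_2) : (forall d, q d *m C = C *m q d) -> C = (C 0 0)%:M.
Proof.
have /eqP ii := valP i; have i0 : val i != 0.
  by apply/eqP => i0; move: ii; rewrite i0 expr0n => /eqP; rewrite eq_sym oppr_eq0 oner_eq0.
move=> qC; have h1 := qC (true, false); have h2 := qC (false, true).
have e r s (X Y : 'M[k]_2) : X = Y -> X r s = Y r s by move->.
have f01 := e 0 1 _ _ h1; have f10 := e 1 0 _ _ h1; have f11 := e 0 1 _ _ h2.
move: f01 f10 f11; rewrite !mxE !big_ord_recl !big_ord0 !mxE /=.
rewrite ?(mul0r, mulr0, addr0, add0r).
have -> : lift ord0 ord0 = 1 :> 'I_2 by apply/val_inj.
move=> f01 f10 f11.
have z (a : k) : val i * a = - (val i * a) -> a = 0.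
  move=> /eqP; rewrite -addr_eq0 -mulr2n -mulr_natr mulf_eq0 (negPf hk) orbF.
  by rewrite mulf_eq0 (negPf i0) => /eqP.
have c01 : C 0 1 = 0 by apply: z; apply: (etrans f01); rewrite mulrN mulrC.
have c10 : C 1 0 = 0 by apply: z; rewrite -mulNr; apply: esym; apply: (etrans f10); rewrite mulrC.
have c11 : C 1 1 = C 0 0 by apply: (mulfI i0); apply: (etrans f11); rewrite mulrC.
apply/matrixP => r s; rewrite mxE.
case: r => [[|[|?]] rp] //; case: s => [[|[|?]] sp] //; rewrite ?mulr1n ?mulr0n.
- by congr (C _ _); apply: val_inj.
- by rewrite -[RHS]c01; congr (C _ _); apply: val_inj.
- by rewrite -[RHS]c10; congr (C _ _); apply: val_inj.
- by rewrite -[RHS]c11; congr (C _ _); apply: val_inj.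
Qed.

Lemma R_deg0 (r : R) : gr_deg 0 r -> exists C, r = embM alpha beta gamma C.
Proof.
move=> r0.
have /choice[c cE] : forall u : 'I_2 * 'I_2, exists c : k, (r : 'M[Q]_2) u.1 u.2 = c%:A.
  by move=> u; apply/skl_deg0P/r0.
by exists (\matrix_(r, s) c (r, s)); apply/matrixP => s t; rewrite !mxE (cE (s, t)).
Qed.

Lemma T_deg0 (a : T) : gr_deg 0 a -> exists c, val a = embM alpha beta gamma c%:M.
Proof.
move=> a0; have [C aC] := @R_deg0 (val a) a0.
exists (C 0 0); rewrite aC; congr (embM _ _ _ _); apply: qmx_center => d.
have := Qt_valP a d; rewrite aC act_iota => h.
have : q d *m C *m q' d = C.
  apply/eqP; rewrite -subr_eq0; apply/eqP/embM_inj.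
  by rewrite rmorphB h subrr.
move: (q d) (q' d) (@Vq k i d) => P P' PP' PC.
by rewrite -[in RHS]PC -!mulmxA PP' mulmx1.
Qed.

End QtLin.

(** * Equivariant modules with a line *)

Section HasLine.
Variables (k : fieldType) (alpha beta gamma : k) (i : sqrtN1 k).
Hypothesis hk : (2%:R : k) != 0.
Local Notation Q := (skl alpha beta gamma).
Local Notation R := (Qp_graded alpha beta gamma).
Local Notation T := (Qt_graded alpha beta gamma i).
Local Notation eqMod := (eqModule alpha beta gamma i).
Local Notation act := (@Qp_act k alpha beta gamma i : Gam -> R -> R).
Local Notation q := (qmx i).
Local Notation emb := (embM alpha beta gamma).
Local Notation lin := (@lin k alpha beta gamma i).
Local Notation linT := (@linT k alpha beta gamma i).
Implicit Types (c d : 'rV[k]_4) (M N : eqMod).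

(** Gamma preserves degrees, so the projections of Q' commute with its action and restrict to the
    invariants. *)
Lemma T_grading : exists pr, @grading T pr.
Proof.
have [pr prP] := R_grading alpha beta gamma.
have prT n (a : T) : exists b : T, val b = pr n (val a).
  apply: Qt_of => d; rewrite (act_pr (f := act d) prP) ?Qt_valP //.
    exact: actD.
  by move=> m r; exact: act_deg.
have [f fE] := choice (fun na : nat * T => prT na.1 na.2).
exists (fun n a => f (n, a)); split.
- move=> n a b; apply: val_inj; rewrite Qt_valD !fE /=; exact: (prD prP).
- move=> n a; rewrite /= fE; exact: (pr_deg prP).
- move=> n m a an; apply: val_inj; rewrite fE (pr_id prP m an) /=.
  by case: eqP.
- move=> a; have [K aK] := pr_sum prP (val a); exists K; apply: val_inj.
  have vs (I : Type) (r : seq I) (g : I -> T) :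
      val (\sum_(j <- r) g j) = \sum_(j <- r) val (g j) :> R by exact: (big_morph _ (@Qt_valD _ _ _ _ i)).
  rewrite vs {1}aK; apply: eq_bigr => n _; exact: (esym (fE (val n, a))).
- exact: (grdeg1 prP).
- move=> m n a b; exact: (grdegM prP).
Qed.

Definition eavg M := @avg k R emb (em_mod M) (@em_act _ _ _ _ _ M).

Lemma eavg_id M (v : M) : v \in @em_inv _ _ _ _ _ M -> eavg v = v.
Proof. by move=> /em_inv_fixed vf; exact: (avg_id _ hk vf). Qed.

Lemma eavgD M (u v : M) : eavg (u + v) = eavg u + eavg v.
Proof. exact: avgD (@em_actD _ _ _ _ _ M) u v. Qed.

Lemma eavg_deg M n (v : M) : gm_deg n v -> gm_deg n (eavg v).
Proof.
have Mg := em_graded M => vn.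
rewrite -[n]add0r; apply: (gm_degZ Mg (deg_iota _ _ _ _)).
elim/big_ind: _ => [|u w un wn|d _]; [exact: gm_deg0| |exact: em_act_deg].
rewrite -[w]opprK; apply: (gm_degB Mg) => //; rewrite -sub0r; apply: (gm_degB Mg) => //.
exact: gm_deg0.
Qed.

Lemma em_invs_graded M : is_graded (em_invs M).
Proof.
have Mg := em_graded M; have [M1 M2 M3 M4] := Mg.
have vs (s : seq int) (w : int -> em_invs M) :
    val (\sum_(n <- s) w n) = \sum_(n <- s) val (w n) by exact: (big_morph val).
split.
- move=> n; split=> [|u v]; first exact: (gm_deg0 Mg).
  exact: (gm_degB Mg).
- move=> j n a v aj vn; exact: (gm_degZ Mg).
- move=> v; have [s [w [wd vE]]] := M3 (val v).
  (* Averaging preserves the degree of each component and fixes the sum, so it turns any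
     decomposition of an invariant into one with invariant components. *)
  exists s, (fun n => InvElt (em_avg_inv (w n))); split=> [n|].
    exact: eavg_deg.
  apply: val_inj; rewrite vs -(eavg_id (valP v)) vE /=.
  have e0 : eavg (0 : M) = 0 by apply: (addIr (eavg (0 : M))); rewrite -eavgD !add0r.
  exact: (big_morph _ (@eavgD M) e0).
move=> s w us wd w0 n ns; apply: val_inj.
apply: (M4 s (fun n => val (w n))) => //.
by rewrite -vs w0.
Qed.

Definition line_mod c d : eqMod :=
  quotMod (@lin_deg k alpha beta gamma i c) (@lin_deg k alpha beta gamma i d) (@act_lin k alpha beta gamma i c) (@act_lin k alpha beta gamma i d).

(** The class of 1 generates the invariants, since the coefficient of an invariant can be averaged.
    Its annihilator in Qtilde is generated by the two forms, by averaging the coefficients in Q'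
    ([R_avg_T]). *)
Lemma has_line_mod c c' (L : gr k 2 4) : is_line c c' (val L) ->
  has_line (line_mod c c') L.
Proof.
move=> Lcc; have [pr prT] := T_grading.
exists c, c', (linT c), (linT c'); split=> //; apply: graded_isom_sym.
set M := line_mod c c'.
have m1 : lquot_pi (lin c) (lin c') 1 \in @em_inv _ _ _ _ _ M.
  apply/forallP => d; apply/eqP.
  apply: (etrans (quot_actE (@actD _ _ _ _ i) (@actMr _ _ _ _ i) (@act_lin k alpha beta gamma i c) (@act_lin k alpha beta gamma i c') d 1)).
  congr lquot_pi; exact: rmorph1.
have [|v|a|f [fb fd _]] := @cyclic_graded T pr prT (linT c) (linT c') (em_invs M)
  (em_invs_graded M) (InvElt m1).
- have [prr prP] := R_grading alpha beta gamma.
  by exists 1; split=> //; exact: (grdeg1 prP).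
- have [r vr] := lquot_pi_surj (val v : lquot (lin c) (lin c')).
  have [s sE] : exists s : T, val s = ravg act emb r.
    apply: Qt_of => d; exact: (ravg_fixed (@act_iota _ _ _ _ i) (@actM _ _ _ _ i) (@actD _ _ _ _ i) (@actMr _ _ _ _ i)).
  exists s; apply: val_inj; rewrite -(eavg_id (valP v)).
  rewrite (_ : val v = (r : R) *: (lquot_pi (lin c) (lin c') 1 : M)); last first.
    by rewrite vr lquot_piZ mulr1.
  rewrite /= sE; apply: (avgZr _ (@em_act_semi _ _ _ _ _ M)); exact: em_inv_fixed.
- have aE : val (a *: InvElt m1 : invs M) = lquot_pi (lin c) (lin c') (val a).
    by rewrite -[val a in RHS]mulr1 -lquot_piZ.
  split=> [a0|/lidealP[b [b' aI]]].
    move: aE; rewrite a0 => /esym/lquot_pi_eq0/lidealP[r [r' e]].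
    have [s [s' ->]] := @R_avg_T _ _ _ _ _ hk a (linT c) (linT c') r r' e.
    by apply/lidealP; exists s, s'.
  apply: val_inj; apply: (etrans aE); apply/lquot_pi_eq0/lidealP.
  by exists (val b), (val b'); rewrite aI.
by exists f.
Qed.

Lemma lin_lideal c c' d (L : {vspace 'rV[k]_4}) :
  is_line c c' L -> (forall v, v \in L -> dot d v = 0) -> lin d \in lideal (lin c) (lin c').
Proof.
move=> Lcc /(is_line_span Lcc)[a [b ->]]; apply/lidealP.
by exists (emb a%:M), (emb b%:M); rewrite lin_comb.
Qed.

Lemma is_line_dot c c' (L : {vspace 'rV[k]_4}) v : is_line c c' L -> v \in L ->
  dot c v = 0 /\ dot c' v = 0.
Proof. by move=> [_ h] /h. Qed.

Lemma lideal_line c c' d d' (L : {vspace 'rV[k]_4}) :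
  is_line c c' L -> is_line d d' L ->
  forall r, r \in lideal (lin c) (lin c') -> r \in lideal (lin d) (lin d').
Proof.
move=> Lc Ld; apply: lideal_sub; apply: (lin_lideal Ld) => v vL.
  by have [] := is_line_dot Lc vL.
by have [] := is_line_dot Lc vL.
Qed.

Lemma em_invs_sum M (v : M) : v \in @em_inv _ _ _ _ _ M -> exists w : em_invs M, val w = v.
Proof. by move=> vP; exists (InvElt vP). Qed.

(* A generator of the invariants generates the whole module, since [R] is the sum
   of the [q_e T]. *)
Lemma cyclic_eq_isom M (m : M) c c' : m \in @em_inv _ _ _ _ _ M -> gm_deg 0 m ->
  (forall v : M, exists r : R, v = r *: m) ->
  (forall r : R, r *: m = 0 <-> r \in lideal (lin c) (lin c')) ->
  eq_isom (line_mod c c') M.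
Proof.
move=> mP m0 gen ann; have [pr prP] := R_grading alpha beta gamma.
have [f [fb fd fE]] := cyclic_graded prP (em_graded M) m0 gen ann.
exists f; split=> // d v; have [r ->] := lquot_pi_surj (v : lquot (lin c) (lin c')).
apply: (etrans (congr1 f (quot_actE (@actD _ _ _ _ i) (@actMr _ _ _ _ i)
  (@act_lin k alpha beta gamma i c) (@act_lin k alpha beta gamma i c') d r))).
rewrite !fE em_act_semi; congr (_ *: _).
by rewrite (em_inv_fixed mP).
Qed.

(** The annihilator of the generator m is found by components: if r is the sum of q_e a_e with a_e
    in Qtilde, then the a_e m are invariant, so r m = 0 forces each of them to vanish. *)
Lemma has_line_isom M c c' (L : gr k 2 4) : has_line M L -> is_line c c' (val L) ->
  eq_isom (line_mod c c') M.
Proof.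
move=> [d [d' [z [z' [zE zE' Ld isoM]]]]] Lc.
have [g [/linear_inverse[h [gK hK]] gd]] := isoM.
pose m0 := h (lquot_pi z z' 1).
have hE (a : T) : h (lquot_pi z z' a) = a *: m0 by rewrite /m0 -linearZ /= lquot_piZ mulr1.
have [prT prTP] := T_grading.
have m0d : gm_deg 0 m0.
  by apply/gd; rewrite hK; exists 1; split=> //; exact: (grdeg1 prTP).
have gen0 (w : em_invs M) : exists a : T, w = a *: m0.
  have [a aE] := lquot_pi_surj (g w); exists a.
  by rewrite -hE -aE gK.
have ann0 (a : T) : a *: m0 = 0 <-> a \in lideal z z'.
  rewrite -hE -(raddf0 h) -lquot_pi_eq0; split=> [/(can_inj hK)//|-> //].
apply: (@cyclic_eq_isom M (val m0)) => //; first exact: valP.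
  move=> v.
  have /choice[a aE] : forall e, exists a : T, eavg (emb (invmx (q e)) *: v) = (val a : R) *: val m0.
    move=> e; have [w wE] := em_invs_sum (em_avg_inv (emb (invmx (q e)) *: v)).
    by have [a aw] := gen0 w; exists a; rewrite [LHS](esym wE) aw.
  exists (\sum_e emb (q e) * val (a e)); rewrite scaler_suml.
  rewrite [LHS](em_decomp hk v); apply: eq_bigr => e _.
  by rewrite -scalerA -aE.
move=> r; have [a [rE _]] := R_decomp i hk r.
have zI (b : T) : b \in lideal z z' -> (val b : R) \in lideal (lin c) (lin c').
  move=> /lidealP[s [s' ->]]; apply: (lideal_line Ld Lc); apply/lidealP.
  by exists (val s), (val s'); rewrite -[lin d]zE -[lin d']zE'.
split=> [r0|rI].
  rewrite rE; apply: lideal_sum => e _; apply/lidealMl/zI/ann0; apply: val_inj.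
  have fixe e' : (val (a e') : R) *: val m0 \in @em_inv _ _ _ _ _ M by exact: valP (a e' *: m0).
  apply: (em_indep hk fixe _ e).
  by rewrite -[RHS]r0 rE scaler_suml; apply: eq_bigr => e' _; rewrite scalerA.
have zm (b : T) : b \in lideal z z' -> (val b : R) *: val m0 = 0.
  by move=> /ann0 /(congr1 val).
apply: (lideal_kill _ _ (lideal_line Lc Ld rI)).
  by rewrite -[lin d]zE; apply/zm/lideal_l.
by rewrite -[lin d']zE'; apply/zm/lideal_r.
Qed.

(** Recovers the forms vanishing on the line from M alone, as those killing the invariants of degree
    0. This is what makes the line an isomorphism invariant. *)
Lemma has_line_ann M (L : gr k 2 4) : has_line M L -> forall c,
  (forall v, v \in val L -> dot c v = 0) <->
  (forall m : M, m \in @em_inv _ _ _ _ _ M -> gm_deg 0 m -> lin c *: m = 0).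
Proof.
move=> [d [d' [z [z' [zE zE' Ld isoM]]]]] c.
have [g [/linear_inverse[h [gK hK]] gd]] := isoM.
have [prT prTP] := T_grading.
have z1 : @gr_deg T 1 z by rewrite /= zE; exact: lin_deg.
have z1' : @gr_deg T 1 z' by rewrite /= zE'; exact: lin_deg.
split=> [cL m mP m0|kill].
  have [w wE] := em_invs_sum mP.
  have : gm_deg 0 (g w) by apply/gd; rewrite /= wE.
  move=> [a [a0 ga]]; have [e aE] := T_deg0 hk a0.
  have : linT c *: w = 0.
    apply: (can_inj gK); rewrite linearZ raddf0 /= ga lquot_piZ; apply/lquot_pi_eq0.
    (* The coefficient [a] has degree 0 in Qtilde, hence is a scalar and central. *)
    have -> : linT c * a = a * linT c.
      by apply: val_inj; rewrite /= aE [RHS]iotaC.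
    apply: lidealMl; have [a1 [b1 ->]] := is_line_span Ld cL.
    have sT (e0 : k) : exists s : T, val s = emb e0%:M.
      apply: Qt_of => d0; rewrite act_iota; congr (embM _ _ _ _).
      by rewrite scalar_mxC -mulmxA mulmxV ?qmx_unit ?mulmx1.
    have [s sE] := sT a1; have [s' sE'] := sT b1.
    apply/lidealP; exists s, s'; apply: val_inj.
    by rewrite /= sE sE' zE zE'; exact: lin_comb.
  by move=> /(congr1 val); rewrite /= wE.
pose m0 := h (lquot_pi z z' 1).
have m0d : gm_deg 0 m0.
  by apply/gd; rewrite hK; exists 1; split=> //; exact: (grdeg1 prTP).
have k0 : linT c *: m0 = 0.
  by apply: val_inj; apply: kill => //; exact: valP.
have : linT c \in lideal z z'.
  apply/lquot_pi_eq0; rewrite -[linT c]mulr1 -lquot_piZ -[lquot_pi z z' 1]hK.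
  by rewrite -linearZ /= -/m0 k0 raddf0.
move=> cI; have [b [b' [b0 b0' e]]] := deg1_lideal prTP z1 z1' (lin_deg _ _ _ i c : @gr_deg T 1 (linT c)) cI.
have [a aE] := T_deg0 hk b0; have [a' aE'] := T_deg0 hk b0'.
have /eqP : lin (c - (a *: d + a' *: d')) = 0.
  have := congr1 val e; rewrite /= aE aE' zE zE' => e'.
  rewrite -[c in c - _]scale1r -scaleN1r lin_comb lin_comb.
  have e1 : emb 1%:M = 1 by exact: rmorph1.
  have eN : emb (-1)%:M = -1.
    by rewrite (_ : (-1)%:M = - 1 :> 'M[k]_2) ?rmorphN1 //; exact: raddfN.
  by rewrite e1 eN mul1r mulN1r -e' subrr.
move=> /eqP/lin_inj/eqP; rewrite subr_eq0 => /eqP -> v vL.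
rewrite dot_linear; have [-> ->] := is_line_dot Ld vL.
by rewrite !mulr0 addr0.
Qed.

Lemma eq_isom_inv0 M N c : eq_isom M N ->
  (forall m : N, m \in @em_inv _ _ _ _ _ N -> gm_deg 0 m -> lin c *: m = 0) ->
  (forall m : M, m \in @em_inv _ _ _ _ _ M -> gm_deg 0 m -> lin c *: m = 0).
Proof.
move=> [f [fb fd fa]] kill m mP m0; apply: (bij_inj fb).
rewrite linearZ raddf0 /=; apply: kill; last exact/fd.
by apply/forallP => d; rewrite -fa (em_inv_fixed mP).
Qed.

Lemma eq_isom_sym M N : eq_isom M N -> eq_isom N M.
Proof.
move=> [f [/linear_inverse[g [fK gK]] fd fa]]; exists g; split; first by exists f.
  by move=> n v; rewrite fd gK.
by move=> d v; apply: (can_inj fK); rewrite fa !gK.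
Qed.

Lemma eq_isom_trans M N P : eq_isom M N -> eq_isom N P -> eq_isom M P.
Proof.
move=> [f [fb fd fa]] [g [gb gd ga]]; exists (g \o f : {linear M -> P}); split.
- exact: bij_comp.
- by move=> n v; rewrite fd gd.
- by move=> d v /=; rewrite fa ga.
Qed.

Lemma has_line_unique M N (L L' : gr k 2 4) :
  eq_isom M N -> has_line M L -> has_line N L' -> L = L'.
Proof.
move=> iso hM hN.
have key c : (forall v, v \in val L -> dot c v = 0) <-> (forall v, v \in val L' -> dot c v = 0).
  rewrite (has_line_ann hM) (has_line_ann hN).
  by split; apply: eq_isom_inv0 => //; apply: eq_isom_sym.
have [c [c' [_ [_ [_ _ Lc _]]]]] := hM; have [d [d' [_ [_ [_ _ Ld _]]]]] := hN.
apply: val_inj; apply/vspaceP => v; apply/idP/idP => vL.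
  apply/(proj2 Ld); split; apply: (proj2 (key _)) vL => w wL.
    by have [] := is_line_dot Ld wL.
  by have [] := is_line_dot Ld wL.
apply/(proj2 Lc); split; apply: (proj1 (key _)) vL => w wL.
  by have [] := is_line_dot Lc wL.
by have [] := is_line_dot Lc wL.
Qed.

End HasLine.

(** * Modules of a given type *)

Definition dg2 (A : pzSemiRingType) (a b : A) : 'M[A]_2 :=
  diag_mx (\row_j if j == 0 then a else b).

Lemma mul_dg2 (A : pzSemiRingType) (B : 'M[A]_2) (a b : A) r s :
  (B *m dg2 a b) r s = B r s * (if s == 0 then a else b).
Proof. by rewrite mul_mx_diag !mxE. Qed.

Lemma mulr_dg2 (A : nzRingType) (B : 'M[A]_2) (a b : A) r s :
  (B * dg2 a b) r s = B r s * (if s == 0 then a else b).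
Proof. exact: mul_dg2. Qed.

(** Right multiplication by a diagonal matrix acts on each column separately, so the coefficients
    for the two columns can be chosen independently. *)
Lemma lideal_cols (A : nzRingType) (a a' b b' : A) (X : 'M[A]_2) :
  X \in lideal (dg2 a b) (dg2 a' b') <->
  forall r, X r 0 \in lideal a a' /\ X r 1 \in lideal b b'.
Proof.
split=> [/lidealP[B [B' ->]] r|H].
  split; apply/lidealP; first exists (B r 0), (B' r 0); last exists (B r 1), (B' r 1).
    by rewrite mxE !mulr_dg2.
  by rewrite mxE !mulr_dg2.
have /choice[f fE] : forall rs : 'I_2 * 'I_2, exists u : A * A,
    X rs.1 rs.2 = u.1 * (if rs.2 == 0 then a else b) + u.2 * (if rs.2 == 0 then a' else b').
  case=> r s /=; have [h0 h1] := H r.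
  case: (eqVneq s 0) => [->|s0].
    by have /lidealP[u [u' ->]] := h0; exists (u, u').
  have -> : s = 1 by case: s s0 => [[|[|?]] ?] //= _; exact: val_inj.
  by have /lidealP[u [u' ->]] := h1; exists (u, u').
apply/lidealP; exists (\matrix_(r, s) (f (r, s)).1), (\matrix_(r, s) (f (r, s)).2).
by apply/matrixP => r s; rewrite (fE (r, s)) [RHS]mxE !mulr_dg2 !mxE.
Qed.

(** Change of basis: right multiplication by the unit P carries the generators to g and g' up to the
    left units K and L, which do not change a left ideal. *)
Lemma lideal_conj (A : nzRingType) (P P' K K' L L' y y' g g' : A) :
  P * P' = 1 -> K' * K = 1 -> L' * L = 1 -> K * K' = 1 -> L * L' = 1 ->
  y * P = K * g -> y' * P = L * g' ->
  forall a, a * P \in lideal g g' <-> a \in lideal y y'.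
Proof.
move=> PP KK LL KK2 LL2 yP yP' a.
split=> [/lidealP[b [b' e]]|/lidealP[b [b' ->]]]; apply/lidealP.
  exists (b * K'), (b' * L').
  rewrite -[LHS]mulr1 -PP mulrA e -[y]mulr1 -PP [y * _]mulrA yP.
  rewrite -[y' in RHS]mulr1 -PP [y' * _]mulrA yP' mulrDl.
  by rewrite -!mulrA (mulrA K') KK mul1r (mulrA L') LL mul1r.
by exists (b * K), (b' * L); rewrite mulrDl -!mulrA yP yP'.
Qed.

Section LineForms.
Variables (k : fieldType) (i : sqrtN1 k) (o r s t : 'I_4).
Implicit Type v : 'rV[k]_4.
Local Notation dl := (delta_mx (0 : 'I_1)).

(* [lnA v] and [lnB v] are the forms y, y' on P(Qtilde_1^* ), [fmA v] and [fmB v] cut out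
   the chord through the point [v] and its translate in P(Q_1^* ), and [flip] is
   translation by [xi_s]. *)
Definition lnA v : 'rV[k]_4 := (val i * v 0 r) *: dl o + v 0 o *: dl r.
Definition lnB v : 'rV[k]_4 := (val i * v 0 t) *: dl s - v 0 s *: dl t.
Definition fmA v : 'rV[k]_4 := v 0 r *: dl o - v 0 o *: dl r.
Definition fmB v : 'rV[k]_4 := v 0 t *: dl s - v 0 s *: dl t.
Definition flip v : 'rV[k]_4 := \row_j (if (j == r) || (j == t) then - v 0 j else v 0 j).

End LineForms.

Section GenericForms.
Variables (k : fieldType) (A : algType k) (x : 'I_4 -> A).
Local Notation emb := (map_mx (in_alg A) : 'M[k]_2 -> 'M[A]_2).
Local Notation dl := (delta_mx (0 : 'I_1)).
Definition Jmx : 'M[k]_2 := dg2 1 (-1).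
Definition sl (c : 'rV[k]_4) : A := \sum_j c 0 j *: x j.

Lemma sl_comb a b c d : sl (a *: c + b *: d) = a *: sl c + b *: sl d.
Proof.
rewrite /sl !scaler_sumr -big_split; apply: eq_bigr => j _ /=.
by rewrite !mxE scalerDl !scalerA.
Qed.

Lemma sl_combA a b c d : sl (a *: c + b *: d) = a%:A * sl c + b%:A * sl d.
Proof. by rewrite sl_comb !mulr_algl. Qed.

Lemma sl_dl j : sl (dl j) = x j.
Proof.
rewrite /sl (bigD1 j) //= mxE !eqxx scale1r big1 ?addr0 // => m mj.
by rewrite mxE (negPf mj) andbF scale0r.
Qed.

Lemma sl_eigen (f : A -> A) (e : k) a b m n :
  (forall u v, f (u + v) = f u + f v) -> (forall c u, f (c *: u) = c *: f u) ->
  f (x m) = e *: x m -> f (x n) = e *: x n ->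
  f (sl (a *: dl m - b *: dl n)) = e *: sl (a *: dl m - b *: dl n).
Proof.
move=> fD fZ fm fn; rewrite -scaleNr sl_comb !sl_dl fD !fZ fm fn.
by rewrite scalerDr !scalerA ![e * _]mulrC.
Qed.

Lemma JJ : Jmx *m Jmx = 1%:M.
Proof.
apply/matrixP => a b; rewrite mul_dg2 !mxE -val_eqE /=.
by case: a b => [[|[|?]] ?] [[|[|?]] ?] //=; rewrite ?mulr1n ?mulr0n ?mulr1 ?mulrN1 ?oppr0 ?mul0r ?opprK.
Qed.

Lemma emb_mul (B C : 'M[k]_2) : emb (B *m C) = emb B *m emb C.
Proof. exact: map_mxM. Qed.

(** The entries are one linear form at a point and at its flip, which differ in the sign of [a].
    Taking out [Jmx] moves that sign to the second term, where it matches the diagonalized q_r. *)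
Lemma dg2_form (a b : k) (u v : A) :
  dg2 (a *: u - b *: v) (- a *: u - b *: v) =
  emb Jmx *m (emb a%:M *m u%:M - emb (b *: Jmx) *m v%:M).
Proof.
have C (B : 'M[k]_2) (w : A) p q : (emb B *m w%:M) p q = B p q *: w.
  by rewrite -diag_const_mx mul_mx_diag !mxE /= -scalerAl mul1r.
rewrite mulmxBr !mulmxA -!emb_mul -scalemxAr JJ mul_mx_scalar.
have E (Y Z : 'M[A]_2) p q : (Y - Z) p q = Y p q - Z p q by rewrite !mxE.
apply/matrixP => p q; rewrite E !C /dg2 !mxE.
case: p q => [[|[|?]] ?] [[|[|?]] ?] //=;
  rewrite -?val_eqE /= ?mulr1n ?mulr0n ?mulr1 ?mulr0 ?mulrN1 ?scale0r ?oppr0 ?addr0 //.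
Qed.

(* [q] is the matrix of the action on [k^2] of the factors of [x_o], [x_r], [x_s], [x_t] *)
Lemma form_conj (i : sqrtN1 k) (o r s t : 'I_4) (qr qs qt P S : 'M[k]_2)
    (v : 'rV[k]_4) :
  uniq [:: o; r; s; t] ->
  qr *m P = P *m (- val i *: Jmx) -> qs *m P = P *m S -> qt = qr *m qs ->
  Jmx *m S = - (S *m Jmx) ->
  (emb ((val i * v 0 r)%:M) *m (x o)%:M + emb (v 0 o *: qr) *m (x r)%:M) *m emb P =
    emb (P *m (val i *: Jmx)) *m
      dg2 (sl (fmA o r v)) (sl (fmA o r (flip r t v))) /\
  (emb ((val i * v 0 t) *: qs) *m (x s)%:M + emb (- v 0 s *: qt) *m (x t)%:M) *m emb P =
    emb (P *m S *m (val i *: Jmx)) *m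
      dg2 (sl (fmB s t v)) (sl (fmB s t (flip r t v))).
Proof.
rewrite /= !inE !negb_or => /and4P[/and3P[or os ot] /andP[rs rt] st _].
move=> qrP qsP -> JS; have /eqP ii := valP i; rewrite expr2 in ii.
have mv (B : 'M[k]_2) (u : A) : emb B *m u%:M *m emb P = emb (B *m P) *m u%:M.
  by rewrite -mulmxA -mx_alg_comm mulmxA -emb_mul.
have slE a b c d : sl (a *: dl c - b *: dl d) = a *: x c - b *: x d.
  by rewrite -scaleNr sl_comb !sl_dl scaleNr.
have fA : sl (fmA o r (flip r t v)) = - v 0 r *: x o - v 0 o *: x r.
  by rewrite slE !mxE eqxx (negPf or) (negPf ot).
have fB : sl (fmB s t (flip r t v)) = - v 0 t *: x s - v 0 s *: x t.
  by rewrite slE !mxE eqxx orbT [s == r]eq_sym (negPf rs) (negPf st).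
rewrite fA fB !slE !dg2_form !mulmxDl !mv.
have half (Z : 'M[k]_2) (W : 'M[A]_2) :
    emb (Z *m (val i *: Jmx)) *m (emb Jmx *m W) = emb (val i *: Z) *m W.
  by rewrite mulmxA -emb_mul -scalemxAr -scalemxAl -mulmxA JJ mulmx1.
rewrite !half !mulmxBr !mulmxA -!emb_mul -!mulNmx.
have embN (Z : 'M[k]_2) : - emb Z = emb (- Z).
  by apply/matrixP => p q; rewrite !mxE raddfN.
rewrite !embN; split; congr (emb _ *m _ + emb _ *m _).
- by rewrite mul_scalar_mx mul_mx_scalar scalerA mulrC.
- by rewrite -!scalemxAl qrP -!scalemxAr !scalerA mulrN scaleNr mulrC.
- by rewrite -scalemxAl qsP mul_mx_scalar scalerA mulrC.
rewrite -!scalemxAl -scalemxAr -!mulmxA qsP (mulmxA qr) qrP -!mulmxA.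
rewrite -scalemxAl -scalemxAr JS !mulmxN !scalerN !scaleNr opprK scalerA.
by rewrite scalerN scalerA mulrC.
Qed.
End GenericForms.

Lemma lquot_pair_sum (R : nzRingType) (l1 l1' l2 l2' : R) (J : finType) (A a b : J -> R) :
  \sum_j A j *: ((lquot_pi l1 l1' (a j), lquot_pi l2 l2' (b j)) : lquot l1 l1' * lquot l2 l2') =
  (lquot_pi l1 l1' (\sum_j A j * a j), lquot_pi l2 l2' (\sum_j A j * b j)).
Proof.
rewrite !lquot_pi_sum; apply: injective_projections.
  rewrite /= (big_morph fst (id1 := 0) (op1 := +%R)) //; apply: eq_bigr => j _.
  exact: lquot_piZ.
rewrite /= (big_morph snd (id1 := 0) (op1 := +%R)) //; apply: eq_bigr => j _.
exact: lquot_piZ.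
Qed.

(** * The module (M_1 + M_2) (x) k^2 as a cyclic module *)

Section ColumnModule.
Variables (k : fieldType) (alpha beta gamma : k) (i : sqrtN1 k).
Local Notation Q := (skl alpha beta gamma).
Local Notation Qg := (skl_graded alpha beta gamma).
Local Notation R := (Qp_graded alpha beta gamma).
Local Notation emb := (embM alpha beta gamma).
Variables (l1 l1' l2 l2' : Qg).
Local Notation N := (gcolumn (gsum (lquot2 l1 l1') (lquot2 l2 l2'))).
Local Notation pi1 := (lquot_pi l1 l1').
Local Notation pi2 := (lquot_pi l2 l2').

Definition in_cols (X : 'M[Q]_2) : Prop :=
  forall r, X r 0 \in lideal l1 l1' /\ X r 1 \in lideal l2 l2'.

(** A column of pairs is a 2x2 matrix whose first column is read modulo the first ideal and whose
    second column modulo the second. Hence the image of any invertible scalar matrix generates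
    [N]. *)
Definition colpi (X : 'M[Q]_2) : N := \col_r (pi1 (X r 0), pi2 (X r 1)).

Lemma colpi_eq0 X : colpi X = 0 <-> in_cols X.
Proof.
split=> [X0 r|H].
  have := congr1 (fun w : 'cV[lquot2 l1 l1' * lquot2 l2 l2']_2 => w r 0) X0.
  rewrite /colpi mxE mxE => -[h1 h2].
  split.
    exact: (proj1 (@lquot_pi_eq0 Q l1 l1' (X r 0)) h1).
  exact: (proj1 (@lquot_pi_eq0 Q l2 l2' (X r 1)) h2).
apply/matrixP => r s; rewrite mxE [RHS]mxE; have [h1 h2] := H r.
have e1 := proj2 (@lquot_pi_eq0 Q l1 l1' (X r 0)) h1.
have e2 := proj2 (@lquot_pi_eq0 Q l2 l2' (X r 1)) h2.
exact: (congr2 pair e1 e2).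
Qed.

Lemma colpi_surj (w : N) : exists X, w = colpi X.
Proof.
have /choice[f fE] : forall r : 'I_2, exists u : Q * Q,
    (w : 'cV[lquot2 l1 l1' * lquot2 l2 l2']_2) r 0 = (pi1 u.1, pi2 u.2).
  move=> r; have [a aE] := @lquot_pi_surj Q l1 l1' (w r 0).1.
  have [b bE] := @lquot_pi_surj Q l2 l2' (w r 0).2.
  by exists (a, b); rewrite /= -aE -bE -surjective_pairing.
exists (\matrix_(r, s) if s == 0 then (f r).1 else (f r).2).
by apply/matrixP => r s; rewrite ord1 fE !mxE.
Qed.

Lemma colpiZ (A : R) X : A *: colpi X = colpi (A *m X).
Proof.
have cE (Y : 'M[Q]_2) r : colpi Y r 0 = (pi1 (Y r 0), pi2 (Y r 1)) by rewrite mxE.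
have mE r s : (A *m X) r s = \sum_j A r j * X j s by rewrite mxE.
apply/matrixP => r s; rewrite ord1 cE (mE r 0) (mE r 1).
transitivity (\sum_j A r j *: colpi X j 0); first by rewrite [LHS]mxE.
under eq_bigr do rewrite cE.
exact: lquot_pair_sum.
Qed.

Lemma colpiB X Y : colpi X - colpi Y = colpi (X - Y).
Proof.
have cE (Z : 'M[Q]_2) r : colpi Z r 0 = (pi1 (Z r 0), pi2 (Z r 1)) by rewrite mxE.
have mE r s : (X - Y) r s = X r s - Y r s by rewrite !mxE.
apply/matrixP => r s; rewrite ord1 cE (mE r 0) (mE r 1) !lquot_piB.
by transitivity (colpi X r 0 - colpi Y r 0); rewrite ?cE //; rewrite !mxE.
Qed.

Lemma colpi_deg n (X : R) : gr_deg n X -> gm_deg n%:Z (colpi X).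
Proof.
move=> Xn r; rewrite mxE; split.
  by exists (X r 0); split=> //; exact: Xn.
by exists (X r 1); split=> //; exact: Xn.
Qed.

Lemma deg_colpi n (w : N) : gm_deg n%:Z w -> exists2 X : R, gr_deg n X & w = colpi X.
Proof.
move=> wn.
have /choice[f fE] : forall r : 'I_2, exists u : Q * Q,
    (w : 'cV[lquot2 l1 l1' * lquot2 l2 l2']_2) r 0 = (pi1 u.1, pi2 u.2) /\
    (skl_deg n u.1 /\ skl_deg n u.2).
  move=> r; have [[a [an aE]] [b [bn bE]]] := wn r.
  by exists (a, b); rewrite /= -aE -bE -surjective_pairing.
exists ((\matrix_(r, s) if s == 0 then (f r).1 else (f r).2) : 'M[Q]_2).
  by move=> r s; rewrite mxE; case: (fE r) => _ []; case: (s == 0).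
by apply/matrixP => r s; rewrite ord1 (proj1 (fE r)) !mxE.
Qed.

Lemma deg_neg n (w : N) : gm_deg (Negz n) w -> w = 0.
Proof.
move=> wn; apply/matrixP => r s; rewrite ord1 [RHS]mxE.
by have [h1 h2] := wn r; rewrite [LHS]surjective_pairing h1 h2.
Qed.

Lemma colpi_isom (P P' : 'M[k]_2) (y y' : R) : P *m P' = 1%:M -> P' *m P = 1%:M ->
  (forall A : R, in_cols (A *m emb P) <-> A \in lideal y y') ->
  graded_isom (lquot2 y y') N.
Proof.
move=> PP' P'P ann.
have annE (A : R) : A *: colpi (emb P) = 0 <-> A \in lideal y y'.
  by rewrite colpiZ colpi_eq0.
have eP (X : R) : (X *m emb P') *m emb P = X.
  by rewrite -mulmxA -[_ *m emb P]/(_ * _) -rmorphM /= -[P' * P]/(P' *m P) P'P rmorph1 mulmx1.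
have [|| f fE] := @lquot_lift R y y' N (colpi (emb P)).
- by apply/annE; exact: lideal_l.
- by apply/annE; exact: lideal_r.
exists f; split.
  have fI : injective f.
    move=> u v; have [a ->] := lquot_pi_surj u; have [b ->] := lquot_pi_surj v.
    rewrite !fE => e; apply/lquot_pi_eq/annE.
    by rewrite scalerBl e subrr.
  have /choice[g gP] : forall w : N, exists u, f u = w.
    move=> w; have [X ->] := colpi_surj w; exists (lquot_pi y y' ((X : R) *m emb P')).
    by rewrite fE colpiZ eP.
  by exists g => // u; apply: fI; exact: gP.
have [pr prP] := R_grading alpha beta gamma.
move=> n v; have [a aE] := lquot_pi_surj (v : lquot y y').
case: n => [n|n]; split.
- move=> [b [bn ->]]; rewrite fE colpiZ; apply: (@colpi_deg n (b * emb P)).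
  by rewrite -[n]addn0; apply: (grdegM prP bn); exact: deg_iota.
- rewrite aE fE colpiZ => /deg_colpi[X Xn XE].
  exists (X * emb P'); split.
    by rewrite -[n]addn0; apply: (grdegM prP Xn); exact: deg_iota.
  apply/lquot_pi_eq/ann.
  rewrite mulmxBl [X in _ - X]eP; apply/colpi_eq0.
  by rewrite -colpiB XE subrr.
- by move=> ->; rewrite raddf0 => r; rewrite mxE.
by rewrite aE fE => /deg_neg /annE /lquot_pi_eq0.
Qed.

End ColumnModule.

Section SpanTwo.
Variables (k : fieldType).
Local Notation dl := (delta_mx (0 : 'I_1)).

Lemma span2P (V : vectType k) (u w z : V) :
  reflect (exists a b, z = a *: u + b *: w) (z \in <<[:: u; w]>>%VS).
Proof.
rewrite span_cons span_seq1; apply: (iffP memv_addP) => [[x xu [y yw ->]]|[a [b ->]]].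
  have /vlineP[a ->] := xu; have /vlineP[b ->] := yw; by exists a, b.
exists (a *: u); first exact/memvZ/memv_line.
by exists (b *: w); first exact/memvZ/memv_line.
Qed.

Lemma proportional (a b p q : k) : (a, b) != (0, 0) -> b * p - a * q = 0 ->
  exists x, p = x * a /\ q = x * b.
Proof.
rewrite xpair_eqE negb_and => ab /eqP; rewrite subr_eq0 => /eqP e.
have [a0|a0] := eqVneq a 0.
  rewrite a0 eqxx /= in ab; exists (q / b); rewrite a0 mulr0 mulfVK //; split=> //.
  by apply: (mulfI ab); rewrite e a0 mul0r mulr0.
exists (p / a); rewrite mulfVK //; split=> //.
by apply: (mulfI a0); rewrite -e mulrA [a * (p / a)]mulrC mulfVK // mulrC.
Qed.

Lemma span2_line (o r s t : 'I_4) (a b c d : k) : uniq [:: o; r; s; t] ->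
  (a, b) != (0, 0) -> (c, d) != (0, 0) ->
  is_line (b *: dl o - a *: dl r) (d *: dl s - c *: dl t)
    <<[:: (a *: dl o + b *: dl r)%R; (c *: dl s + d *: dl t)%R]>>%VS.
Proof.
move=> un ab cd.
have enum4 j : j \in [:: o; r; s; t].
  have: ([:: o; r; s; t] =i predT); last by move->.
  by apply/subset_cardP; [rewrite (card_uniqP un) card_ord|apply/subsetP].
move: (un); rewrite /= !inE !negb_or => /and4P[/and3P[or os ot] /andP[rs rt] st _].
have [ro so sr] : [/\ (r == o) = false, (s == o) = false & (s == r) = false].
  by split; rewrite eq_sym; [exact: negPf or|exact: negPf os|exact: negPf rs].
have [to tr ts] : [/\ (t == o) = false, (t == r) = false & (t == s) = false].
  by split; rewrite eq_sym; [exact: negPf ot|exact: negPf rt|exact: negPf st].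
have E := (negPf or, negPf os, negPf ot, negPf rs, negPf rt, negPf st, (ro, so, sr), (to, tr, ts), eqxx).
have dotd x y m n (v : 'rV[k]_4) : dot (x *: dl m - y *: dl n) v = x * v 0 m - y * v 0 n.
  rewrite -scaleNr dot_linear -mulNr.
  have D l : dot (dl l) v = v 0 l.
    rewrite /dot (bigD1 l) //= mxE !eqxx mul1r big1 ?addr0 // => l' ll.
    by rewrite mxE (negPf ll) andbF mul0r.
  by rewrite !D.
have mem v : v \in <<[:: (a *: dl o + b *: dl r)%R; (c *: dl s + d *: dl t)%R]>>%VS <->
    b * v 0 o - a * v 0 r = 0 /\ d * v 0 s - c * v 0 t = 0.
  split=> [/span2P[x [y ->]]|[h1 h2]].
    by rewrite !mxE !eqxx ?E /=; split; ring.
  have [x [xo xr]] := proportional ab h1; have [y [ys yt]] := proportional cd h2.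
  apply/span2P; exists x, y; apply/rowP => j; rewrite !mxE !eqxx /=.
  by have := enum4 j; rewrite !inE => /or4P[]/eqP->; rewrite !E /=
     ?xo ?xr ?ys ?yt; ring.
split; last first.
  by move=> v; rewrite mem !dotd.
suff fr : free [:: (a *: dl o + b *: dl r)%R; (c *: dl s + d *: dl t)%R] by exact: (eqP fr).
rewrite free_cons seq1_free span_seq1; apply/andP; split.
  apply/negP => /vlineP[y e]; move: ab; rewrite xpair_eqE.
  have := congr1 (fun v : 'rV[k]_4 => v 0 o) e; have := congr1 (fun v : 'rV[k]_4 => v 0 r) e.
  rewrite !mxE !E /= !(mulr0, mulr1, addr0, add0r) => -> ->.
  by rewrite eqxx.
apply/eqP => e; move: cd; rewrite xpair_eqE.
have := congr1 (fun v : 'rV[k]_4 => v 0 s) e; have := congr1 (fun v : 'rV[k]_4 => v 0 t) e.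
rewrite !mxE !E /= !(mulr0, mulr1, addr0, add0r) => -> ->.
by rewrite eqxx.
Qed.
End SpanTwo.

Definition cyc (r s t : 'I_4) : bool :=
  (r : nat, s : nat, t : nat) \in [:: (1, 2, 3); (2, 3, 1); (3, 1, 2)]%N.

Lemma cyc_uniq r s t : cyc r s t -> uniq [:: 0; r; s; t].
Proof.
case: r s t => [[|[|[|[|?]]]] ?] [[|[|[|[|?]]]] ?] [[|[|[|[|?]]]] ?] //.
Qed.

Lemma cyc_neg r s t : cyc r s t -> forall j, gam_neg (gj r) j = (j == s) || (j == t).
Proof.
case: r s t => [[|[|[|[|?]]]] ?] [[|[|[|[|?]]]] ?] [[|[|[|[|?]]]] ?] //;
by move=> _ [[|[|[|[|?]]]] ?].
Qed.

Section CycQ.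
Variables (k : fieldType) (i : sqrtN1 k).
Local Notation q j := (qmx i (gj j)).

Lemma cyc_q r s t : cyc r s t -> q t = q r *m q s.
Proof.
have /eqP ii := valP i; rewrite expr2 in ii.
case: r s t => [[|[|[|[|?]]]] ?] [[|[|[|[|?]]]] ?] [[|[|[|[|?]]]] ?] // _;
  rewrite /qmx /=;
  apply/matrixP => -[[|[|?]] ?] [[|[|?]] ?] //;
  rewrite !mxE ?big_ord_recl ?big_ord0 !mxE /=;
  rewrite ?(mulrN, mulNr, mul0r, mulr0, mul1r, mulr1, opprK, oppr0, addr0, add0r, ii) //.
Qed.

Lemma q_sq d : d != gam1 -> qmx i d *m qmx i d = - 1%:M.
Proof.
have /eqP ii := valP i; rewrite expr2 in ii.
case: d => [[] []] // _; rewrite /qmx /=;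
  apply/matrixP => -[[|[|?]] ?] [[|[|?]] ?] //;
  rewrite !mxE ?big_ord_recl ?big_ord0 !mxE /=;
  rewrite ?(mulrN, mulNr, mul0r, mulr0, mul1r, mulr1, opprK, oppr0, addr0, add0r, ii, mulr0n, mulr1n) //.
Qed.

Lemma cyc_anti r s t : cyc r s t -> q r *m q s = - (q s *m q r).
Proof.
move=> c; rewrite qmx_comm (_ : chi _ _ = true) ?expr1 ?scaleN1r //.
by case: r s t c => [[|[|[|[|?]]]] ?] [[|[|[|[|?]]]] ?] [[|[|[|[|?]]]] ?].
Qed.

Lemma cyc_gj r s t : cyc r s t -> (gj r != gam1) && (gj s != gam1).
Proof.
by case: r s t => [[|[|[|[|?]]]] ?] [[|[|[|[|?]]]] ?] [[|[|[|[|?]]]] ?].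
Qed.
End CycQ.

Section KeyIdeal.
Variables (k : fieldType) (alpha beta gamma : k) (i : sqrtN1 k).
Hypothesis hk : (2%:R : k) != 0.
Local Notation Q := (skl alpha beta gamma).
Local Notation Qg := (skl_graded alpha beta gamma).
Local Notation R := (Qp_graded alpha beta gamma).
Local Notation emb := (embM alpha beta gamma).
Local Notation lin := (@lin k alpha beta gamma i).
Local Notation x := (skl_x alpha beta gamma).
Local Notation sl := (sl x).
Local Notation q j := (qmx i (gj j)).
Local Notation dl := (delta_mx (0 : 'I_1)).

Lemma lin_two (a b : k) m n : lin (a *: dl m + b *: dl n) =
  emb (a *: q m) * (x m)%:M + emb (b *: q n) * (x n)%:M.
Proof.
have D j : lin (dl j) = emb (q j) * (x j)%:M.
  rewrite linE (bigD1 j) //= mxE !eqxx scale1r big1 ?addr0 // => l /negPf lj.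
  by rewrite mxE lj andbF scale0r rmorph0 mul0r.
rewrite lin_comb (D m) (D n) (iotaZ emb a) (iotaZ emb b).
have regroup (B : nzRingType) (u1 u2 u3 u4 u5 u6 : B) :
    u1 * (u2 * u3) + u4 * (u5 * u6) = u1 * u2 * u3 + u4 * u5 * u6 by rewrite !mulrA.
exact: (regroup R).
Qed.

Definition cols (v : 'rV[k]_4) (o r s t : 'I_4) (X : R) : Prop :=
  @in_cols k alpha beta gamma (sl (fmA o r v)) (sl (fmB s t v))
    (sl (fmA o r (flip r t v))) (sl (fmB s t (flip r t v))) X.

(* In a basis in which [q_r] is diagonal, [lin (lnA v)] and [lin (lnB v)] become, up to
   invertible left factors, diagonal matrices of linear forms. *)
Lemma key_ideal r s t (P P' : 'M[k]_2) v : cyc r s t ->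
  P *m P' = 1%:M -> P' *m P = 1%:M -> q r *m P = P *m (- val i *: Jmx k) ->
  forall A : R, cols v 0 r s t (A *m emb P) <->
    A \in lideal (lin (lnA i 0 r v)) (lin (lnB i s t v)).
Proof.
move=> c PP' P'P qP A; have un := cyc_uniq c.
have /eqP ii := valP i; rewrite expr2 in ii.
(* This is q_s in the eigenbasis of q_r; as q_s anticommutes with q_r, it anticommutes with
   [Jmx]. *)
pose S := P' *m q s *m P.
have qS : q s *m P = P *m S by rewrite !mulmxA PP' mul1mx.
have [r1 s1] := andP (cyc_gj c).
have i0 : val i != 0 by apply/eqP => i0; move/eqP: ii; rewrite i0 mul0r eq_sym oppr_eq0 oner_eq0.
have SS : S *m S = - 1%:M.
  rewrite /S -!mulmxA (mulmxA P P') PP' mul1mx (mulmxA (q s) (q s)) q_sq //.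
  by rewrite mulNmx mul1mx mulmxN P'P.
have JS : Jmx k *m S = - (S *m Jmx k).
  have e : P *m (- val i *: (Jmx k *m S)) = - (P *m (- val i *: (S *m Jmx k))).
    rewrite scalemxAl mulmxA -qP -mulmxA -qS mulmxA (cyc_anti i c) mulNmx -mulmxA qP.
    by rewrite mulmxA qS -mulmxA -scalemxAr.
  have := congr1 (mulmx P') e; rewrite mulmxN !mulmxA P'P !mul1mx.
  rewrite -scalerN => /(congr1 (fun X => (- val i)^-1 *: X)).
  by rewrite !scalerA mulVf ?oppr_eq0 // !scale1r.
have [e1 e2] := @form_conj k Q x i 0 r s t (q r) (q s) (q t) P S v un qP qS (cyc_q i c) JS.
apply: (iff_trans (iff_sym (lideal_cols (sl (fmA 0 r v)) (sl (fmB s t v))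
  (sl (fmA 0 r (flip r t v))) (sl (fmB s t (flip r t v))) (A *m emb P)))).
have iJ : (val i *: Jmx k) *m (- val i *: Jmx k) = 1%:M.
  by rewrite -scalemxAl -scalemxAr JJ scalerA mulrN ii opprK scale1r.
have iJ' : (- val i *: Jmx k) *m (val i *: Jmx k) = 1%:M.
  by rewrite -scalemxAl -scalemxAr JJ scalerA mulNr ii opprK scale1r.
clearbody S; pose K := P *m (val i *: Jmx k); pose K' := (- val i *: Jmx k) *m P'.
pose L := P *m S *m (val i *: Jmx k); pose L' := (- val i *: Jmx k) *m (- S) *m P'.
have inv (B C : 'M[k]_2) : B *m C = 1%:M -> emb B * emb C = 1.
  by move=> BC; rewrite -rmorphM /= -[B * C]/(B *m C) BC rmorph1.
apply: (@lideal_conj R (emb P) (emb P') (emb K) (emb K') (emb L) (emb L')).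
- exact: inv.
- by apply: inv; rewrite /K /K' -mulmxA (mulmxA P') P'P mul1mx.
- apply: inv; rewrite /L /L' -!mulmxA (mulmxA P') P'P mul1mx (mulmxA (- S)).
  by rewrite mulNmx SS opprK mul1mx.
- by apply: inv; rewrite /K /K' -mulmxA (mulmxA _ _ P') iJ mul1mx.
- apply: inv; rewrite /L /L' -!mulmxA (mulmxA _ _ (- S *m P')) iJ mul1mx.
  by rewrite (mulmxA S) mulmxN SS opprK mul1mx.
- have q0 : (val i * v 0 r) *: q 0 = (val i * v 0 r)%:M by rewrite scalemx1.
  by rewrite /lnA lin_two q0; exact: e1.
rewrite /lnB -scaleNr lin_two; exact: e2.
Qed.

End KeyIdeal.

Lemma matrix2P (A : Type) (X Y : 'M[A]_2) :
  X 0 0 = Y 0 0 -> X 0 1 = Y 0 1 -> X 1 0 = Y 1 0 -> X 1 1 = Y 1 1 -> X = Y.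
Proof.
move=> h00 h01 h10 h11; apply/matrixP => r s.
have I2 (j : 'I_2) : j = 0 \/ j = 1.
  by case: j => [[|[|?]] ?] //; [left|right]; apply: val_inj.
by case: (I2 r) => ->; case: (I2 s) => ->.
Qed.

Lemma sum2 (V : nmodType) (f : 'I_2 -> V) : \sum_j f j = f 0 + f 1.
Proof.
by rewrite !big_ord_recl big_ord0 addr0; congr (_ + f _); apply: val_inj.
Qed.

Lemma eigen_mx (k : fieldType) (i : sqrtN1 k) d : (2%:R : k) != 0 -> d != gam1 ->
  exists P P' : 'M[k]_2, [/\ P *m P' = 1%:M, P' *m P = 1%:M &
    qmx i d *m P = P *m (- val i *: Jmx k)].
Proof.
move=> hk d1; have /eqP ii := valP i; rewrite expr2 in ii.
suff [P [P' [PP' e]]] : exists P P' : 'M[k]_2, P *m P' = 2%:R%:M /\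
    qmx i d *m P = P *m (- val i *: Jmx k).
  have PP1 : P *m (2%:R^-1 *: P') = 1%:M.
    by rewrite -scalemxAr PP' -mul_scalar_mx -scalar_mxM mulVf.
  by exists P, (2%:R^-1 *: P'); split=> //; exact: mulmx1C.
set I := val i in ii *.
have close (P P' : 'M[k]_2) (D : 'M[k]_2) :
    P 0 0 * P' 0 0 + P 0 1 * P' 1 0 = 2%:R -> P 0 0 * P' 0 1 + P 0 1 * P' 1 1 = 0 ->
    P 1 0 * P' 0 0 + P 1 1 * P' 1 0 = 0 -> P 1 0 * P' 0 1 + P 1 1 * P' 1 1 = 2%:R ->
    D 0 0 * P 0 0 + D 0 1 * P 1 0 = - I * P 0 0 ->
    D 0 0 * P 0 1 + D 0 1 * P 1 1 = I * P 0 1 ->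
    D 1 0 * P 0 0 + D 1 1 * P 1 0 = - I * P 1 0 ->
    D 1 0 * P 0 1 + D 1 1 * P 1 1 = I * P 1 1 ->
    exists P P' : 'M[k]_2, P *m P' = 2%:R%:M /\ D *m P = P *m (- I *: Jmx k).
  move=> p00 p01 p10 p11 d00 d01 d10 d11; exists P, P'; split; apply: matrix2P.
  - by rewrite mxE sum2 p00 mxE.
  - by rewrite mxE sum2 p01 mxE.
  - by rewrite mxE sum2 p10 mxE.
  - by rewrite mxE sum2 p11 mxE.
  - by rewrite -scalemxAr mxE sum2 d00 [RHS]mxE mul_dg2 mulr1.
  - by rewrite -scalemxAr mxE sum2 d01 [RHS]mxE mul_dg2 /= mulrN1 mulrNN.
  - by rewrite -scalemxAr mxE sum2 d10 [RHS]mxE mul_dg2 mulr1.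
  - by rewrite -scalemxAr mxE sum2 d11 [RHS]mxE mul_dg2 /= mulrN1 mulrNN.
have reduce (a b c : k) : a = b + c * (I * I + 1) -> a = b.
  by rewrite ii addNr mulr0 addr0.
(* In the order q_3, q_1, q_2: the columns of the first matrix are eigenvectors for -i and i, and
   the second matrix is twice the inverse of the first. The multiples of I^2 + 1, which [ring]
   cannot see to be 0, are removed by [reduce]. *)
case: d d1 => [[] []] // _; [
  apply: (close (mx2 1 1 I (- I)) (mx2 1 (- I) 1 I)) |
  apply: (close (mx2 0 1 1 0) (mx2 0 2%:R 2%:R 0)) |
  apply: (close (mx2 1 1 (-1) 1) (mx2 1 (-1) 1 1)) ];
  rewrite !mxE /= -?/I; first [ring | apply: (reduce _ _ 1); ring |
    apply: (reduce _ _ (-1)); ring | apply: (reduce _ _ (-2%:R)); ring].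
Qed.

Section Types.
Variables (k : fieldType) (alpha beta gamma : k) (i : sqrtN1 k).
Hypothesis hk : (2%:R : k) != 0.
Local Notation Q := (skl alpha beta gamma).
Local Notation Qg := (skl_graded alpha beta gamma).
Local Notation R := (Qp_graded alpha beta gamma).
Local Notation eqMod := (eqModule alpha beta gamma i).
Local Notation act := (@Qp_act k alpha beta gamma i : Gam -> R -> R).
Local Notation emb := (embM alpha beta gamma).
Local Notation lin := (@lin k alpha beta gamma i).
Local Notation x := (skl_x alpha beta gamma).
Local Notation sl := (sl x).
Local Notation q j := (qmx i (gj j)).
Local Notation dl := (delta_mx (0 : 'I_1)).
Local Notation line_mod := (@line_mod k alpha beta gamma i).

Lemma sl_lideal c c' d (L : {vspace 'rV[k]_4}) :
  is_line c c' L -> (forall v, v \in L -> dot d v = 0) ->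
  sl d \in lideal (sl c) (sl c').
Proof.
move=> Lcc /(is_line_span Lcc)[a [b ->]]; apply/lidealP; exists a%:A, b%:A.
exact: sl_combA.
Qed.

Lemma sl_lideal_eq c c' d d' (L : {vspace 'rV[k]_4}) :
  is_line c c' L -> is_line d d' L ->
  forall u, u \in lideal (sl c) (sl c') <-> u \in lideal (sl d) (sl d').
Proof.
move=> Lc Ld u; split; apply: lideal_sub.
- by apply: (sl_lideal Ld) => v /(is_line_dot Lc)[].
- by apply: (sl_lideal Ld) => v /(is_line_dot Lc)[].
- by apply: (sl_lideal Lc) => v /(is_line_dot Ld)[].
- by apply: (sl_lideal Lc) => v /(is_line_dot Ld)[].
Qed.

(** At most one coordinate vanishes. All points of E satisfy this ([cone_good]), and under it every
    pair of coordinates determines a point of a projective line. *)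
Definition good (v : 'rV[k]_4) := forall a b, a != b -> v 0 a = 0 -> v 0 b <> 0.

(* the line through [v] and its translate by [xi_r] *)
Definition chord (o r s t : 'I_4) (v : 'rV[k]_4) : {vspace 'rV[k]_4} :=
  <<[:: (v 0 o *: dl o + v 0 r *: dl r)%R; (v 0 s *: dl s + v 0 t *: dl t)%R]>>%VS.

Lemma good_pair v a b : good v -> a != b -> (v 0 a, v 0 b) != (0, 0).
Proof.
by move=> gv ab; rewrite xpair_eqE; apply/negP => /andP[/eqP a0 /eqP b0]; exact: (gv a b).
Qed.

Lemma chord_line v r s t : cyc r s t -> good v ->
  is_line (fmA 0 r v) (fmB s t v) (chord 0 r s t v).
Proof.
move=> c gv; have un := cyc_uniq c; apply: span2_line => //; apply: good_pair => //.
  by move: un; rewrite /= !inE !negb_or => /and4P[/and3P[]].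
by move: un; rewrite /= !inE !negb_or => /and4P[_ _ ? _].
Qed.

Lemma flip_good v r t : good v -> good (flip r t v).
Proof.
move=> gv a b ab a0 b0; apply: (gv a b ab).
  by move: a0; rewrite mxE; case: ifP => // _ /eqP; rewrite oppr_eq0 => /eqP.
by move: b0; rewrite mxE; case: ifP => // _ /eqP; rewrite oppr_eq0 => /eqP.
Qed.

Section Given.
Variables (r s t : 'I_4) (v : 'rV[k]_4) (c1 c1' c2 c2' : 'rV[k]_4).
Hypotheses (c : cyc r s t) (gv : good v).
Hypotheses (L1 : is_line c1 c1' (chord 0 r s t v)).
Hypotheses (L2 : is_line c2 c2' (chord 0 r s t (flip r t v))).
Local Notation N := (gcolumn (gsum
  (@lquot2 Qg (skl_lin alpha beta gamma c1) (skl_lin alpha beta gamma c1'))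
  (@lquot2 Qg (skl_lin alpha beta gamma c2) (skl_lin alpha beta gamma c2')))).

Lemma in_cols_cols (X : R) :
  @in_cols k alpha beta gamma (sl c1) (sl c1') (sl c2) (sl c2') X <->
  @cols k alpha beta gamma v 0 r s t X.
Proof.
have E1 := sl_lideal_eq L1 (chord_line c gv).
have E2 := sl_lideal_eq L2 (chord_line c (@flip_good v r t gv)).
split=> H a; have [h1 h2] := H a.
  exact: (conj (proj1 (E1 (X a 0)) h1) (proj1 (E2 (X a 1)) h2)).
exact: (conj (proj2 (E1 (X a 0)) h1) (proj2 (E2 (X a 1)) h2)).
Qed.

Lemma line_mod_type : graded_isom (line_mod (lnA i 0 r v) (lnB i s t v)) N.
Proof.
have [P [P' [PP' P'P qP]]] := eigen_mx i hk (proj1 (andP (cyc_gj c))).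
apply: (colpi_isom PP' P'P) => A.
exact: (iff_trans (in_cols_cols _) (key_ideal v c PP' P'P qP A)).
Qed.

End Given.

(* A scalar matrix killing a non-zero invariant vanishes: its [q_e]-components do. *)
Lemma emb_kill (M : eqMod) (m : M) (B : 'M[k]_2) : m \in @em_inv _ _ _ _ _ M ->
  m != 0 -> emb B *: m = 0 -> B = 0.
Proof.
move=> mP m0 Bm.
have [a [aE adeg]] := R_decomp i hk (emb B).
have /choice[b bE] : forall e, exists b, val (a e) = emb b%:M.
  by move=> e; apply: T_deg0 => //; exact: (adeg 0%N (deg_iota _ _ _ _) e).
have em0 e : (val (a e) : R) *: m = 0.
  have inv e' : (val (a e') : R) *: m \in @em_inv _ _ _ _ _ M.
    by apply/forallP => d; rewrite em_act_semi (em_inv_fixed mP) (Qt_valP (a e') d).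
  apply: (em_indep hk inv _ e); rewrite -[RHS]Bm aE scaler_suml.
  by apply: eq_bigr => e' _; rewrite scalerA.
have b0 e : b e = 0.
  apply/eqP/negPn/negP => be; case/negP: m0; apply/eqP.
  by apply: (iota_scale0 (iota := emb) be); rewrite -bE; exact: em0.
apply: (embM_inj (alpha := alpha) (beta := beta) (gamma := gamma)).
rewrite aE big1 // => e _; rewrite bE b0.
by rewrite (_ : 0%:M = 0) ?rmorph0 ?mulr0 //; exact: raddf0.
Qed.

Lemma act_scalar_mx d (u : Q) (e : k) : skl_act d u = e *: u ->
  act d (u%:M : 'M[Q]_2) = emb e%:M * u%:M.
Proof.
move=> ue; apply: twist_scalar => //; first exact: raddf0.
by rewrite mulmxV ?qmx_unit.
Qed.

Lemma sl_act d a b m n (e : bool) :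
  gam_neg d m = e -> gam_neg d n = e ->
  skl_act d (sl (a *: dl m - b *: dl n)) = (-1) ^+ e *: sl (a *: dl m - b *: dl n).
Proof.
move=> em en; apply: sl_eigen; [exact: skl_actD|exact: skl_actZ| |].
  by rewrite -em; exact: skl_act_x.
by rewrite -en; exact: skl_act_x.
Qed.
End Types.

Section Entries.
Variables (k : fieldType) (A : algType k).
Local Notation emb := (map_mx (in_alg A) : 'M[k]_2 -> 'M[A]_2).

Lemma scalar_emb_entry (l : A) (B : 'M[k]_2) a b : (l%:M *m emb B) a b = B a b *: l.
Proof. by rewrite mul_scalar_mx !mxE /= -scalerAr mulr1. Qed.

Lemma emb_scalar_entry (e : k) (X : 'M[A]_2) a b : (emb e%:M *m X) a b = e *: X a b.
Proof.
rewrite -[in LHS]diag_const_mx map_diag_mx mul_diag_mx !mxE /=.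
by rewrite -scalerAl mul1r.
Qed.

Lemma emb_chain_entry (e : k) (l : A) (B C : 'M[k]_2) a b :
  (emb e%:M *m l%:M *m emb B *m emb C) a b = (e * (B *m C) a b) *: l.
Proof.
have eM : emb B *m emb C = emb (B *m C) by rewrite map_mxM.
by rewrite -!mulmxA eM emb_scalar_entry scalar_emb_entry scalerA.
Qed.

Lemma emb_swap_entry (X : 'M[A]_2) (B : 'M[k]_2) a :
  B 0 0 = 0 -> B 0 1 = 1 -> B 1 0 = 1 -> B 1 1 = 0 ->
  (X *m emb B) a 0 = X a 1 /\ (X *m emb B) a 1 = X a 0.
Proof.
move=> b00 b01 b10 b11; rewrite !(mxE, sum2) b00 b01 b10 b11 /=.
by rewrite scale0r scale1r !mulr0 !mulr1 addr0 add0r.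
Qed.
End Entries.

Lemma delta_sandwich (k : fieldType) (X Y : 'M[k]_2) e a b :
  (X *m (delta_mx e e *m Y)) a b = X a e * Y e b.
Proof.
rewrite mxE (bigD1 e) //= big1 ?addr0 => [|j je].
  rewrite mxE (bigD1 e) //= big1 ?addr0 => [|j je]; first by rewrite mxE !eqxx mul1r.
  by rewrite mxE (negPf je) andbF mul0r.
rewrite mxE big1 ?mulr0 // => m _.
by rewrite mxE (negPf je) mul0r.
Qed.

(** * Classification of the equivariant modules over a given sum of two line modules *)

Section FormsIndep.
Variables (k : fieldType) (alpha beta gamma : k).
Hypothesis hk : (2%:R : k) != 0.
Local Notation Q := (skl alpha beta gamma).
Local Notation Qg := (skl_graded alpha beta gamma).
Local Notation sl := (sl (skl_x alpha beta gamma)).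

Lemma sl_deg c : @gr_deg Qg 1 (sl c).
Proof. by apply: skl_deg_sum => j _; apply/skl_degZ/skl_deg_x. Qed.

Lemma sl_inj c : sl c = 0 -> c = 0.
Proof.
move=> c0; apply/rowP => j; rewrite mxE.
have [|_ -> //] := @skl_indep k alpha beta gamma 0 (fun j => c 0 j).
by rewrite scale0r add0r.
Qed.

Lemma sl_in_lideal c d d' : sl c \in lideal (sl d) (sl d') ->
  exists a b, c = a *: d + b *: d'.
Proof.
have [pr prP] := skl_grading alpha beta gamma.
move=> /(deg1_lideal prP (sl_deg d) (sl_deg d') (sl_deg c))[b [b' [/skl_deg0P[e ->] /skl_deg0P[e' ->]]]].
move=> h; exists e, e'; apply/eqP; rewrite -subr_eq0; apply/eqP/sl_inj.
have -> : c - (e *: d + e' *: d') = 1 *: c + (-1) *: (e *: d + e' *: d').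
  by rewrite scale1r scaleN1r.
rewrite sl_comb sl_combA h scale1r scaleN1r; exact: subrr.
Qed.

(** In degree 1 the coefficients are scalars. Comparing the coordinates of each form with those of
    its sign-changed copy gives v_r v_0 = 0 and v_t v_s = 0, hence two vanishing coordinates. *)
Lemma chord_forms_disjoint v r s t : cyc r s t -> good v ->
  sl (fmA 0 r v) \in lideal (sl (fmA 0 r (flip r t v))) (sl (fmB s t (flip r t v))) ->
  sl (fmB s t v) \in lideal (sl (fmA 0 r (flip r t v))) (sl (fmB s t (flip r t v))) ->
  False.
Proof.
move=> c gv /sl_in_lideal[a [b e1]] /sl_in_lideal[a' [b' e2]].
have := cyc_uniq c; rewrite /= !inE !negb_or => /and4P[/and3P[or os ot] /andP[rs rt] st _].
have two (u w x y : k) : u = x * - u -> w = x * w -> u * w = 0.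
  move=> h1 h2; have [->|w0] := eqVneq w 0; first by rewrite mulr0.
  have x1 : x = 1 by apply: (mulIf w0); rewrite -h2 mul1r.
  move: h1; rewrite x1 mul1r => /eqP; rewrite -addr_eq0 -mulr2n -mulr_natr mulf_eq0.
  by rewrite (negPf hk) orbF => /eqP ->; rewrite mul0r.
have z1 : v 0 r * v 0 0 = 0.
  apply: (two _ _ a 0).
    have := congr1 (fun w : 'rV[k]_4 => w 0 0) e1.
    rewrite !mxE !eqxx (negPf or) (negPf os) (negPf ot) /=.
    by rewrite !(mulr0, mulr1, subr0, addr0, oppr0).
  have := congr1 (fun w : 'rV[k]_4 => w 0 r) e1.
  rewrite !mxE !eqxx [r == 0]eq_sym (negPf or) (negPf ot) (negPf rs) (negPf rt) /=.
  rewrite !(mulr0, mulr1, sub0r, subr0, addr0, oppr0) mulrN => /oppr_inj //.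
have z2 : v 0 t * v 0 s = 0.
  apply: (two _ _ b' 0).
    have := congr1 (fun w : 'rV[k]_4 => w 0 s) e2.
    rewrite !mxE !eqxx [s == 0]eq_sym [s == r]eq_sym (negPf os) (negPf rs) (negPf st) /= orbT.
    by rewrite !(mulr0, mulr1, subr0, addr0, add0r, oppr0).
  have := congr1 (fun w : 'rV[k]_4 => w 0 t) e2.
  rewrite !mxE !eqxx [t == 0]eq_sym [t == r]eq_sym [t == s]eq_sym [s == r]eq_sym.
  rewrite (negPf ot) (negPf rt) (negPf st) (negPf rs) /=.
  rewrite !(mulr0, mulr1, sub0r, subr0, addr0, add0r, oppr0) mulrN => /oppr_inj //.
move/eqP: z1; move/eqP: z2; rewrite !mulf_eq0 => /orP[]/eqP h /orP[]/eqP h'.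
- exact: (gv r t).
- exact: (gv 0 t).
- exact: (gv r s).
- exact: (gv 0 s).
Qed.
End FormsIndep.

Section OfType.
Variables (k : fieldType) (alpha beta gamma : k) (i : sqrtN1 k).
Hypothesis hk : (2%:R : k) != 0.
Local Notation Q := (skl alpha beta gamma).
Local Notation Qg := (skl_graded alpha beta gamma).
Local Notation R := (Qp_graded alpha beta gamma).
Local Notation eqMod := (eqModule alpha beta gamma i).
Local Notation act := (@Qp_act k alpha beta gamma i : Gam -> R -> R).
Local Notation emb := (embM alpha beta gamma).
Local Notation sl := (sl (skl_x alpha beta gamma)).
Local Notation q j := (qmx i (gj j)).
Local Notation line_mod := (@line_mod k alpha beta gamma i).
Variables (r s t : 'I_4) (v : 'rV[k]_4) (c1 c1' c2 c2' : 'rV[k]_4).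
Hypotheses (c : cyc r s t) (gv : good v).
Hypotheses (L1 : is_line c1 c1' (chord 0 r s t v)).
Hypotheses (L2 : is_line c2 c2' (chord 0 r s t (flip r t v))).
Local Notation N := (gcolumn (gsum
  (@lquot2 Qg (skl_lin alpha beta gamma c1) (skl_lin alpha beta gamma c1'))
  (@lquot2 Qg (skl_lin alpha beta gamma c2) (skl_lin alpha beta gamma c2')))).

Lemma flipK : flip r t (flip r t v) = v.
Proof.
by apply/rowP => j; rewrite !mxE; case: ifP => -> //; rewrite opprK.
Qed.

Let I (b : 'I_2) : {pred Q} := if b == 0
  then lideal (sl (fmA 0 r v)) (sl (fmB s t v))
  else lideal (sl (fmA 0 r (flip r t v))) (sl (fmB s t (flip r t v))).

Let colsP (X : R) : @cols k alpha beta gamma v 0 r s t X <->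
  forall a b, (X : 'M[Q]_2) a b \in I b.
Proof.
split=> [H a b|H a]; last by split; [exact: (H a 0)|exact: (H a 1)].
have [h0 h1] := H a; have [->|b0] := eqVneq b 0; first exact: h0.
have -> : b = 1 by case: b b0 => [[|[|?]] ?] // _; exact: val_inj.
exact: h1.
Qed.

Let IZ b (e : k) u : u \in I b -> e *: u \in I b.
Proof.
rewrite /I -mulr_algl; case: (b == 0); exact: lidealMl.
Qed.

Let I0 b : 0 \in I b.
Proof. by rewrite /I; case: (b == 0); exact: lideal0. Qed.

Section Module.
Variables (M : eqMod) (m : M) (f : {linear M -> N}) (P P' : 'M[k]_2).
Hypotheses (mP : m \in @em_inv _ _ _ _ _ M) (fI : injective f).
Hypotheses (PP' : P *m P' = 1%:M) (P'P : P' *m P = 1%:M).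
Hypothesis (fm : f m = @colpi k alpha beta gamma (skl_lin alpha beta gamma c1)
  (skl_lin alpha beta gamma c1') (skl_lin alpha beta gamma c2)
  (skl_lin alpha beta gamma c2') (emb P)).

Let annP (A : R) : A *: m = 0 <-> @cols k alpha beta gamma v 0 r s t (A *m emb P).
Proof.
apply: iff_trans (in_cols_cols c gv L1 L2 _).
apply: iff_trans (colpi_eq0 _ _ _ _ _).
rewrite -colpiZ -fm -linearZ_LR; split=> [->|e]; first exact: raddf0.
by apply: fI; rewrite e raddf0.
Qed.

Let embE (B C : 'M[k]_2) : emb B *m emb C = emb (B *m C).
Proof. by rewrite [RHS]map_mxM. Qed.

(** If l lies in the ideal of column e, the matrix l E_ee P' kills m. As m is fixed, so does its
    translate by gamma_r, and after multiplication by P the column b of that translate consists of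
    scalar multiples of l; one scalar is non-zero when the given entry is. *)
Lemma conj_offdiag (e b : 'I_2) (l : Q) (eps : k) : eps != 0 ->
  skl_act (gj r) l = eps *: l -> l \in I e ->
  (P' *m invmx (q r) *m P) e b != 0 -> l \in I b.
Proof.
move=> eps0 le lI Reb.
pose A : R := l%:M *m emb (delta_mx e e *m P').
have Am : A *: m = 0.
  apply/annP/colsP => a d.
  rewrite /A -mulmxA embE -mulmxA P'P mulmx1 scalar_emb_entry mxE.
  by have [-> //|_] := eqVneq d e; [exact: IZ|rewrite andbF scale0r; exact: I0].
have : act (gj r) A *: m = 0.
  have := congr1 (em_act (gj r)) Am; rewrite em_act_semi (em_inv_fixed mP) => ->.
  by apply: (addIr (em_act (gj r) (0 : M))); rewrite -em_actD !add0r.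
move=> /annP/colsP H.
have [a qa] : exists a, q r a e != 0.
  apply/not_existsP => /= z.
  have : (invmx (q r) *m q r) e e = 0.
    by rewrite mxE big1 // => a _; have /negP/negPn/eqP -> := z a; rewrite mulr0.
  by rewrite mulVmx ?qmx_unit // mxE eqxx => /eqP; rewrite oner_eq0.
have := H a b.
have -> : (act (gj r) A *m emb P) a b = (eps * (q r a e * (P' *m invmx (q r) *m P) e b)) *: l.
  have -> : act (gj r) A = emb eps%:M *m l%:M *m
      emb (q r *m (delta_mx e e *m P') *m invmx (q r)).
    apply: (etrans (@actMr _ _ _ _ i (gj r) (l%:M) (emb (delta_mx e e *m P')))).
    by rewrite (@act_scalar_mx _ _ _ _ i _ _ _ le) (act_iota _ _ _ i).
  apply: (etrans (emb_chain_entry _ _ _ _ _ _)).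
  apply: (congr1 (fun w => (eps * w) *: l)).
  by rewrite -!mulmxA delta_sandwich.
move=> /(IZ (eps * (q r a e * (P' *m invmx (q r) *m P) e b))^-1).
by rewrite scalerA mulVf ?scale1r // !mulf_neq0.
Qed.

Let gvf := @flip_good _ v r t gv.

Lemma act_fmA w : skl_act (gj r) (sl (fmA 0 r w)) = 1 *: sl (fmA 0 r w).
Proof.
have := cyc_uniq c; rewrite /= !inE !negb_or => /and4P[/and3P[or os ot] /andP[rs rt] st _].
apply: (@sl_act _ _ _ _ _ _ _ _ _ false); rewrite (cyc_neg c).
  by rewrite (negPf os) (negPf ot).
by rewrite (negPf rs) (negPf rt).
Qed.

Lemma act_fmB w : skl_act (gj r) (sl (fmB s t w)) = -1 *: sl (fmB s t w).
Proof.
by apply: (@sl_act _ _ _ _ _ _ _ _ _ true); rewrite (cyc_neg c) eqxx ?orbT.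
Qed.

(** A non-zero off-diagonal entry would put both forms of one chord into the ideal of the other. The
    two forms are eigenvectors of gamma_r, with eigenvalues 1 and -1, as [conj_offdiag] requires. *)
Lemma conj_diag :
  (P' *m invmx (q r) *m P) 0 1 = 0 /\ (P' *m invmx (q r) *m P) 1 0 = 0.
Proof.
have N1 : (-1 : k) != 0 by rewrite oppr_eq0 oner_eq0.
split; apply/eqP/negPn/negP => nz.
  apply: (chord_forms_disjoint hk c gv).
    exact: (conj_offdiag (e := 0) (oner_neq0 _) (act_fmA v) (lideal_l _ _) nz).
  exact: (conj_offdiag (e := 0) N1 (act_fmB v) (lideal_r _ _) nz).
apply: (chord_forms_disjoint hk c gvf); rewrite flipK.
  exact: (conj_offdiag (e := 1) (oner_neq0 _) (act_fmA _) (lideal_l _ _) nz).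
exact: (conj_offdiag (e := 1) N1 (act_fmB _) (lideal_r _ _) nz).
Qed.

Let D := P' *m q r *m P.

(** In the basis P the matrix q_r is diagonal with square -1, and it is not scalar because it
    anticommutes with q_s. Only diag(-i, i) and diag(i, -i) remain; they account for the two lines,
    of p and of p + xi_s. *)
Lemma conj_eigen : q r *m P = P *m (- val i *: Jmx k) \/
  q r *m P = P *m (val i *: Jmx k).
Proof.
have /andP[r1 s1] := cyc_gj c.
have qPD : q r *m P = P *m D by rewrite /D !mulmxA PP' mul1mx.
have qV : invmx (q r) = - q r.
  rewrite -[invmx _]mulmx1 -[1%:M]opprK -(q_sq i r1) mulmxN mulmxA.
  by rewrite mulVmx ?qmx_unit // mul1mx.
have [d01 d10] : D 0 1 = 0 /\ D 1 0 = 0.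
  have neg (X : 'M[k]_2) a b : (- X) a b = - X a b by rewrite mxE.
  have [] := conj_diag; rewrite qV mulmxN mulNmx -/D !neg => /eqP h1 /eqP h2.
  by move: h1 h2; rewrite !oppr_eq0 => /eqP -> /eqP ->.
have DD : D *m D = - 1%:M.
  by rewrite /D -!mulmxA (mulmxA P P') PP' mul1mx (mulmxA (q r)) q_sq // mulNmx mul1mx mulmxN P'P.
have /eqP ii := valP i; rewrite expr2 in ii.
have sq a : a * a = -1 -> a = val i \/ a = - val i.
  move=> aa; have : (a - val i) * (a + val i) == 0.
    by rewrite -subr_sqr !expr2 aa ii subrr.
  rewrite mulf_eq0 subr_eq0 addr_eq0 => /orP[]/eqP; by [left|right].
have e00 : D 0 0 * D 0 0 = -1.
  have := congr1 (fun X : 'M[k]_2 => X 0 0) DD.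
  by rewrite mxE sum2 d01 mul0r addr0 !mxE eqxx.
have e11 : D 1 1 * D 1 1 = -1.
  have := congr1 (fun X : 'M[k]_2 => X 1 1) DD.
  by rewrite mxE sum2 d10 mul0r add0r !mxE eqxx.
have J a : D 0 0 = a -> D 1 1 = - a -> D = a *: Jmx k.
  have [J00 J01 J10 J11] : [/\ Jmx k 0 0 = 1, Jmx k 0 1 = 0, Jmx k 1 0 = 0 & Jmx k 1 1 = -1].
    by split; rewrite !mxE.
  move=> h0 h1; apply: matrix2P; rewrite [RHS]mxE ?J00 ?J01 ?J10 ?J11.
  - by rewrite mulr1.
  - by rewrite mulr0.
  - by rewrite mulr0.
  - by rewrite mulrN1.
have ns : D 0 0 <> D 1 1.
  move=> e; have Ds : D = (D 0 0)%:M.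
    by apply: matrix2P; rewrite [RHS]mxE /= ?mulr1n ?mulr0n ?d01 ?d10 ?e.
  have qs : q r = (D 0 0)%:M.
    transitivity (P *m D *m P'); first by rewrite -qPD -mulmxA PP' mulmx1.
    by rewrite {1}Ds scalar_mxC -mulmxA PP' mulmx1.
  have := cyc_anti i c; rewrite qs mul_scalar_mx mul_mx_scalar => /eqP.
  rewrite -addr_eq0 -scalerDl scaler_eq0 -mulr2n -mulr_natr mulf_eq0 (negPf hk) orbF.
  case/orP => [/eqP d0|/eqP q0].
    by move: e00; rewrite d0 mul0r => /eqP; rewrite eq_sym oppr_eq0 oner_eq0.
  by have := qmx_unit i (gj s); rewrite q0 unitmxE det0 unitr0.
rewrite qPD; case: (sq _ e00) => h0; case: (sq _ e11) => h1.
- by case: ns; rewrite h0 h1.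
- by right; rewrite (J (val i)).
- by left; rewrite (J (- val i)) // opprK.
- by case: ns; rewrite h0 h1.
Qed.

Hypotheses (m0 : gm_deg 0 m) (fb : bijective f).

Lemma gen_m (w : M) : exists A : R, w = A *: m.
Proof.
have [X fX] := colpi_surj (f w); exists (X *m emb P'); apply: (bij_inj fb).
rewrite linearZ_LR fm fX /= colpiZ -mulmxA embE P'P.
have -> : emb 1%:M = 1%:M by exact: rmorph1.
by rewrite mulmx1.
Qed.

Lemma eq_isom_line : eq_isom (line_mod (lnA i 0 r v) (lnB i s t v)) M \/
  eq_isom (line_mod (lnA i 0 r (flip r t v)) (lnB i s t (flip r t v))) M.
Proof.
case: conj_eigen => qP; [left|right].
  apply: (cyclic_eq_isom mP m0 gen_m) => A.
  exact: (iff_trans (annP A) (key_ideal v c PP' P'P qP A)).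
(* Swapping the two columns of P restores the order of the eigenvalues and exchanges the two column
   ideals, which amounts to replacing v by its flip. *)
pose W : 'M[k]_2 := mx2 0 1 1 0.
have WW : W *m W = 1%:M.
  by apply: matrix2P; rewrite mxE sum2 !mxE /= ?mulr1 ?mulr0 ?addr0 ?add0r ?mul0r.
have PW : (P *m W) *m (W *m P') = 1%:M by rewrite -mulmxA (mulmxA W) WW mul1mx.
have WP : (W *m P') *m (P *m W) = 1%:M by rewrite -mulmxA (mulmxA P') P'P mul1mx.
have JW : (val i *: Jmx k) *m W = W *m (- val i *: Jmx k).
  apply: matrix2P; rewrite -scalemxAl -scalemxAr [LHS]mxE [RHS]mxE mul_dg2 mxE sum2 !mxE /=;
    rewrite ?mulr1n ?mulr0n; ring.
have qPW : q r *m (P *m W) = (P *m W) *m (- val i *: Jmx k).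
  by rewrite mulmxA qP -!mulmxA JW.
apply: (cyclic_eq_isom mP m0 gen_m) => A.
apply: (iff_trans (annP A)).
apply: (iff_trans _ (key_ideal (flip r t v) c PW WP qPW A)).
have sw a : ((A : 'M[Q]_2) *m emb (P *m W)) a 0 = (A *m emb P) a 1 /\
    ((A : 'M[Q]_2) *m emb (P *m W)) a 1 = (A *m emb P) a 0.
  rewrite -embE mulmxA.
  by apply: emb_swap_entry; rewrite mxE.
rewrite /cols /in_cols flipK; split=> H a; have [h0 h1] := H a; have [w0 w1] := sw a.
  by split; [rewrite w0; exact: h1|rewrite w1; exact: h0].
by split; [rewrite -w1; exact: h1|rewrite -w0; exact: h0].
Qed.

End Module.

Lemma of_type_line (M : eqMod) : graded_isom M N ->
  eq_isom (line_mod (lnA i 0 r v) (lnB i s t v)) M \/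
  eq_isom (line_mod (lnA i 0 r (flip r t v)) (lnB i s t (flip r t v))) M.
Proof.
move=> [f [fb fd]]; have [g gK fK] := fb; have fI := bij_inj fb.
pose w0 : N := @colpi k alpha beta gamma (sl c1) (sl c1') (sl c2) (sl c2') (emb 1%:M).
have [prQ prQP] := skl_grading alpha beta gamma.
have w0n : w0 <> 0.
  move=> /colpi_eq0/(_ 0)[h _].
  have := deg0_lideal prQP (sl_deg _ _ _ c1) (sl_deg _ _ _ c1') (deg_iota _ _ _ 1%:M 0 0) h.
  rewrite !mxE eqxx /= scale1r => /eqP; exact/negP/oner_neq0.
pose v0 := g w0.
have v00 : gm_deg 0 v0.
  by apply/fd; rewrite fK; apply: (@colpi_deg _ _ _ _ _ _ _ _ 0%N); exact: deg_iota.
(* The non-zero element [v0] of degree 0 is the sum of its four components, so one of them gives a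
   non-zero invariant of degree 0, the future generator. *)
have [e me] : exists e, eavg (emb (invmx (qmx i e)) *: v0) <> 0.
  apply/not_existsP => /= z; apply: w0n; rewrite -(fK w0) -/v0.
  suff -> : v0 = 0 by exact: raddf0.
  rewrite (em_decomp hk v0) big1 // => e _; have /contrapT h := z e.
  exact: (etrans (congr1 (fun w => emb (qmx i e) *: w) h) (scaler0 _ _)).
set m : M := eavg _ in me.
have mP : m \in @em_inv _ _ _ _ _ M by exact: em_avg_inv.
have m0 : gm_deg 0 m.
  apply: eavg_deg; exact: (@gm_degZ R M (em_graded M) 0%N 0 _ _ (deg_iota _ _ _ _) v00).
have [X X0 fX] := @deg_colpi k alpha beta gamma _ _ _ _ 0%N (f m) (proj1 (fd 0 m) m0).
have [P XP] := R_deg0 X0; rewrite XP in fX.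
(* The matrix [kermx P] kills [colpi (emb P)], hence the non-zero invariant m; a scalar matrix which
   does so is 0. *)
have Pu : P \in unitmx.
  rewrite -row_free_unit -kermx_eq0; apply/eqP.
  apply: (@emb_kill k alpha beta gamma i hk M m (kermx P) mP (introN eqP me)).
  apply: fI; rewrite linearZ_LR fX /= colpiZ raddf0; apply/colpi_eq0.
  have -> : emb (kermx P) *m emb P = emb (kermx P *m P) by rewrite [RHS]map_mxM.
  have -> : emb (kermx P *m P) = 0 by rewrite mulmx_ker; exact: raddf0.
  by move=> a; rewrite !mxE; split; exact: lideal0.
exact: (eq_isom_line mP fI (mulmxV Pu) (mulVmx Pu) fX m0 fb).
Qed.
End OfType.

(** * Homogeneous forms as functions of the coordinates *)

Section Forms.
Import mpoly.
Variables (k : fieldType).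

(** Treating forms as functions lets them be composed with [plv] and [sgn2] and compared pointwise,
    without computing the substituted polynomials. *)
Definition hform n (d : nat) (F : 'rV[k]_n -> k) : Prop :=
  exists2 p : {mpoly k[n]}, p \is d.-homog & forall v, F v = p.@[v 0].

Lemma hform_ext n d (F G : 'rV[k]_n -> k) : F =1 G -> hform d F -> hform d G.
Proof. by move=> FG [p pd pE]; exists p => // v; rewrite -FG. Qed.

Lemma hform0 n d : hform d (fun _ : 'rV[k]_n => 0).
Proof. by exists 0; [exact: dhomog0|move=> v; rewrite meval0]. Qed.

Lemma hform1 n : hform 0 (fun _ : 'rV[k]_n => 1).
Proof. by exists 1; [exact: dhomog1|move=> v; rewrite meval1]. Qed.

Lemma hformD n d (F G : 'rV[k]_n -> k) :
  hform d F -> hform d G -> hform d (fun v => F v + G v).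
Proof.
move=> [p pd pE] [q qd qE]; exists (p + q); first exact: dhomogD.
by move=> v; rewrite mevalD pE qE.
Qed.

Lemma hformZ n d c (F : 'rV[k]_n -> k) : hform d F -> hform d (fun v => c * F v).
Proof.
move=> [p pd pE]; exists (c *: p); first exact: dhomogZ.
by move=> v; rewrite mevalZ pE.
Qed.

Lemma hformB n d (F G : 'rV[k]_n -> k) :
  hform d F -> hform d G -> hform d (fun v => F v - G v).
Proof.
move=> fF fG; apply: (@hform_ext _ _ (fun v => F v + (-1) * G v)).
  by move=> v; rewrite mulN1r.
exact/hformD/hformZ.
Qed.

Lemma hformM n d e (F G : 'rV[k]_n -> k) :
  hform d F -> hform e G -> hform (d + e) (fun v => F v * G v).
Proof.
move=> [p pd pE] [q qd qE]; exists (p * q); first exact: dhomogM.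
by move=> v; rewrite mevalM pE qE.
Qed.

Lemma hformX n d e (F : 'rV[k]_n -> k) : hform d F -> hform (d * e) (fun v => F v ^+ e).
Proof.
move=> fF; elim: e => [|e IH].
  by rewrite muln0; apply: hform_ext (hform1 n) => v; rewrite expr0.
by rewrite mulnS; apply: hform_ext (hformM fF IH) => v; rewrite exprS.
Qed.

Lemma hform_coord n j : hform 1 (fun v : 'rV[k]_n => v 0 j).
Proof. exists 'X_j; [by rewrite dhomogX /= mdeg1 | by move=> v; rewrite mevalXU]. Qed.

Lemma hform_sum n d (I : Type) (r : seq I) (F : I -> 'rV[k]_n -> k) :
  (forall x, hform d (F x)) -> hform d (fun v => \sum_(x <- r) F x v).
Proof.
move=> fF; elim: r => [|x r IH].
  by apply: hform_ext (hform0 n d) => v; rewrite big_nil.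
by apply: hform_ext (hformD (fF x) IH) => v; rewrite big_cons.
Qed.

Lemma hform_words n d (F : 'rV[k]_n -> k) : hform d F ->
  exists2 l : seq (k * seq 'I_n), forall w, w \in l -> size w.2 = d &
    forall v, F v = \sum_(w <- l) w.1 * \prod_(j <- w.2) v 0 j.
Proof.
move=> [p pd pE].
pose word (m : 'X_{1..n}) : seq 'I_n := flatten [seq nseq (m j) j | j <- enum 'I_n].
exists [seq (p@_m, word m) | m <- msupp p] => [w /mapP[m mp ->]|v] /=.
  have <- : mdeg m = d := dhomog_mf pd mp.
  rewrite mdegE size_flatten /shape -map_comp sumnE big_map.
  by rewrite big_enum; apply: eq_bigr => j _; rewrite /= size_nseq.
rewrite pE mevalE big_map; apply: eq_bigr => m _ /=; congr (_ * _).
rewrite /word big_flatten big_map big_enum; apply: eq_bigr => j _ /=.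
by rewrite big_nseq -Monoid.iteropE.
Qed.

Lemma hform_scale n d (F : 'rV[k]_n -> k) c v : hform d F -> F (c *: v) = c ^+ d * F v.
Proof.
move=> /hform_words[l ld lE]; rewrite !lE mulr_sumr !big_seq; apply: eq_bigr => w /ld <-.
rewrite mulrCA; congr (_ * _); elim: w.2 => [|j s IH] /=.
  by rewrite !big_nil mulr1.
by rewrite !big_cons IH mxE exprS; ring.
Qed.

Lemma hform_comp m n d e (F : 'rV[k]_n -> k) (g : 'rV[k]_m -> 'rV[k]_n) :
  hform d F -> (forall j, hform e (fun v => g v 0 j)) -> hform (d * e) (fun v => F (g v)).
Proof.
move=> /hform_words[l ld lE] ge.
have wf w : w \in l -> hform (d * e) (fun v => w.1 * \prod_(j <- w.2) g v 0 j).
  move=> /ld <-; apply: hformZ; elim: w.2 => [|j s IH] /=.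
    by apply: hform_ext (hform1 m) => v; rewrite big_nil.
  by rewrite mulSn; apply: hform_ext (hformM (ge j) IH) => v; rewrite big_cons.
have : hform (d * e) (fun v => \sum_(w <- l) w.1 * \prod_(j <- w.2) g v 0 j).
  elim: l wf {ld lE} => [|w l IH] wf.
    by apply: hform_ext (hform0 _ _) => v; rewrite big_nil.
  apply: hform_ext (hformD (wf w (mem_head _ _)) (IH _)) => [v|u ul].
    by rewrite big_cons.
  by apply: wf; rewrite inE ul orbT.
by apply: hform_ext => v; rewrite lE.
Qed.

Lemma pvar_closedP (T : Type) n (h : T -> 'rV[k]_n) (Z : T -> Prop) :
  @ks_closed k (pvar h) Z <-> exists J : ('rV[k]_n -> k) -> Prop,
    (forall F, J F -> exists d, hform d F) /\
    (forall x, Z x <-> forall F, J F -> F (h x) = 0).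
Proof.
split=> [[J [Jd JZ]]|[J [Jd JZ]]].
  exists (fun F : 'rV[k]_n -> k => exists2 p, J p & forall v : 'rV[k]_n, F v = p.@[v 0]); split.
    by move=> F [p /[dup] Jp /Jd[d pd] pE]; exists d, p.
  move=> x; rewrite JZ; split=> [H F [p Jp ->]|H p Jp]; first exact: H.
  by apply: (H (fun v : 'rV[k]_n => p.@[v 0])); exists p.
exists (fun p : {mpoly k[n]} => (exists d, p \is d.-homog) /\
  exists2 F : 'rV[k]_n -> k, J F & forall v : 'rV[k]_n, F v = p.@[v 0]); split; first by move=> p [].
move=> x; rewrite JZ; split=> [H p [_ [F JF FE]]|H F JF].
  by rewrite -FE; apply: H.
have [d [p pd pE]] := Jd F JF; rewrite pE; apply: H.
by split; [exists d|exists F].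
Qed.

Lemma pvar_regularP (T : Type) n (h : T -> 'rV[k]_n) (U : T -> Prop) (f : T -> k) :
  @ks_regular k (pvar h) U f <-> forall x, U x -> exists d A B,
    [/\ hform d A, hform d B, B (h x) != 0 &
      forall y, U y -> B (h y) != 0 -> f y = A (h y) / B (h y)].
Proof.
split=> H x /H[d]; last first.
  move=> [A [B [[a ad aE] [b bd bE] Bx fE]]]; exists d, a, b; split=> //.
    by rewrite -bE.
  by move=> y Uy; rewrite -bE -aE; apply: fE.
move=> [a [b [ad bd bx fE]]].
exists d, (fun v : 'rV[k]_n => a.@[v 0]), (fun v : 'rV[k]_n => b.@[v 0]); split=> //; first by exists a.
by exists b.
Qed.

End Forms.

(** * Plucker coordinates *)

Section Plucker.
Variable k : fieldType.
Local Notation dl := (delta_mx (0 : 'I_1)).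

Definition plpair (m : 'I_6) : nat * nat := nth (0, 0)%N
  [:: (0, 1); (0, 2); (0, 3); (1, 2); (1, 3); (2, 3)]%N m.

Definition minor (u w : 'rV[k]_4) (j l : 'I_4) : k := u 0 j * w 0 l - u 0 l * w 0 j.

Definition plk (u w : 'rV[k]_4) : 'rV[k]_6 :=
  \row_m minor u w (inord (plpair m).1) (inord (plpair m).2).

Lemma pluckerE (L : gr k 2 4) :
  plucker L = plk (vbasis (val L))`_0 (vbasis (val L))`_1.
Proof. by apply/rowP => m; rewrite !mxE /minor /plpair; case: (nth _ _ _). Qed.

Lemma minor_comb u w (a b c d : k) j l :
  minor (a *: u + b *: w) (c *: u + d *: w) j l = (a * d - b * c) * minor u w j l.
Proof. by rewrite /minor !mxE; ring. Qed.

Lemma plucker_mem (L : gr k 2 4) u w : u \in val L -> w \in val L ->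
  exists c, plk u w = c *: plucker L.
Proof.
have dL : \dim (val L) = 2%N := eqP (valP L).
have E : val L = <<[:: (vbasis (val L))`_0; (vbasis (val L))`_1]>>%VS.
  rewrite -[LHS](span_basis (vbasisP (val L))); congr (<<_>>%VS).
  have : size (vbasis (val L)) = 2%N := etrans (size_tuple _) dL.
  by case: (vbasis (val L) : seq _) => [|a [|b [|]]].
rewrite {1 2}E => /span2P[a [b ->]] /span2P[c [d ->]].
exists (a * d - b * c); apply/rowP => m.
by rewrite pluckerE !mxE minor_comb.
Qed.

(** [plucker] uses an arbitrary basis of L; this allows a convenient one, at the cost of a scalar
    that homogeneous statements absorb. *)
Lemma plucker_span (L : gr k 2 4) u w : u \in val L -> w \in val L -> plk u w != 0 ->
  exists2 c, c != 0 & plucker L = c *: plk u w.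
Proof.
move=> uL wL; have [c ->] := plucker_mem uL wL; rewrite scaler_eq0 negb_or => /andP[c0 _].
by exists c^-1; rewrite ?invr_eq0 // scalerA mulVf // scale1r.
Qed.

(* the Plucker coordinate [p_jl], antisymmetric in [j] and [l] *)
Definition PF (j l : 'I_4) (x : 'rV[k]_6) : k := \sum_(m < 6)
  (if plpair m == (j : nat, l : nat) then 1 else
   if plpair m == (l : nat, j : nat) then -1 else 0) * x 0 m.

Lemma hform_PF j l : hform 1 (PF j l).
Proof. by apply: hform_sum => m; apply: hformZ; exact: hform_coord. Qed.

Lemma PF_plk u w j l : PF j l (plk u w) = minor u w j l.
Proof.
rewrite -[in RHS](inord_val j) -[in RHS](inord_val l) /PF.
under eq_bigr do rewrite mxE.
rewrite !big_ord_recl big_ord0 /plpair /minor.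
by case: j l => [[|[|[|[|?]]]] ?] [[|[|[|[|?]]]] ?] //=; ring.
Qed.

Lemma PFZ j l c x : PF j l (c *: x) = c * PF j l x.
Proof. by rewrite mulr_sumr; apply: eq_bigr => m _; rewrite mxE mulrCA. Qed.

End Plucker.

Lemma enum4 (o r s t : 'I_4) : uniq [:: o; r; s; t] -> forall j, j \in [:: o; r; s; t].
Proof.
move=> un; have: ([:: o; r; s; t] =i predT); last by move=> h j; rewrite h.
by apply/subset_cardP; [rewrite (card_uniqP un) card_ord|apply/subsetP].
Qed.

Lemma sum4 (V : nmodType) (f : 'I_4 -> V) o r s t : uniq [:: o; r; s; t] ->
  \sum_j f j = f o + f r + f s + f t.
Proof.
move=> un; transitivity (\sum_(j <- [:: o; r; s; t]) f j).
  rewrite -big_enum; apply: perm_big; apply: uniq_perm; rewrite ?enum_uniq // => j.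
  by rewrite mem_enum enum4.
by rewrite !big_cons big_nil addr0 !addrA.
Qed.

Lemma extend4 (a b : 'I_4) : a != b -> exists c d, uniq [:: a; b; c; d].
Proof.
have h4 : forall j, (j < 4)%N -> 'I_4 by move=> j; exact: Ordinal.
case: a b => [[|[|[|[|?]]]] ?] [[|[|[|[|?]]]] ?] //= _;
  first [ by exists (@Ordinal 4 0 isT), (@Ordinal 4 1 isT)
        | by exists (@Ordinal 4 0 isT), (@Ordinal 4 2 isT)
        | by exists (@Ordinal 4 0 isT), (@Ordinal 4 3 isT)
        | by exists (@Ordinal 4 1 isT), (@Ordinal 4 2 isT)
        | by exists (@Ordinal 4 1 isT), (@Ordinal 4 3 isT)
        | by exists (@Ordinal 4 2 isT), (@Ordinal 4 3 isT) ].
Qed.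

(** * Lines attached to points of the cone over E *)

Section Cone.
Variables (k : closedFieldType) (e : 'I_4 -> k).
Hypotheses (hk : (2%:R : k) != 0) (einj : injective e).
Local Notation dl := (delta_mx (0 : 'I_1)).
Implicit Types v w : 'rV[k]_4.

Definition cone v : Prop :=
  \sum_j v 0 j ^+ 2 = 0 /\ \sum_j e j * v 0 j ^+ 2 = 0.

Lemma coneZ c v : cone v -> cone (c *: v).
Proof.
move=> [h1 h2]; split.
  rewrite (eq_bigr (fun j => c ^+ 2 * v 0 j ^+ 2)) => [|j _]; last by rewrite mxE exprMn.
  by rewrite -mulr_sumr h1 mulr0.
rewrite (eq_bigr (fun j => c ^+ 2 * (e j * v 0 j ^+ 2))) => [|j _].
  by rewrite -mulr_sumr h2 mulr0.
by rewrite mxE exprMn mulrCA.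
Qed.

(** Subtracting the second equation from e_b times the first eliminates v_b. *)
Lemma cone_sq v a b c d : uniq [:: a; b; c; d] -> cone v ->
  v 0 a ^+ 2 = ((e c - e b) / (e b - e a)) * v 0 c ^+ 2 + ((e d - e b) / (e b - e a)) * v 0 d ^+ 2.
Proof.
move=> un [h1 h2]; rewrite (sum4 _ un) in h1; rewrite (sum4 _ un) in h2.
have ba : e b - e a != 0.
  rewrite subr_eq0 (inj_eq einj) eq_sym; move: un => /= /andP[+ _].
  by rewrite !inE negb_or => /andP[].
have := congr2 (fun x y => e b * x - y) h1 h2; rewrite mulr0 subr0 => h.
apply: (mulfI ba); transitivity ((e c - e b) * v 0 c ^+ 2 + (e d - e b) * v 0 d ^+ 2).
  apply/eqP; rewrite -subr_eq0 -[X in _ == X]h; apply/eqP; ring.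
by field.
Qed.

Lemma cone_good v : v != 0 -> cone v -> good v.
Proof.
move=> v0 cv a b ab va vb; case/eqP: v0.
have [c [d un]] := extend4 ab.
have vc : v 0 c = 0.
  have un' : uniq [:: c; d; a; b] by rewrite -(rot_uniq 2).
  have := cone_sq un' cv; rewrite va vb expr0n /= !mulr0 addr0 => /eqP.
  by rewrite sqrf_eq0 => /eqP.
have vd : v 0 d = 0.
  have := cv.1; rewrite (sum4 _ un) va vb vc expr0n /= !add0r => /eqP.
  by rewrite sqrf_eq0 => /eqP.
apply/rowP => j; rewrite mxE; have := enum4 un j.
by rewrite !inE => /or4P[]/eqP->.
Qed.

Section Lines.
Variables (i : sqrtN1 k) (o r s t : 'I_4).
Hypothesis un : uniq [:: o; r; s; t].

Definition uA v : 'rV[k]_4 := v 0 o *: dl o + (- (val i * v 0 r)) *: dl r.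
Definition uB v : 'rV[k]_4 := v 0 s *: dl s + (val i * v 0 t) *: dl t.
(* the line [lnA v = lnB v = 0] *)
Definition twline v : {vspace 'rV[k]_4} := <<[:: uA v; uB v]>>%VS.
(* translation by [xi_r] *)
Definition sgn2 v : 'rV[k]_4 := \row_j (if (j == s) || (j == t) then - v 0 j else v 0 j).
Definition plv v : 'rV[k]_6 := plk (uA v) (uB v).

Let ii : val i * val i = -1.
Proof. by have /eqP := valP i; rewrite expr2. Qed.

Let i0 : val i != 0.
Proof. by apply/eqP => i0; move/eqP: ii; rewrite i0 mul0r eq_sym oppr_eq0 oner_eq0. Qed.

Let E : (((o == r) = false) * ((o == s) = false) * ((o == t) = false) * ((r == s) = false)
  * ((r == t) = false) * ((s == t) = false)) * (((r == o) = false) * ((s == o) = false)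
  * ((t == o) = false) * ((s == r) = false) * ((t == r) = false) * ((t == s) = false)).
Proof.
move: un; rewrite /= !inE !negb_or => /and4P[/and3P[or os ot] /andP[rs rt] st _].
by split; do ![split]; try (rewrite eq_sym; exact: negPf); exact: negPf.
Qed.

Lemma uAE v j : uA v 0 j = if j == o then v 0 o else if j == r then - (val i * v 0 r) else 0.
Proof.
rewrite !mxE; have := enum4 un j; rewrite !inE => /or4P[]/eqP ->; rewrite !E ?eqxx /=;
  rewrite ?(mulr0, mulr1, addr0, add0r) //.
Qed.

Lemma uBE v j : uB v 0 j = if j == s then v 0 s else if j == t then val i * v 0 t else 0.
Proof.
rewrite !mxE; have := enum4 un j; rewrite !inE => /or4P[]/eqP ->; rewrite !E ?eqxx /=;
  rewrite ?(mulr0, mulr1, addr0, add0r) //.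
Qed.

Lemma twline_is_line v : good v -> is_line (lnA i o r v) (lnB i s t v) (twline v).
Proof.
move=> gv.
have gA : (v 0 o, - (val i * v 0 r)) != (0, 0).
  have := good_pair gv (negbT E.1.1.1.1.1.1) (b := r); rewrite !xpair_eqE oppr_eq0 mulf_eq0 (negPf i0) //.
have gB : (v 0 s, val i * v 0 t) != (0, 0).
  have := good_pair gv (negbT E.1.2) (b := t); rewrite !xpair_eqE mulf_eq0 (negPf i0) //.
have [dL H] := span2_line un gA gB; split=> // w; rewrite H.
have -> : (- (val i * v 0 r)) *: dl o - v 0 o *: dl r = - lnA i o r v.
  by rewrite /lnA opprD scaleNr.
have dN c w' : dot (- c) w' = - dot c w' :> k by rewrite !dotE mulNmx mxE.
rewrite dN; split=> [[/eqP h ->]|[h ->]]; split=> //; last by rewrite h oppr0.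
by apply/eqP; rewrite -oppr_eq0.
Qed.

Lemma plv_PF v j l : PF j l (plv v) = minor (uA v) (uB v) j l.
Proof. exact: PF_plk. Qed.

Lemma PF_os v : PF o s (plv v) = v 0 o * v 0 s.
Proof. by rewrite plv_PF /minor !uAE !uBE !E !eqxx; ring. Qed.
Lemma PF_ot v : PF o t (plv v) = val i * (v 0 o * v 0 t).
Proof. by rewrite plv_PF /minor !uAE !uBE !E !eqxx; ring. Qed.
Lemma PF_rs v : PF r s (plv v) = - val i * (v 0 r * v 0 s).
Proof. by rewrite plv_PF /minor !uAE !uBE !E !eqxx; ring. Qed.
Lemma PF_rt v : PF r t (plv v) = v 0 r * v 0 t.
Proof.
rewrite plv_PF /minor !uAE !uBE !E !eqxx.
transitivity (- (val i * val i) * (v 0 r * v 0 t)); first by ring.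
by rewrite ii opprK mul1r.
Qed.
Lemma PF_or v : PF o r (plv v) = 0.
Proof. by rewrite plv_PF /minor !uAE !uBE !E !eqxx; ring. Qed.
Lemma PF_st v : PF s t (plv v) = 0.
Proof. by rewrite plv_PF /minor !uAE !uBE !E !eqxx; ring. Qed.

Lemma plv_neq0 v : good v -> plv v != 0.
Proof.
move=> gv; apply/eqP => p0; have P0 j l : PF j l (plv v) = 0.
  by rewrite p0 -(scale0r 0) PFZ mul0r.
have z a b : val i * (a * b) = 0 -> a * b = 0 by move=> /eqP; rewrite mulf_eq0 (negPf i0) => /eqP.
have os : v 0 o * v 0 s = 0 by rewrite -PF_os.
have ot : v 0 o * v 0 t = 0 by apply: z; rewrite -PF_ot.
have rs : v 0 r * v 0 s = 0 by apply: z; apply/eqP; rewrite -oppr_eq0 -mulNr -PF_rs P0.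
have rt : v 0 r * v 0 t = 0 by rewrite -PF_rt.
have gA a b : a != b -> v 0 a = 0 -> v 0 b = 0 -> False by move=> ab a0 b0; exact: (gv a b).
have [h|h] := eqVneq (v 0 o) 0.
  have r0 : v 0 r != 0 by apply/eqP => r0; apply: (gA o r) => //; rewrite E.
  have s0 : v 0 s = 0 by apply: (mulfI r0); rewrite rs mulr0.
  have t0 : v 0 t = 0 by apply: (mulfI r0); rewrite rt mulr0.
  by apply: (gA s t) => //; rewrite E.
have s0 : v 0 s = 0 by apply: (mulfI h); rewrite os mulr0.
have t0 : v 0 t = 0 by apply: (mulfI h); rewrite ot mulr0.
by apply: (gA s t) => //; rewrite E.
Qed.

Lemma hform_plv m : hform 2 (fun v => plv v 0 m).
Proof.
have fA j : hform 1 (fun v => uA v 0 j).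
  apply: (@hform_ext _ _ _ (fun v => (j == o)%:R * v 0 o + (- (val i * (j == r)%:R)) * v 0 r)).
    move=> v; rewrite uAE; have := enum4 un j.
    by rewrite !inE => /or4P[]/eqP ->; rewrite ?E ?eqxx /=; ring.
  by apply: hformD; apply: hformZ; exact: hform_coord.
have fB j : hform 1 (fun v => uB v 0 j).
  apply: (@hform_ext _ _ _ (fun v => (j == s)%:R * v 0 s + (val i * (j == t)%:R) * v 0 t)).
    move=> v; rewrite uBE; have := enum4 un j.
    by rewrite !inE => /or4P[]/eqP ->; rewrite ?E ?eqxx /=; ring.
  by apply: hformD; apply: hformZ; exact: hform_coord.
apply: (@hform_ext _ _ _ (fun v => minor (uA v) (uB v) (inord (plpair m).1) (inord (plpair m).2))).
  by move=> v; rewrite mxE.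
by apply: hformB; apply: (@hformM _ _ 1 1).
Qed.

Lemma plv_comp d F : hform d F -> hform (d * 2) (fun v => F (plv v)).
Proof. by move=> Fd; apply: hform_comp Fd hform_plv. Qed.

(** Degree m in the Plucker coordinates is degree 2m in v. Agreement is asked on the cone only, so
    that the equations of E may be used. *)
Definition red (m : nat) (F : 'rV[k]_4 -> k) : Prop :=
  exists2 H, hform m H & forall v, cone v -> F v = H (plv v).

Lemma red_ext m F G : (forall v, cone v -> F v = G v) -> red m F -> red m G.
Proof. by move=> FG [H Hm HE]; exists H => // v cv; rewrite -FG // HE. Qed.

Lemma red0 m : red m (fun=> 0).
Proof. by exists (fun=> 0) => //; exact: hform0. Qed.

Lemma red1 : red 0 (fun=> 1).
Proof. by exists (fun=> 1) => //; exact: hform1. Qed.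

Lemma redD m F G : red m F -> red m G -> red m (fun v => F v + G v).
Proof.
move=> [H Hm HE] [H' Hm' HE']; exists (fun x => H x + H' x); first exact: hformD.
by move=> v cv; rewrite HE // HE'.
Qed.

Lemma redZ m c F : red m F -> red m (fun v => c * F v).
Proof.
by move=> [H Hm HE]; exists (fun x => c * H x); [exact: hformZ|move=> v cv; rewrite HE].
Qed.

Lemma redM m n F G : red m F -> red n G -> red (m + n) (fun v => F v * G v).
Proof.
move=> [H Hm HE] [H' Hm' HE']; exists (fun x => H x * H' x); first exact: hformM.
by move=> v cv; rewrite HE // HE'.
Qed.

Definition ty (j : 'I_4) : bool := (j == s) || (j == t).

Lemma red_mixed a b : ty a != ty b -> red 1 (fun v => v 0 a * v 0 b).
Proof.
have R (x y : 'I_4) c : c != 0 -> (forall v, PF x y (plv v) = c * (v 0 x * v 0 y)) ->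
    red 1 (fun v => v 0 x * v 0 y).
  move=> c0 h; exists (fun X => c^-1 * PF x y X); first exact/hformZ/hform_PF.
  by move=> v _; rewrite h mulKf.
have Ros := R o s 1 (oner_neq0 _) (fun v => etrans (PF_os v) (esym (mul1r _))).
have Rot := R o t _ i0 PF_ot.
have Ni : - val i != 0 by rewrite oppr_eq0.
have Rrs := R r s _ Ni PF_rs.
have Rrt := R r t 1 (oner_neq0 _) (fun v => etrans (PF_rt v) (esym (mul1r _))).
have C x y : red 1 (fun v => v 0 x * v 0 y) -> red 1 (fun v => v 0 y * v 0 x).
  by apply: red_ext => v _; rewrite mulrC.
have := enum4 un a; have := enum4 un b; rewrite /ty !inE.
by move=> /or4P[]/eqP-> /or4P[]/eqP->; rewrite ?E ?eqxx //= => _; do ?exact: C.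
Qed.

(** Eliminating the other coordinate of the type of a writes v_a^2 in terms of v_x^2 and v_y^2, with
    x and y of the opposite type. Then v_x^2 v_b v_c is a product of two mixed monomials. *)
Lemma red_sq a b c : ty a = ty b -> ty a = ty c ->
  red 2 (fun v => v 0 a ^+ 2 * (v 0 b * v 0 c)).
Proof.
move=> ab ac; have [a' [x [y [una tx tyy]]]] : exists a' x y,
    [/\ uniq [:: a; a'; x; y], ty x != ty a & ty y != ty a].
  have ro : uniq [:: r; o; s; t].
    by move: un; rewrite /= !inE !negb_or => /and4P[/and3P[h1 h2 h3] /andP[h4 h5] h6 _];
       rewrite eq_sym h1 h2 h3 h4 h5 h6.
  have st : uniq [:: s; t; o; r] by rewrite -(rot_uniq 2).
  have ts : uniq [:: t; s; o; r].
    by move: st; rewrite /= !inE !negb_or => /and4P[/and3P[h1 h2 h3] /andP[h4 h5] h6 _];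
       rewrite eq_sym h1 h2 h3 h4 h5 h6.
  have := enum4 un a; rewrite !inE => /or4P[]/eqP ->.
  - by exists r, s, t; rewrite /ty ?E ?eqxx.
  - by exists o, s, t; rewrite /ty ?E ?eqxx.
  - by exists t, o, r; rewrite /ty ?E ?eqxx.
  - by exists s, o, r; rewrite /ty ?E ?eqxx.
apply: (@red_ext _ (fun v =>
   ((e x - e a') / (e a' - e a)) * ((v 0 x * v 0 b) * (v 0 x * v 0 c)) +
   ((e y - e a') / (e a' - e a)) * ((v 0 y * v 0 b) * (v 0 y * v 0 c)))).
  by move=> v cv; rewrite (cone_sq una cv); ring.
by apply: redD; apply: redZ; apply: (@redM 1 1); apply: red_mixed; rewrite -?ab -?ac.
Qed.

(** If the two pairs have different types, they recombine into mixed products. Otherwise only two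
    indices are available for a, b, c, so one of them repeats and [red_sq] applies. *)
Lemma red_four a b c d : ty a = ty b -> ty c = ty d ->
  red 2 (fun v => v 0 a * v 0 b * (v 0 c * v 0 d)).
Proof.
move=> ab cd; have [ac|ac] := eqVneq (ty a) (ty c); last first.
  apply: (@red_ext _ (fun v => (v 0 a * v 0 c) * (v 0 b * v 0 d))).
    by move=> v _; ring.
  by apply: (@redM 1 1); apply: red_mixed; rewrite // -ab -cd.
have : [|| a == b, a == c | b == c].
  move: ab ac {cd}; have := enum4 un a; have := enum4 un b; have := enum4 un c.
  rewrite /ty !inE.
  by move=> /or4P[]/eqP-> /or4P[]/eqP-> /or4P[]/eqP->; rewrite ?E ?eqxx ?orbT.
case/or3P => /eqP h; subst.
- by apply: (@red_ext _ (fun v => v 0 b ^+ 2 * (v 0 c * v 0 d))) => [v _|];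
    [ring|apply: red_sq; rewrite // -cd].
- by apply: (@red_ext _ (fun v => v 0 c ^+ 2 * (v 0 b * v 0 d))) => [v _|];
    [ring|apply: red_sq].
by apply: (@red_ext _ (fun v => v 0 c ^+ 2 * (v 0 a * v 0 d))) => [v _|];
    [ring|apply: red_sq].
Qed.

(** Two pairs of letters, each of one type, are removed at a time. This leaves the parity of the
    length of [sF] unchanged, so such pairs exist as long as letters remain. *)
Lemma red_word m (sF sN : seq 'I_4) :
  (forall j, j \in sF -> ~~ ty j) -> (forall j, j \in sN -> ty j) ->
  ~~ odd (size sF) -> size sF + size sN = 4 * m ->
  red (2 * m) (fun v => (\prod_(j <- sF) v 0 j) * (\prod_(j <- sN) v 0 j)).
Proof.
elim: m sF sN => [|m IH] sF sN hF hN oF.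
  rewrite muln0 => /eqP; rewrite addn_eq0 !size_eq0 => /andP[/eqP -> /eqP ->].
  by apply: red_ext red1 => v _; rewrite !big_nil mulr1.
rewrite !mulnS => hs.
have step a b c d sF' sN' : ty a = ty b -> ty c = ty d ->
    (forall j, j \in sF' -> ~~ ty j) -> (forall j, j \in sN' -> ty j) ->
    ~~ odd (size sF') -> (size sF' + size sN' = 4 * m)%N ->
    red (2 + 2 * m) (fun v => (v 0 a * v 0 b * (v 0 c * v 0 d)) *
      ((\prod_(j <- sF') v 0 j) * (\prod_(j <- sN') v 0 j))).
  by move=> ab cd h1 h2 h3 h4; apply: redM; [exact: red_four|exact: IH].
have eqty (l : seq 'I_4) (bb : bool) : (forall j, j \in l -> ty j = bb) ->
    forall x y, x \in l -> y \in l -> ty x = ty y.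
  by move=> h x y xl yl; rewrite !h.
case: sF hF oF hs => [|a [|b [|c [|d sF]]]] hF oF hs //.
- case: sN hN hs => [|a [|b [|c [|d sN]]]] hN hs; try by exfalso; move: hs => /=; lia.
  have H := eqty _ true hN.
  apply: (red_ext _ (step a b c d [::] sN _ _ _ _ _ _)) => //.
  + by move=> v _; rewrite !big_cons !big_nil; ring.
  + by apply: H; rewrite !inE eqxx ?orbT.
  + by apply: H; rewrite !inE eqxx ?orbT.
  + by move=> j jl; apply: hN; rewrite !inE jl !orbT.
  by move: hs => /=; lia.
- case: sN hN hs => [|c [|d sN]] hN hs; try by exfalso; move: hs => /=; lia.
  have hF' j : j \in [:: a; b] -> ty j = false by move=> /hF/negPf.
  have H := eqty _ false hF'; have H' := eqty _ true hN.
  apply: (red_ext _ (step a b c d [::] sN _ _ _ _ _ _)) => //.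
  + by move=> v _; rewrite !big_cons !big_nil; ring.
  + by apply: H; rewrite !inE eqxx ?orbT.
  + by apply: H'; rewrite !inE eqxx ?orbT.
  + by move=> j jl; apply: hN; rewrite !inE jl !orbT.
  by move: hs => /=; lia.
have hF' j : j \in [:: a, b, c, d & sF] -> ty j = false by move=> /hF/negPf.
have H := eqty _ false hF'.
apply: (red_ext _ (step a b c d sF sN _ _ _ _ _ _)) => //.
- by move=> v _; rewrite !big_cons; ring.
- by apply: H; rewrite !inE eqxx ?orbT.
- by apply: H; rewrite !inE eqxx ?orbT.
- by move=> j jl; apply: hF; rewrite !inE jl !orbT.
- by move: oF; rewrite /= !negbK.
by move: hs => /=; lia.
Qed.

Lemma word_sgn2 (w : seq 'I_4) v :
  \prod_(j <- w) sgn2 v 0 j = (-1) ^+ count ty w * \prod_(j <- w) v 0 j.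
Proof.
elim: w => [|j w IH]; first by rewrite !big_nil expr0 mulr1.
rewrite !big_cons IH mxE -/(ty j) /= exprD; case: (ty j); rewrite /= ?expr1 ?expr0; ring.
Qed.

(* Even words of length 4m are products of even words of length 4, and the other
   words cancel. *)
Lemma red_sym m F : hform (4 * m) F -> red (2 * m) (fun v => F v + F (sgn2 v)).
Proof.
move=> /hform_words[l ld lE].
have : red (2 * m) (fun v => \sum_(w <- l)
    (w.1 * (1 + (-1) ^+ count ty w.2)) * \prod_(j <- w.2) v 0 j).
  elim: l ld {lE} => [|w l IH] ld.
    by apply: red_ext (red0 _) => v _; rewrite big_nil.
  apply: (@red_ext _ (fun v => (w.1 * (1 + (-1) ^+ count ty w.2)) *
      \prod_(j <- w.2) v 0 j + \sum_(w <- l)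
    (w.1 * (1 + (-1) ^+ count ty w.2)) * \prod_(j <- w.2) v 0 j)).
    by move=> v _; rewrite big_cons.
  apply: redD; last by apply: IH => u ul; apply: ld; rewrite inE ul orbT.
  have sw := ld w (mem_head _ _).
  rewrite -signr_odd; have [oc|oc] := boolP (odd (count ty w.2)).
    by apply: red_ext (red0 _) => v _; rewrite expr1 subrr mulr0 mul0r.
  apply: redZ.
  apply: (@red_ext _ (fun v => (\prod_(j <- filter (predC ty) w.2) v 0 j) *
     (\prod_(j <- filter ty w.2) v 0 j))).
    move=> v _; rewrite !big_filter mulrC; apply: esym.
    by rewrite (bigID ty) /=.
  have cs : (count (predC ty) w.2 + count ty w.2 = 4 * m)%N by rewrite addnC count_predC.
  apply: red_word.
  - by move=> j; rewrite mem_filter => /andP[].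
  - by move=> j; rewrite mem_filter => /andP[].
  - rewrite size_filter; have := congr1 odd cs; rewrite oddD oddM /= => /eqP.
    by rewrite (negPf oc) addbF => /eqP ->.
  by rewrite !size_filter.
apply: red_ext => v _; rewrite !lE -big_split; apply: eq_bigr => w _ /=.
by rewrite word_sgn2; ring.
Qed.

(** For u in the (o,r)-plane and w in the (s,t)-plane, [pfrel (plk u w)] is the determinant of the
    values at u and w of the two quadrics, with the signs changed by the twist by i. Its vanishing
    says that the two pairs of values are dependent. *)
Definition pfrel (x : 'rV[k]_6) : k :=
  (e s - e o) * PF o s x ^+ 2 - (e t - e o) * PF o t x ^+ 2
  - (e s - e r) * PF r s x ^+ 2 + (e t - e r) * PF r t x ^+ 2.

Lemma hform_pfrel : hform 2 pfrel.
Proof.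
have sq c a b : hform 2 (fun x => c * PF a b x ^+ 2).
  by apply: hformZ; apply: (@hformX _ _ 1 2); exact: hform_PF.
by apply: hformD; [apply: hformB; [apply: hformB|]|]; exact: sq.
Qed.

Lemma pfrel_plv v : cone v -> pfrel (plv v) = 0.
Proof.
move=> [h1 h2]; rewrite (sum4 _ un) in h1; rewrite (sum4 _ un) in h2.
have ii2 : val i ^+ 2 = -1 by rewrite expr2 ii.
rewrite /pfrel PF_os PF_ot PF_rs PF_rt !exprMn sqrrN ii2.
transitivity ((v 0 s ^+ 2 * e s + v 0 t ^+ 2 * e t) * (v 0 o ^+ 2 + v 0 r ^+ 2 + v 0 s ^+ 2 + v 0 t ^+ 2)
  - (v 0 s ^+ 2 + v 0 t ^+ 2) * (e o * v 0 o ^+ 2 + e r * v 0 r ^+ 2 + e s * v 0 s ^+ 2 + e t * v 0 t ^+ 2)).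
  by ring.
by rewrite h1 h2 !mulr0 subrr.
Qed.

Lemma sqrt_exists (c : k) : exists x, x ^+ 2 = c.
Proof.
have [|x /rootP] := closed_rootP ('X^2 - c%:P) _.
  by rewrite size_XnsubC.
by rewrite hornerD hornerN hornerXn hornerC => /eqP; rewrite subr_eq0 => /eqP; exists x.
Qed.

(* From [u] on the (o,r)-plane and [w] on the (s,t)-plane, the point [u + lam w] is on the
   cone, after undoing the twist by [i] of [uA] and [uB]. *)
Lemma cone_exists (a b c d : k) : (a, b) != (0, 0) -> (c, d) != (0, 0) ->
  (e s - e o) * (a * c) ^+ 2 - (e t - e o) * (a * d) ^+ 2
  - (e s - e r) * (b * c) ^+ 2 + (e t - e r) * (b * d) ^+ 2 = 0 ->
  exists2 lam, lam != 0 & exists2 v, v != 0 /\ cone v &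
    uA v = a *: dl o + b *: dl r /\ uB v = lam *: (c *: dl s + d *: dl t).
Proof.
move=> ab cd hrel.
pose A1 := a ^+ 2 - b ^+ 2; pose A2 := e o * a ^+ 2 - e r * b ^+ 2.
pose B1 := c ^+ 2 - d ^+ 2; pose B2 := e s * c ^+ 2 - e t * d ^+ 2.
have det : A1 * B2 - A2 * B1 = 0 by rewrite -[RHS]hrel /A1 /A2 /B1 /B2; ring.
(* As [e] is injective, the twisted quadrics have only the trivial common zero on each plane. So
   neither pair of values is zero, and the determinant makes them proportional with a non-zero
   factor. *)
have ne x y : uniq [:: x; y] -> forall p q : k, (p, q) != (0, 0) ->
    (p ^+ 2 - q ^+ 2, e x * p ^+ 2 - e y * q ^+ 2) != (0, 0).
  rewrite /= inE andbT => xy p q; apply: contra_neq => -[/eqP + h2].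
  rewrite subr_eq0 => /eqP h1; move: h2; rewrite h1 -mulrBl => /eqP.
  rewrite mulf_eq0 subr_eq0 (inj_eq einj) (negPf xy) sqrf_eq0 => /eqP q0.
  by move: h1; rewrite q0 expr0n => /eqP; rewrite sqrf_eq0 => /eqP ->.
have A0 : (A1, A2) != (0, 0) by apply: ne ab; rewrite /= inE E.
have B0 : (B1, B2) != (0, 0) by apply: ne cd; rewrite /= inE E.
have [mu [B1E B2E]] : exists mu, A1 = mu * B1 /\ A2 = mu * B2.
  apply: proportional B0 _; apply/eqP; rewrite -[X in _ == X]det; apply/eqP; ring.
have mu0 : mu != 0.
  by apply: contra_neq A0 => m0; rewrite B1E B2E m0 !mul0r.
(* Both quadrics vanish at u + lam w when A + lam^2 B = 0; as A = mu B, this asks for lam^2 =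
   -mu. *)
have [lam lamE] := sqrt_exists (- mu).
have lam0 : lam != 0 by rewrite -sqrf_eq0 lamE oppr_eq0.
exists lam => //.
pose v : 'rV[k]_4 := \row_j (if j == o then a else if j == r then val i * b else
  if j == s then lam * c else - val i * lam * d).
have vE : [/\ v 0 o = a, v 0 r = val i * b, v 0 s = lam * c & v 0 t = - val i * lam * d].
  by rewrite !mxE !E !eqxx.
have [vo vr vs vt] := vE.
have cv : cone v.
  split; rewrite (sum4 _ un) vo vr vs vt.
    transitivity (a ^+ 2 + (val i * val i) * b ^+ 2 + lam ^+ 2 * (c ^+ 2 + (val i * val i) * d ^+ 2)).
      by ring.
    by rewrite ii lamE; transitivity (A1 - mu * B1); [rewrite /A1 /B1; ring|rewrite B1E subrr].
  transitivity (e o * a ^+ 2 + (val i * val i) * (e r * b ^+ 2) +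
     lam ^+ 2 * (e s * c ^+ 2 + (val i * val i) * (e t * d ^+ 2))); first by ring.
  by rewrite ii lamE; transitivity (A2 - mu * B2); [rewrite /A2 /B2; ring|rewrite B2E subrr].
have ir : - (val i * (val i * b)) = b by rewrite mulrA ii mulN1r opprK.
have it : val i * (- val i * lam * d) = lam * d.
  by rewrite !mulrA mulrN ii opprK mul1r.
exists v; last by rewrite /uA /uB vo vr vs vt ir it scalerDr !scalerA.
split=> //; apply: contra_neq ab => v0.
by rewrite -vo -[b]ir -vr v0 !mxE mulr0 oppr0.
Qed.

(** The vanishing of p_or gives a vector w of L in the (s,t)-plane, and that of p_st a vector u in
    the (o,r)-plane. The quadric then makes u and a multiple of w the two generators of some
    [twline v]. *)
Lemma plucker_surj (L : gr k 2 4) : PF o r (plucker L) = 0 -> PF s t (plucker L) = 0 ->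
  pfrel (plucker L) = 0 -> exists2 v, v != 0 /\ cone v & val L = twline v.
Proof.
have dL : \dim (val L) = 2%N := eqP (valP L).
set b0 := (vbasis (val L))`_0; set b1 := (vbasis (val L))`_1.
have bE : val L = <<[:: b0; b1]>>%VS.
  rewrite -[LHS](span_basis (vbasisP (val L))); congr (<<_>>%VS).
  have : size (vbasis (val L)) = 2%N := etrans (size_tuple _) dL.
  by rewrite /b0 /b1; case: (vbasis (val L) : seq _) => [|x [|y [|]]].
have fr x y : x *: b0 + y *: b1 = 0 -> x = 0 /\ y = 0.
  move=> xy.
  have fb : free [:: b0; b1] by rewrite /free -bE dL.
  move: fb; rewrite free_cons seq1_free span_seq1 => /andP[n0 n1].
  have [x0|x0] := eqVneq x 0.
    split=> //; move: xy; rewrite x0 scale0r add0r => /eqP.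
    by rewrite scaler_eq0 (negPf n1) orbF => /eqP.
  case/negP: n0; apply/vlineP; exists (- (y / x)).
  apply: (scalerI x0); rewrite scalerA mulrN mulrC mulfVK // scaleNr.
  by apply/eqP; rewrite -addr_eq0 xy.
rewrite pluckerE -/b0 -/b1 !PF_plk => por pst.
have kill p q : minor b0 b1 p q = 0 -> exists x y, (x, y) != (0, 0) /\
    (x *: b0 + y *: b1) 0 p = 0 /\ (x *: b0 + y *: b1) 0 q = 0.
  rewrite /minor => mpq.
  have [/eqP|n] := boolP ((b0 0 p, b1 0 p) == (0, 0)).
    move=> [p0 p1]; have [/eqP|n] := boolP ((b0 0 q, b1 0 q) == (0, 0)).
      by move=> [q0 q1]; exists 1, 0; rewrite !mxE p0 p1 q0 q1 xpair_eqE oner_eq0; split=> //; split; ring.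
    exists (b1 0 q), (- b0 0 q); rewrite !mxE p0 p1; split; last by split; ring.
    by apply: contra_neq n => -[-> /eqP]; rewrite oppr_eq0 => /eqP ->.
  exists (b1 0 p), (- b0 0 p); rewrite !mxE; split; last first.
    split; first by ring.
    by rewrite -[RHS]oppr0 -[X in _ = - X]mpq; ring.
  by apply: contra_neq n => -[-> /eqP]; rewrite oppr_eq0 => /eqP ->.
have [x [y [xy [wo wr]]]] := kill o r por; have [x' [y' [xy' [us ut]]]] := kill s t pst.
set w := x *: b0 + y *: b1 in wo wr; set u := x' *: b0 + y' *: b1 in us ut.
have w0 : w != 0 by apply: contra_neq xy => /fr[-> ->].
have u0 : u != 0 by apply: contra_neq xy' => /fr[-> ->].
have uE : u = u 0 o *: dl o + u 0 r *: dl r.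
  apply/rowP => j; rewrite !mxE; have := enum4 un j; rewrite !inE.
  by move=> /or4P[]/eqP ->; rewrite !E ?eqxx /= ?(mulr0, mulr1, addr0, add0r) // -?/(u 0 s) -?/(u 0 t);
    move: us ut; rewrite !mxE.
have wE : w = w 0 s *: dl s + w 0 t *: dl t.
  apply/rowP => j; rewrite !mxE; have := enum4 un j; rewrite !inE.
  by move=> /or4P[]/eqP ->; rewrite !E ?eqxx /= ?(mulr0, mulr1, addr0, add0r) //;
    move: wo wr; rewrite !mxE.
have uL : u \in val L by rewrite bE; apply/span2P; exists x', y'.
have wL : w \in val L by rewrite bE; apply/span2P; exists x, y.
have [c cE] := plucker_mem uL wL; move=> hrel.
have relw : pfrel (plk u w) = 0 by rewrite cE (hform_scale _ _ hform_pfrel) pluckerE hrel mulr0.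
have nu : (u 0 o, u 0 r) != (0, 0).
  by apply: contra_neq u0 => -[h1 h2]; rewrite uE h1 h2 !scale0r addr0.
have nw : (w 0 s, w 0 t) != (0, 0).
  by apply: contra_neq w0 => -[h1 h2]; rewrite wE h1 h2 !scale0r addr0.
move: relw; rewrite /pfrel !PF_plk /minor us ut wo wr !mul0r !subr0 => relw.
have [lam lam0 [v vP [vA vB]]] := cone_exists nu nw relw.
exists v => //.
have dv : \dim (twline v) = 2%N.
  have gv : good v by case: vP; exact: cone_good.
  by have [] := twline_is_line gv.
apply/eqP; rewrite eq_sym eqEdim dL dv leqnn andbT /twline vA vB -uE -wE.
apply/subvP => z /span2P[p [p' ->]]; rewrite scalerA.
by apply: memvD; apply: memvZ.
Qed.

(** Comparing generators, w is x v on the coordinates o, r and y v on s, t. The equations at v and w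
    give x^2 = y^2, since otherwise v_o = v_r = 0; the two signs are v and its translate. *)
Lemma twline_inj v w : v != 0 -> cone v -> w != 0 -> cone w -> twline v = twline w ->
  exists2 c, c != 0 & w = c *: v \/ w = c *: sgn2 v.
Proof.
move=> v0 cv w0 cw vw; have gv := cone_good v0 cv.
have : uA w \in twline v by rewrite vw; apply/span2P; exists 1, 0; rewrite scale1r scale0r addr0.
have : uB w \in twline v by rewrite vw; apply/span2P; exists 0, 1; rewrite scale1r scale0r add0r.
move=> /span2P[x' [y BE]] /span2P[x [y' AE]].
have ent (z z' : 'rV[k]_4) j : z = z' -> z 0 j = z' 0 j by move->.
have comb a b (z z' : 'rV[k]_4) j : (a *: z + b *: z') 0 j = a * z 0 j + b * z' 0 j by rewrite !mxE.
have wo : w 0 o = x * v 0 o.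
  by have := ent _ _ o AE; rewrite (comb x y' (uA v)) !uAE !uBE !E !eqxx mulr0 addr0.
have wr : w 0 r = x * v 0 r.
  have := ent _ _ r AE; rewrite (comb x y' (uA v)) !uAE !uBE !E !eqxx mulr0 addr0.
  by move=> h; apply: (mulfI i0); apply: oppr_inj; rewrite h; ring.
have ws : w 0 s = y * v 0 s.
  by have := ent _ _ s BE; rewrite (comb x' y (uA v)) !uAE !uBE !E !eqxx mulr0 add0r.
have wt : w 0 t = y * v 0 t.
  have := ent _ _ t BE; rewrite (comb x' y (uA v)) !uAE !uBE !E !eqxx mulr0 add0r.
  by move=> h; apply: (mulfI i0); rewrite h; ring.
have xy2 : x ^+ 2 = y ^+ 2.
  have [h1 h2] := cw; have [h3 h4] := cv.
  rewrite (sum4 _ un) wo wr ws wt in h1; rewrite (sum4 _ un) wo wr ws wt in h2.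
  rewrite (sum4 _ un) in h3; rewrite (sum4 _ un) in h4.
  have k1 : (x ^+ 2 - y ^+ 2) * (v 0 o ^+ 2 + v 0 r ^+ 2) = 0.
    rewrite -[RHS](subrr 0) -{1}h1 -[X in _ = _ - X](mulr0 (y ^+ 2)) -h3; ring.
  have k2 : (x ^+ 2 - y ^+ 2) * (e o * v 0 o ^+ 2 + e r * v 0 r ^+ 2) = 0.
    rewrite -[RHS](subrr 0) -{1}h2 -[X in _ = _ - X](mulr0 (y ^+ 2)) -h4; ring.
  apply/eqP; rewrite -subr_eq0; apply/eqP/eqP; case: eqP => // /eqP nz.
  have z1 : v 0 o ^+ 2 + v 0 r ^+ 2 = 0 by apply: (mulfI nz); rewrite k1 mulr0.
  have z2 : e o * v 0 o ^+ 2 + e r * v 0 r ^+ 2 = 0 by apply: (mulfI nz); rewrite k2 mulr0.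
  have z3 : (e o - e r) * v 0 o ^+ 2 = 0.
    by rewrite -[RHS](subrr 0) -{1}z2 -[X in _ = _ - X](mulr0 (e r)) -z1; ring.
  have o0 : v 0 o = 0.
    by move/eqP: z3; rewrite mulf_eq0 subr_eq0 (inj_eq einj) E sqrf_eq0 => /eqP.
  have r0 : v 0 r = 0.
    by move: z1; rewrite o0 expr0n add0r => /eqP; rewrite sqrf_eq0 => /eqP.
  by case: (gv o r _ o0 r0); rewrite E.
have x0 : x != 0.
  apply: contra_neq w0 => x0; have y0 : y = 0.
    by move: xy2; rewrite x0 expr0n => /esym/eqP; rewrite sqrf_eq0 => /eqP.
  apply/rowP => j; rewrite mxE; have := enum4 un j.
  by rewrite !inE => /or4P[]/eqP ->; rewrite ?wo ?wr ?ws ?wt ?x0 ?y0 mul0r.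
exists x => //; move/eqP: xy2; rewrite eq_sym eqf_sqr => /orP[]/eqP yx; [left|right];
  apply/rowP => j; rewrite !mxE; have := enum4 un j;
  by rewrite !inE => /or4P[]/eqP ->; rewrite ?wo ?wr ?ws ?wt ?yx ?E ?eqxx /= ?orbT ?mulrN ?mulNr.
Qed.

Lemma twlineZ c v : c != 0 -> twline (c *: v) = twline v.
Proof.
have ZA x w : uA (x *: w) = x *: uA w by rewrite /uA !mxE scalerDr !scalerA mulrN mulrCA.
have ZB x w : uB (x *: w) = x *: uB w by rewrite /uB !mxE scalerDr !scalerA mulrCA.
move=> c0; apply/vspaceP => z; apply/span2P/span2P => -[a [b ->]].
  by exists (a * c), (b * c); rewrite ZA ZB !scalerA.
by exists (a / c), (b / c); rewrite ZA ZB !scalerA !mulfVK.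
Qed.

Lemma twline_sgn2 v : twline (sgn2 v) = twline v.
Proof.
have ZA w : uA (sgn2 w) = uA w by rewrite /uA !mxE !E.
have ZB w : uB (sgn2 w) = - uB w.
  by rewrite /uB !mxE !E !eqxx /= mulrN !scaleNr opprD.
apply/vspaceP => z; apply/span2P/span2P => -[a [b ->]].
  by exists a, (- b); rewrite ZA ZB scalerN scaleNr.
by exists a, (- b); rewrite ZA ZB scalerN scaleNr opprK.
Qed.

End Lines.
End Cone.

(* [quad2] is [\sum_j ev j * v_j ^ 2]; distinctness of the [ev j] is smoothness of [E]. *)
Definition ev (k : fieldType) (alpha gamma : k) (j : 'I_4) : k :=
  nth 0 [:: 0; 1 - gamma; 1 + alpha * gamma; 1 + alpha] j.

(** The differences of the last three values are -gamma(1 + alpha), -(alpha + gamma) and -alpha(1 -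
    gamma). By the relation (alpha + gamma) + beta(1 + alpha gamma) = 0, with beta non-zero, alpha +
    gamma and 1 + alpha gamma could only vanish together, and then alpha^2 = 1. *)
Lemma ev_inj (k : fieldType) (alpha beta gamma : k) :
  alpha + beta + gamma + alpha * beta * gamma = 0 ->
  (forall t, t \in [:: alpha; beta; gamma] -> t \notin [:: 0; 1; -1]) ->
  injective (ev alpha gamma).
Proof.
move=> habc hne.
have := hne alpha; rewrite !inE eqxx !negb_or => /(_ isT)/and3P[a0 a1 aN].
have := hne beta; rewrite !inE eqxx orbT !negb_or => /(_ isT)/and3P[b0 b1 bN].
have := hne gamma; rewrite !inE eqxx !orbT !negb_or => /(_ isT)/and3P[c0 c1 cN].
have g1 : 1 - gamma != 0 by rewrite subr_eq0 eq_sym.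
have a2 : 1 + alpha != 0 by rewrite addrC addr_eq0.
have ac : 1 + alpha * gamma != 0.
  apply/eqP => h; have h1 : alpha + gamma = 0.
    rewrite -[RHS]habc -[LHS]addr0 -[X in _ + X](mulr0 beta) -h; ring.
  have gE : gamma = - alpha by apply/eqP; rewrite -addr_eq0 addrC h1.
  have : (1 - alpha) * (1 + alpha) = 0 by rewrite -[RHS]h gE; ring.
  by move/eqP; rewrite mulf_eq0 (negPf a2) orbF subr_eq0 eq_sym (negPf a1).
have ag : alpha + gamma != 0.
  apply/eqP => h; have : beta * (1 + alpha * gamma) = 0.
    by rewrite -[RHS](subrr 0) -{1}habc -h; ring.
  by move/eqP; rewrite mulf_eq0 (negPf b0) (negPf ac).
have d12 : 1 - gamma != 1 + alpha * gamma.
  rewrite -subr_eq0 (_ : _ - _ = - gamma * (1 + alpha)); last by ring.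
  by rewrite mulf_neq0 ?oppr_eq0.
have d13 : 1 - gamma != 1 + alpha.
  rewrite -subr_eq0 (_ : _ - _ = - (alpha + gamma)); last by ring.
  by rewrite oppr_eq0.
have d23 : 1 + alpha * gamma != 1 + alpha.
  rewrite -subr_eq0 (_ : _ - _ = - (alpha * (1 - gamma))); last by ring.
  by rewrite oppr_eq0 mulf_neq0.
have u : uniq [:: 0; 1 - gamma; 1 + alpha * gamma; 1 + alpha].
  rewrite /= !inE !negb_or ![0 == _]eq_sym g1 ac a2 d12 d13 d23 //.
by move=> x y /eqP; rewrite /ev nth_uniq // => /eqP/val_inj.
Qed.

(** * Points of E and translations *)

Section CurvePoints.
Variables (k : closedFieldType) (alpha gamma : k).
Local Notation E := (curve alpha gamma).
Local Notation e := (ev alpha gamma).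

Lemma quad_cone v : quad1 v = 0 /\ quad2 alpha gamma v = 0 <-> cone e v.
Proof.
have un : uniq [:: 0; inord 1; inord 2; inord 3 : 'I_4].
  by rewrite /= !inE -!val_eqE /= !inordK.
rewrite /cone /quad1 /quad2 [\sum_j e j * _](sum4 _ un) /ev /= !inordK //.
by rewrite mul0r add0r.
Qed.

Lemma ccoord_neq0 (p : E) : ccoord p != 0.
Proof.
rewrite /ccoord vpick0; apply/eqP => p0.
by have := valP (val p); rewrite -/(cpt p) p0 dimv0.
Qed.

Lemma cpt_ccoord (p : E) : cpt p = <[ccoord p]>%VS.
Proof.
apply/eqP; rewrite eq_sym eqEdim (eqP (valP (val p))) dim_vline ccoord_neq0 andbT.
by rewrite -memvE; exact: memv_pick.
Qed.

Lemma ccoord_cone (p : E) : cone e (ccoord p).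
Proof. by apply/quad_cone; have /andP[/eqP h1 /eqP h2] := valP p. Qed.

Lemma vline_eq (u w : 'rV[k]_4) : u != 0 -> <[u]>%VS = <[w]>%VS -> exists2 c, c != 0 & u = c *: w.
Proof.
move=> u0 uw; have : u \in <[w]>%VS by rewrite -uw memv_line.
move=> /vlineP[c uE]; exists c => //; apply: contra_neq u0 => c0.
by rewrite uE c0 scale0r.
Qed.

Lemma line_scale (w : 'rV[k]_4) c : c != 0 -> <[c *: w]>%VS = <[w]>%VS.
Proof.
move=> c0; apply/vspaceP => z; apply/vlineP/vlineP => -[a ->].
  by exists (a * c); rewrite scalerA.
by exists (a / c); rewrite scalerA mulfVK.
Qed.

Lemma curve_ext (p q : E) : cpt p = cpt q -> p = q.
Proof. by move=> pq; apply: val_inj; apply: val_inj. Qed.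

Lemma curve_pt v : v != 0 -> cone e v -> exists p : E, exists2 c, c != 0 & ccoord p = c *: v.
Proof.
move=> v0 cv; have dl : \dim <[v]> == 1%N by rewrite dim_vline v0.
pose P : gr k 1 4 := exist _ <[v]>%VS dl.
have pv : exists c, vpick <[v]> = c *: v by apply/vlineP; exact: memv_pick.
have oc : on_curve alpha gamma P.
  have [c cE] := pv; have := coneZ c cv; rewrite -cE => /quad_cone[h1 h2].
  by rewrite /on_curve /= h1 h2 !eqxx.
exists (exist _ P oc); have [c cE] := pv; exists c => //.
apply/eqP => c0; have : vpick <[v]> = 0 by rewrite cE c0 scale0r.
by move/eqP; rewrite vpick0 => /eqP h; move: v0; rewrite -memv0 -h memv_line.
Qed.

End CurvePoints.

(* Off the identity, [d = gj (rr d)]; the value at [gam1] is irrelevant. *)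
Definition rr (d : Gam) : 'I_4 :=
  match d with
  | (false, true) => @Ordinal 4 2 isT
  | (true, true) => @Ordinal 4 3 isT
  | _ => @Ordinal 4 1 isT
  end.
Definition ss (d : Gam) : 'I_4 :=
  match d with
  | (false, true) => @Ordinal 4 3 isT
  | (true, true) => @Ordinal 4 1 isT
  | _ => @Ordinal 4 2 isT
  end.
Definition tt (d : Gam) : 'I_4 :=
  match d with
  | (false, true) => @Ordinal 4 1 isT
  | (true, true) => @Ordinal 4 2 isT
  | _ => @Ordinal 4 3 isT
  end.

Lemma cycd d : cyc (rr d) (ss d) (tt d).
Proof. by case: d => [[] []]. Qed.

Lemma gj_rr d : d != gam1 -> gj (rr d) = d.
Proof. by case: d => [[] []]. Qed.

Lemma gj_cases (d d' : Gam) : d != gam1 -> d' != gam1 -> d' != d ->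
  d' = gj (ss d) \/ d' = gj (tt d).
Proof. by case: d d' => [[] []] [[] []] //; by [left|right]. Qed.

Lemma gam_ss d : gam_neg (gj (ss d)) =1 (fun j => (j == tt d) || (j == rr d)).
Proof. by apply: cyc_neg; case: d => [[] []]. Qed.

Lemma gam_rr d : d != gam1 -> gam_neg d =1 (fun j => (j == ss d) || (j == tt d)).
Proof. by move=> d1; rewrite -{1}(gj_rr d1); apply: cyc_neg; exact: cycd. Qed.

Section Vectors.
Variable k : fieldType.
Implicit Types v : 'rV[k]_4.

Definition gamv (d : Gam) v : 'rV[k]_4 := \row_j ((-1) ^+ gam_neg d j * v 0 j).

Lemma gam_pt_line d v : gam_pt d <[v]> = <[gamv d v]>%VS.
Proof.
rewrite /gam_pt limg_line lfunE /= mul_mx_diag; congr (<[_]>%VS).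
by apply/rowP => j; rewrite !mxE mulrC.
Qed.

Lemma gamv_comp d d' v : gamv d (gamv d' v) = gamv (gamM d' d) v.
Proof.
apply/rowP => j; rewrite !mxE mulrA -signr_addb; congr ((-1) ^+ _ * _).
by move: d d' => [[] []] [[] []]; case: j => [[|[|[|[|?]]]] ?].
Qed.

Lemma gamv1 v : gamv gam1 v = v.
Proof. by apply/rowP => j; rewrite mxE; case: j => [[|[|[|[|?]]]] ?] //; rewrite /= mul1r. Qed.

Lemma gamv_rr d v : d != gam1 -> gamv d v =
  \row_j (if (j == ss d) || (j == tt d) then - v 0 j else v 0 j).
Proof.
move=> d1; apply/rowP => j; rewrite !mxE (gam_rr d1).
by case: (_ || _); rewrite ?mulN1r ?mul1r.
Qed.

Lemma gamv_ss d v : gamv (gj (ss d)) v = flip (rr d) (tt d) v.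
Proof.
by apply/rowP => j; rewrite !mxE gam_ss orbC; case: (_ || _); rewrite ?mulN1r ?mul1r.
Qed.
End Vectors.

Section ChordCuts.
Variables (k : closedFieldType) (alpha beta gamma : k).
Hypothesis hk : (2%:R : k) != 0.
Hypothesis habc : alpha + beta + gamma + alpha * beta * gamma = 0.
Hypothesis hne : forall t, t \in [:: alpha; beta; gamma] -> t \notin [:: 0; 1; -1].
Local Notation E := (curve alpha gamma).
Local Notation e := (ev alpha gamma).
Local Notation dl := (delta_mx (0 : 'I_1)).

Let einj : injective e := ev_inj habc hne.

Lemma ccoord_good (p : E) : good (ccoord p).
Proof. exact: (cone_good einj (ccoord_neq0 p) (ccoord_cone p)). Qed.

Section Triple.
Variables (r s t : 'I_4).
Hypothesis c3 : cyc r s t.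
Let un : uniq [:: 0; r; s; t] := cyc_uniq c3.

Lemma chord_sgn2 (v : 'rV[k]_4) : chord 0 r s t (sgn2 s t v) = chord 0 r s t v.
Proof.
move: un; rewrite /= !inE !negb_or => /and4P[/and3P[_ os ot] /andP[rs rt] _ _].
rewrite /chord !mxE (negPf os) (negPf ot) (negPf rs) (negPf rt) !eqxx orbT /=.
rewrite !scaleNr -opprD; apply/vspaceP => z.
by apply/span2P/span2P => -[a [b ->]]; exists a, (- b); rewrite scalerN scaleNr ?opprK.
Qed.

Lemma row4 (v : 'rV[k]_4) : v = (v 0 0 *: dl 0 + v 0 r *: dl r) + (v 0 s *: dl s + v 0 t *: dl t).
Proof. by rewrite {1}[v]row_sum_delta (sum4 _ un) !addrA. Qed.

(** Half the sum and half the difference of v and its translate are the two generators of the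
    chord. *)
Lemma chord_sub (v : 'rV[k]_4) (L : {vspace 'rV[k]_4}) : v \in L -> sgn2 s t v \in L ->
  (chord 0%R r s t v <= L)%VS.
Proof.
move: un; rewrite /= !inE !negb_or => /and4P[/and3P[_ os ot] /andP[rs rt] _ _].
have := row4 (sgn2 s t v); rewrite !mxE (negPf os) (negPf ot) (negPf rs) (negPf rt) !eqxx orbT /=.
rewrite !scaleNr -opprD; have := row4 v.
set A := _ *: dl 0 + _; set B := _ *: dl s + _ => vE wE vL wL.
have AL : A \in L.
  rewrite (_ : A = 2%:R^-1 *: (v + sgn2 s t v)); first by apply: memvZ; exact: memvD.
  by rewrite wE {1}vE addrACA subrr addr0 -mulr2n -scaler_nat scalerA mulVf // scale1r.
have BL : B \in L.
  have -> : B = v - A by rewrite {1}vE [A + B]addrC addrK.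
  exact: memvB.
by apply/subvP => z /span2P[a [b ->]]; apply: memvD; apply: memvZ.
Qed.

Lemma cuts_chord (c c' v : 'rV[k]_4) (p q : E) : good v ->
  cpt p = <[v]>%VS -> cpt q = <[sgn2 s t v]>%VS -> cuts c c' p q ->
  is_line c c' (chord 0 r s t v).
Proof.
move=> gv pv qv [b0 [b1 [L [u [w [pE qE _]]]]]].
rewrite (_ : chord 0 r s t v = <<[:: b0; b1]>>%VS) //.
apply/eqP; rewrite eqEdim L.1 (chord_line c3 gv).1 leqnn andbT.
by apply: chord_sub; rewrite memvE -?pv -?qv ?pE ?qE -memvE; apply/span2P; eexists; eexists.
Qed.

Lemma quad1E (v : 'rV[k]_4) : quad1 v = v 0 0 ^+ 2 + v 0 r ^+ 2 + v 0 s ^+ 2 + v 0 t ^+ 2.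
Proof. exact: (sum4 _ un). Qed.

Lemma quad2E (v : 'rV[k]_4) : quad2 alpha gamma v =
  e 0 * v 0 0 ^+ 2 + e r * v 0 r ^+ 2 + e s * v 0 s ^+ 2 + e t * v 0 t ^+ 2.
Proof.
rewrite -(sum4 (fun j => e j * v 0 j ^+ 2) un).
have un' : uniq [:: 0; inord 1; inord 2; inord 3 : 'I_4].
  by rewrite /= !inE -!val_eqE /= !inordK.
rewrite (sum4 _ un') /quad2 /ev /= !inordK //.
by rewrite mul0r add0r.
Qed.

Lemma chord_cuts (v : 'rV[k]_4) (p q : E) : cone e v -> good v ->
  cpt p = <[v]>%VS -> cpt q = <[sgn2 s t v]>%VS -> cuts (fmA 0 r v) (fmB s t v) p q.
Proof.
move=> [h1 h2] gv pv qv; set b0 := v 0 0 *: dl 0 + v 0 r *: dl r.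
rewrite (sum4 _ un) in h1; rewrite (sum4 _ un) in h2.
set b1 := v 0 s *: dl s + v 0 t *: dl t; exists b0, b1.
split; first exact: chord_line.
exists (1, 1), (1, -1) => /=.
move: (un); rewrite /= !inE !negb_or => /and4P[/and3P[r0 os ot] /andP[rs rt] st _].
have ne : ((0 == r) = false) * ((0 == s) = false) * ((0 == t) = false) * ((r == s) = false) *
  ((r == t) = false) * ((s == t) = false) * ((r == 0) = false) * ((s == 0) = false) *
  ((t == 0) = false) * ((s == r) = false) * ((t == r) = false) * ((t == s) = false).
  by do ![split]; apply/negbTE; rewrite // eq_sym.
split.
- by rewrite pv !scale1r -row4.
- rewrite qv scale1r scaleN1r; congr (<[_]>%VS).
  rewrite [LHS]row4 !mxE !ne !eqxx orbT /=.
  by rewrite !scaleNr -opprD.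
(* These are the values of the quadrics at [b1]. Their values at [b0] are opposite, since [b0 + b1]
   is on the cone, so both restrict to multiples of b^2 - a^2, which is the product of the two
   linear forms. *)
exists (v 0 s ^+ 2 + v 0 t ^+ 2, e s * v 0 s ^+ 2 + e t * v 0 t ^+ 2) => /=; split.
  rewrite xpair_eqE; apply/negP => /andP[/eqP z1 /eqP z2].
  have z3 : (e s - e t) * v 0 s ^+ 2 = 0.
    by rewrite -[RHS](subrr 0) -{1}z2 -[X in _ = _ - X](mulr0 (e t)) -z1; ring.
  have s0 : v 0 s = 0.
    by move/eqP: z3; rewrite mulf_eq0 subr_eq0 (inj_eq einj) ne sqrf_eq0 => /eqP.
  have t0 : v 0 t = 0.
    by move: z1; rewrite s0 expr0n add0r => /eqP; rewrite sqrf_eq0 => /eqP.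
  by case: (gv s t st s0 t0).
move=> a b; rewrite quad1E quad2E !mxE !ne !eqxx /=.
rewrite ?(mulr0, mulr1, addr0, add0r); split.
  by rewrite -[RHS]addr0 -[X in _ = _ + X](mulr0 (a ^+ 2)) -h1; ring.
by rewrite -[RHS]addr0 -[X in _ = _ + X](mulr0 (a ^+ 2)) -h2; ring.
Qed.

End Triple.
End ChordCuts.

Section Transport.
Variables (k : fieldType) (alpha beta gamma : k) (i : sqrtN1 k).
Implicit Types M N : eqModule alpha beta gamma i.

Lemma eq_isom_invs M N : eq_isom M N -> graded_isom (em_invs M) (em_invs N).
Proof.
move=> [f [fb fd fa]].
have [g [fK gK]] := linear_inverse fb.
have ga d n : g (em_act d n) = em_act d (g n) by rewrite -{1}[n]gK -fa fK.
have fI (m : invs M) : f (val m) \in em_inv (M := N).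
  by apply/forallP => d; rewrite -fa (eqP (forallP (valP m) d)).
have gI (m : invs N) : g (val m) \in em_inv (M := M).
  by apply/forallP => d; rewrite -ga (eqP (forallP (valP m) d)).
pose h (m : em_invs M) : em_invs N := InvElt (fI m).
have hl : linear h by move=> a u v; apply: val_inj; exact: (linearP f).
pose h' : {linear em_invs M -> em_invs N} := HB.pack h (GRing.isLinear.Build _ _ _ _ h hl).
exists h'; split; last by move=> n v; exact: fd.
exists (fun m : em_invs N => InvElt (gI m)) => m; apply: val_inj; [exact: fK|exact: gK].
Qed.

Lemma has_line_transport M N L : eq_isom M N -> has_line M L -> has_line N L.
Proof.
move=> /eq_isom_invs iso [c [c' [y [y' [yE yE' Lc gM]]]]]; exists c, c', y, y'; split=> //.
exact: graded_isom_trans (graded_isom_sym iso) gM.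
Qed.
End Transport.

(** * The two-torsion points and the modules attached to points of E *)

Section Modules.
Variables (k : closedFieldType) (alpha beta gamma : k).
Hypothesis hk : (2%:R : k) != 0.
Hypothesis habc : alpha + beta + gamma + alpha * beta * gamma = 0.
Hypothesis hne : forall t, t \in [:: alpha; beta; gamma] -> t \notin [:: 0; 1; -1].
Variables (i : sqrtN1 k) (G : groupLaw alpha gamma) (xi : Gam -> curve alpha gamma).
Hypothesis hxi : forall d p, cpt (ga G p (xi d)) = gam_pt d (cpt p).
Hypothesis hE2 : forall q, ga G q q = go G <-> exists d, q = xi d.
Local Notation E := (curve alpha gamma).
Local Notation e := (ev alpha gamma).
Let good_p (p : E) : good (ccoord p) := @ccoord_good k alpha beta gamma habc hne p.

Lemma cone_gamv d (v : 'rV[k]_4) : cone e v -> cone e (gamv d v).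
Proof.
have sq j : gamv d v 0 j ^+ 2 = v 0 j ^+ 2.
  by rewrite mxE exprMn -exprM mulnC exprM sqrrN expr1n expr1n mul1r.
by move=> [h1 h2]; split; under eq_bigr do rewrite sq.
Qed.

Lemma cpt_xi d p v : cpt p = <[v]>%VS -> cpt (ga G p (xi d)) = <[gamv d v]>%VS.
Proof. by move=> pv; rewrite hxi pv gam_pt_line. Qed.

Lemma ga_xi p d d' : ga G (ga G p (xi d)) (xi d') = ga G p (xi (gamM d d')).
Proof.
apply: curve_ext; have pv := cpt_ccoord p.
by rewrite (cpt_xi _ (cpt_xi _ pv)) gamv_comp (cpt_xi _ pv).
Qed.

Lemma xi1 : xi gam1 = go G.
Proof.
rewrite -(ga0 G (xi gam1)); apply: curve_ext.
by rewrite (cpt_xi _ (cpt_ccoord _)) gamv1 -cpt_ccoord.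
Qed.

Lemma xiM d d' : ga G (xi d) (xi d') = xi (gamM d d').
Proof. by have := ga_xi (go G) d d'; rewrite !ga0. Qed.

(** Otherwise the sign change of d would multiply the coordinates of the identity by a scalar. A
    good vector has a non-zero coordinate among those kept and one among those negated, so the
    scalar would be 1 and -1. *)
Lemma xi_neq d : d != gam1 -> xi d <> go G.
Proof.
move=> d1 xd; have pv := cpt_ccoord (go G).
have := cpt_xi d pv; rewrite xd ga0 pv => /(vline_eq (ccoord_neq0 _))[c c0 vE].
set v := ccoord (go G) in vE *; have gv : good v := @good_p (go G).
have cj j : v 0 j = (-1) ^+ gam_neg d j * (c * v 0 j).
  by rewrite {1}vE !mxE mulrCA.
have g := gam_rr d1.
have : uniq [:: 0; rr d; ss d; tt d] := cyc_uniq (cycd d).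
rewrite /= !inE !negb_or => /and4P[/and3P[or os ot] /andP[rs rt] st _].
have nonz a b : a != b -> exists2 j, v 0 j != 0 & j = a \/ j = b.
  move=> ab; have [a0|] := eqVneq (v 0 a) 0; last by exists a => //; left.
  by exists b; [apply/eqP/(gv a b)|right].
have [j j0 jE] := nonz _ _ or; have [l l0 lE] := nonz _ _ st.
have c1 : c = 1.
  apply: (mulIf j0); rewrite mul1r [RHS]cj g.
  suff -> : (j == ss d) || (j == tt d) = false by rewrite mul1r.
  by case: jE => ->; apply/negbTE; rewrite negb_or ?os ?rs ?ot ?rt.
have : v 0 l = - v 0 l.
  rewrite {1}[v 0 l]cj c1 mul1r g.
  suff -> : (l == ss d) || (l == tt d) = true by rewrite mulN1r.
  by case: lE => ->; rewrite eqxx ?orbT.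
move/eqP; rewrite -addr_eq0 -mulr2n -mulr_natl mulf_eq0 (negPf hk) => /eqP l00.
by rewrite l00 eqxx in l0.
Qed.

Lemma xi_inj : injective xi.
Proof.
move=> d d' dd; have : xi (gamM d d') = go G by rewrite -xiM dd xiM -xi1; congr xi; case: d' {dd} => [[] []].
have [/eqP|/xi_neq//] := boolP (gamM d d' == gam1).
by case: d d' {dd} => [[] []] [[] []].
Qed.

Lemma tors2_idx (z : tors2 G) : exists2 d, d != gam1 & sval z = xi d.
Proof.
case: z => q h; have [q0 /hE2[d qd]] := h; exists d => //.
by apply/eqP => d1; apply: q0; rewrite qd d1 xi1.
Qed.

Lemma tors2_of d : d != gam1 -> exists z : tors2 G, sval z = xi d.
Proof.
move=> d1; have h : xi d <> go G /\ ga G (xi d) (xi d) = go G.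
  by split; [exact: xi_neq|apply/hE2; exists d].
by exists (exist _ (xi d) h).
Qed.

Lemma tors2_inj (z w : tors2 G) : sval z = sval w -> z = w.
Proof. by case: z w => [q h] [q' h'] /= qq; subst; congr exist; exact: Prop_irrelevance. Qed.

Definition vl d (p : E) := twline i 0 (rr d) (ss d) (tt d) (ccoord p).

Lemma vl_dim d p : \dim (vl d p) == 2%N.
Proof. by have [->] := twline_is_line i (cyc_uniq (cycd d)) (@good_p p). Qed.

Definition Lv d p : gr k 2 4 := exist _ (vl d p) (vl_dim d p).

Definition Mv d (p : E) : eqModule alpha beta gamma i :=
  line_mod alpha beta gamma i (lnA i 0 (rr d) (ccoord p)) (lnB i (ss d) (tt d) (ccoord p)).

Lemma has_line_Mv d p : has_line (Mv d p) (Lv d p).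
Proof.
by apply: (has_line_mod alpha beta gamma i hk); apply: (twline_is_line i (cyc_uniq (cycd d)) (@good_p p)).
Qed.

Lemma of_type_Mv d z p : d != gam1 -> sval z = xi d -> @of_type k alpha beta gamma i G z (Mv d p).
Proof.
move=> d1 zd; have c3 := cycd d; set v := ccoord p.
(* Of the two admissible choices of xi', this is the one realized by [flip]. *)
set d' := gj (ss d); have d'1 : d' != gam1 by have /andP[] := cyc_gj c3.
have [z' zd'] := tors2_of d'1.
exists p, z'; split.
  by rewrite zd zd' => /xi_inj; rewrite /d'; case: (d) d1 => [[] []].
exists (fmA 0 (rr d) v), (fmB (ss d) (tt d) v).
exists (fmA 0 (rr d) (flip (rr d) (tt d) v)), (fmB (ss d) (tt d) (flip (rr d) (tt d) v)).
have pv : cpt p = <[v]>%VS := cpt_ccoord p.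
have gv : good v := @good_p p.
have gE w : gamv d w = sgn2 (ss d) (tt d) w := gamv_rr w d1.
have p'v : cpt (ga G p (sval z')) = <[flip (rr d) (tt d) v]>%VS.
  by rewrite zd' (cpt_xi _ pv) gamv_ss.
have cv : cone e v := ccoord_cone p.
split.
- by apply: (chord_cuts habc hne) => //; rewrite zd (cpt_xi _ pv) gE.
- apply: (chord_cuts habc hne) => //.
  + by rewrite -gamv_ss; exact: cone_gamv.
  + exact: flip_good.
  + by rewrite zd (cpt_xi _ p'v) gE.
by apply: (line_mod_type alpha beta gamma i hk) => //; apply: chord_line => //; exact: flip_good.
Qed.

Lemma of_type_Lv d z M : d != gam1 -> sval z = xi d -> @of_type k alpha beta gamma i G z M ->
  exists p, has_line M (Lv d p).
Proof.
move=> d1 zd [p [z' [zz' [c1 [c1' [c2 [c2' [cut1 cut2 iso]]]]]]]].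
have c3 := cycd d; set v := ccoord p; have pv : cpt p = <[v]>%VS := cpt_ccoord p.
have gv : good v := @good_p p.
have gE w : gamv d w = sgn2 (ss d) (tt d) w := gamv_rr w d1.
have L1 : is_line c1 c1' (chord 0 (rr d) (ss d) (tt d) v).
  by apply: (cuts_chord hk c3 gv pv _ cut1); rewrite zd (cpt_xi _ pv) gE.
have [d' d'1 zd'] := tors2_idx z'.
have dd' : d' != d by apply/eqP => dd; apply: zz'; rewrite zd' zd dd.
have p'v := cpt_xi d' pv; rewrite zd' in cut2.
set w := flip (rr d) (tt d) v; have gw : good w := flip_good gv.
have L2 : is_line c2 c2' (chord 0 (rr d) (ss d) (tt d) w).
  (* The given xi' is xi_s or xi_t. In the second case p + xi' differs from p + xi_s by xi_r, and
     the chord is the same. *)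
  have [dE|dE] := gj_cases d1 d'1 dd'.
    by rewrite dE gamv_ss in p'v; apply: (cuts_chord hk c3 gw _ _ cut2);
      rewrite ?dE // zd (cpt_xi _ p'v) gE.
  have wE : gamv d' v = sgn2 (ss d) (tt d) w.
    rewrite dE -gE /w -gamv_ss gamv_comp; congr gamv.
    by case: (d) d1 => [[] []].
  rewrite wE in p'v; rewrite -(chord_sgn2 c3); apply: (cuts_chord hk c3 _ p'v _ cut2).
    by rewrite -wE => a b ab; rewrite !mxE => /eqP; rewrite mulf_eq0 signr_eq0 => /eqP a0 /eqP;
      rewrite mulf_eq0 signr_eq0 => /eqP; exact: (gv a b ab a0).
  by rewrite zd (cpt_xi _ p'v) gE.
have [isoM|isoM] := of_type_line hk c3 gv L1 L2 iso.
  by exists p; apply: has_line_transport isoM (has_line_Mv d p).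
exists (ga G p (xi (gj (ss d)))); apply: has_line_transport isoM _.
apply: (has_line_mod alpha beta gamma i hk); rewrite (_ : val _ = twline i 0 (rr d) (ss d) (tt d) w).
  exact: (twline_is_line i (cyc_uniq c3) gw).
have := cpt_xi (gj (ss d)) pv; rewrite gamv_ss -/w cpt_ccoord.
by move=> /(vline_eq (ccoord_neq0 _))[c c0 cE]; rewrite /= /vl cE twlineZ.
Qed.

End Modules.

(** Closedness tested at one outside point at a time: the forms vanishing on Z are then taken all
    together as equations. *)
Lemma pvar_separate (k : fieldType) (T : Type) n (h : T -> 'rV[k]_n) (Z : T -> Prop) :
  @ks_closed k (pvar h) Z <-> forall x, ~ Z x -> exists d F,
    [/\ hform d F, forall z, Z z -> F (h z) = 0 & F (h x) != 0].
Proof.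
rewrite pvar_closedP; split=> [[J [Jd JZ]] x nZx|sep].
  have : ~ forall F, J F -> F (h x) = 0 by rewrite -JZ.
  move=> /existsNP[F /not_implyP[JF Fx]]; have [d Fd] := Jd F JF.
  by exists d, F; split=> // [z /JZ H|]; [exact: H|exact/eqP].
exists (fun F => (exists d, hform d F) /\ forall z, Z z -> F (h z) = 0).
split=> [F []//|x]; split=> [Zx F [_]|H]; first exact.
apply: contrapT => /sep[d [F [Fd FZ /eqP]]]; apply; apply: H; split=> //.
by exists d.
Qed.

(** * The three families of lines *)

Section LineFamily.
Variables (k : closedFieldType) (alpha beta gamma : k).
Hypothesis hk : (2%:R : k) != 0.
Hypothesis habc : alpha + beta + gamma + alpha * beta * gamma = 0.
Hypothesis hne : forall t, t \in [:: alpha; beta; gamma] -> t \notin [:: 0; 1; -1].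
Variables (i : sqrtN1 k) (G : groupLaw alpha gamma) (xi : Gam -> curve alpha gamma).
Hypothesis hxi : forall d p, cpt (ga G p (xi d)) = gam_pt d (cpt p).
Hypothesis hE2 : forall q, ga G q q = go G <-> exists d, q = xi d.
Local Notation E := (curve alpha gamma).
Local Notation e := (ev alpha gamma).
Local Notation plvd d := (plv i 0 (rr d) (ss d) (tt d)).
Local Notation sg d := (sgn2 (ss d) (tt d)).
Local Notation Lv := (Lv habc hne i).

Let einj : injective e := ev_inj habc hne.
Let und d : uniq [:: 0; rr d; ss d; tt d] := cyc_uniq (cycd d).

Let i0 : val i != 0.
Proof.
apply/eqP => z; have /eqP := valP i; rewrite z expr0n /= => /eqP.
by rewrite eq_sym oppr_eq0 oner_eq0.
Qed.

Lemma plucker_Lv d p : exists2 c, c != 0 & plucker (Lv d p) = c *: plvd d (ccoord p).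
Proof.
apply: plucker_span.
- by apply/span2P; exists 1, 0; rewrite scale1r scale0r addr0.
- by apply/span2P; exists 0, 1; rewrite scale1r scale0r add0r.
by apply: (plv_neq0 i (und d)); exact: (@ccoord_good k alpha beta gamma habc hne p).
Qed.

Lemma ccoord_ga d p : d != gam1 ->
  exists2 c, c != 0 & ccoord (ga G p (xi d)) = c *: sg d (ccoord p).
Proof.
move=> d1; have := cpt_xi hxi d (cpt_ccoord p); rewrite cpt_ccoord => /(vline_eq (ccoord_neq0 _)).
by move=> [c c0 cE]; exists c => //; rewrite cE (gamv_rr _ d1).
Qed.

Lemma Lv_eqP d p q : d != gam1 -> Lv d p = Lv d q <-> coset G (xi d) p q.
Proof.
move=> d1; have [c c0 cE] := ccoord_ga p d1; split=> [/(congr1 val) /= pq|].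
  have [b b0 [qE|qE]] := twline_inj einj (und d) (ccoord_neq0 p) (ccoord_cone p)
    (ccoord_neq0 q) (ccoord_cone q) pq; [left|right]; apply: curve_ext; rewrite !cpt_ccoord.
    by rewrite qE line_scale.
  by rewrite qE cE !line_scale.
by move=> [->//|->]; apply: val_inj; rewrite /= /vl cE twlineZ // (twline_sgn2 i (und d)).
Qed.

(** Each factor is one coordinate of an opposite pair: p_0s or p_rt, then p_0t or p_rs. On each of
    the other two families both coordinates of one pair vanish, so all four products do; at a good
    point of the family d some choice is non-zero. *)
Definition sepF d (a b : bool) (x : 'rV[k]_6) : k :=
  (if a then PF 0 (ss d) x else PF (rr d) (tt d) x) *
  (if b then PF 0 (tt d) x else PF (rr d) (ss d) x).

Lemma hform_sepF d a b : hform 2 (sepF d a b).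
Proof.
by apply: (@hformM _ _ 1 1); [case: a|case: b]; exact: hform_PF.
Qed.

Lemma sepF_neq0 d p : exists a b, sepF d a b (plucker (Lv d p)) != 0.
Proof.
have [c c0 ->] := plucker_Lv d p; set v := ccoord p.
have gv : good v := @ccoord_good k alpha beta gamma habc hne p.
have := und d; rewrite /= !inE !negb_or => /and4P[/and3P[or os ot] /andP[rs rt] st _].
suff [a [b ab]] : exists a b, sepF d a b (plvd d v) != 0.
  by exists a, b; rewrite (hform_scale _ _ (hform_sepF d a b)) mulf_neq0 // expf_neq0.
have ni : - val i != 0 by rewrite oppr_eq0.
have one x y : x * y = 0 :> k -> x = 0 \/ y = 0.
  by move=> /eqP; rewrite mulf_eq0 => /orP[]/eqP; [left|right].
have [a ha] : exists a : bool,
    (if a then PF 0 (ss d) (plvd d v) else PF (rr d) (tt d) (plvd d v)) != 0.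
  have [z|] := eqVneq (PF 0 (ss d) (plvd d v)) 0; last by exists true.
  exists false; rewrite (PF_rt i (und d)); move: z; rewrite (PF_os i (und d)) => /one[z|z].
    by apply: mulf_neq0; apply/eqP; [exact: (gv _ _ or z)|exact: (gv _ _ ot z)].
  apply: mulf_neq0; apply/eqP; first by apply: (gv _ _ _ z); rewrite eq_sym.
  exact: (gv _ _ st z).
have [b hb] : exists b : bool,
    (if b then PF 0 (tt d) (plvd d v) else PF (rr d) (ss d) (plvd d v)) != 0.
  have [z|] := eqVneq (PF 0 (tt d) (plvd d v)) 0; last by exists true.
  exists false; rewrite (PF_rs i (und d)); apply: mulf_neq0 => //.
  move/eqP: z; rewrite (PF_ot i (und d)) mulf_eq0 (negPf i0) => /eqP/one[z|z].
    by apply: mulf_neq0; apply/eqP; [exact: (gv _ _ or z)|exact: (gv _ _ os z)].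
  by apply: mulf_neq0; apply/eqP; apply: (gv _ _ _ z); rewrite eq_sym.
by exists a, b; rewrite /sepF mulf_neq0.
Qed.

Lemma PF_sym j l d v : PF j l (plvd d v) = 0 -> PF l j (plvd d v) = 0.
Proof.
by rewrite !PF_plk /minor => h; rewrite -[RHS]oppr0 -[X in _ = - X]h; ring.
Qed.

Lemma sepF_eq0 d d' a b p : d != gam1 -> d' != gam1 -> d' != d ->
  sepF d a b (plucker (Lv d' p)) = 0.
Proof.
move=> d1 d1' dd; have [c c0 ->] := plucker_Lv d' p; set v := ccoord p.
rewrite (hform_scale _ _ (hform_sepF d a b)); apply/eqP; rewrite mulf_eq0 orbC; apply/orP; left.
have h1 := PF_or i (und d') v; have h2 := PF_st i (und d') v.
rewrite mulf_eq0; have [dE|dE] := gj_cases d1 d1' dd; apply/orP; [left|right].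
  have [rE sE tE] : [/\ rr d' = ss d, ss d' = tt d & tt d' = rr d].
    by rewrite dE; split; case: (d) d1 => [[] []].
  apply/eqP; case: a; first by rewrite -rE.
  by apply: PF_sym; rewrite -sE -tE.
have [rE sE tE] : [/\ rr d' = tt d, ss d' = rr d & tt d' = ss d].
  by rewrite dE; split; case: (d) d1 => [[] []].
by apply/eqP; case: b; [rewrite -rE|rewrite -sE -tE].
Qed.

Lemma Lv_disjoint d d' p q : d != gam1 -> d' != gam1 -> Lv d p = Lv d' q -> d' = d.
Proof.
move=> d1 d1' pq; apply/eqP; apply: contraT => dd.
have [a [b]] := sepF_neq0 d p; rewrite pq sepF_eq0 ?eqxx //.
Qed.

Lemma locusP L : @locus k alpha beta gamma i G L <-> exists2 d, d != gam1 & exists p, L = Lv d p.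
Proof.
split=> [[z [M [zM ML]]]|[d d1 [p ->]]].
  have [d d1 zd] := tors2_idx hxi hE2 z; exists d => //.
  have [p Mp] := of_type_Lv hk habc hne hxi hE2 d1 zd zM; exists p.
  have [c [c' [_ [_ [_ _ Lc _]]]]] := ML.
  have iso := has_line_isom hk ML Lc.
  exact: (has_line_unique hk (eq_isom_trans (eq_isom_sym iso) iso) ML Mp).
have [z zd] := tors2_of hk habc hne hxi hE2 d1.
exists z, (Mv beta i d p); split; first exact: (of_type_Mv hk habc hne i hxi hE2 p d1 zd).
exact: has_line_Mv.
Qed.

Lemma locus_closed : @ks_closed k (pvar (@plucker k)) (@locus k alpha beta gamma i G).
Proof.
apply/pvar_separate => L nL.
have sep d : d != gam1 -> exists n F,
    [/\ hform n F, forall p, F (plucker (Lv d p)) = 0 & F (plucker L) != 0].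
  move=> d1; set x := plucker L.
  have vanish n (F : 'rV[k]_6 -> k) : hform n F -> (forall v, cone e v -> F (plvd d v) = 0) ->
      forall p, F (plucker (Lv d p)) = 0.
    move=> Fn Fv p; have [c _ ->] := plucker_Lv d p.
    by rewrite (hform_scale _ _ Fn) Fv ?mulr0 //; exact: ccoord_cone.
  have [h1|h1] := eqVneq (PF 0 (rr d) x) 0; last first.
    exists 1%N, (PF 0 (rr d)); split=> //; first exact: hform_PF.
    exact: (vanish _ _ (@hform_PF k 0 (rr d)) (fun v _ => PF_or i (und d) v)).
  have [h2|h2] := eqVneq (PF (ss d) (tt d) x) 0; last first.
    exists 1%N, (PF (ss d) (tt d)); split=> //; first exact: hform_PF.
    exact: (vanish _ _ (@hform_PF k (ss d) (tt d)) (fun v _ => PF_st i (und d) v)).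
  have [h3|h3] := eqVneq (pfrel e 0 (rr d) (ss d) (tt d) x) 0; last first.
    exists 2%N, (pfrel e 0 (rr d) (ss d) (tt d)); split=> //; first exact: hform_pfrel.
    exact: (vanish _ _ (@hform_pfrel k e 0 (rr d) (ss d) (tt d)) (fun v => @pfrel_plv k e i _ _ _ _ (und d) v)).
  case: nL; apply/locusP; exists d => //.
  have [v [v0 cv] Lv'] := plucker_surj einj i (und d) h1 h2 h3.
  have [p [c c0 pE]] := curve_pt v0 cv; exists p; apply: val_inj.
  by rewrite /= /vl pE twlineZ.
have [n1 [F1 [f1 z1 nz1]]] := sep (true, false) isT.
have [n2 [F2 [f2 z2 nz2]]] := sep (false, true) isT.
have [n3 [F3 [f3 z3 nz3]]] := sep (true, true) isT.
(* A union of three closed sets: the product vanishes on every family and not at L. *)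
exists (n1 + n2 + n3)%N, (fun x => F1 x * F2 x * F3 x); split.
- by apply: hformM => //; exact: hformM.
- move=> M /locusP[d d1 [p ->]]; move: d d1 p => [[] []] d1 p.
  + by rewrite z3 mulr0.
  + by rewrite z1 !mul0r.
  + by rewrite z2 mulr0 mul0r.
  by rewrite eqxx in d1.
by rewrite !mulf_neq0.
Qed.

End LineFamily.

(** * Descent of closed sets and regular functions from E to its image *)

Section Quartic.
Variables (k : closedFieldType) (s t : 'I_4).
Hypothesis hk : (2%:R : k) != 0.
Local Notation sg := (@sgn2 k s t).

Lemma sgn2K : involutive sg.
Proof. by move=> v; apply/rowP => j; rewrite !mxE; case: (_ || _); rewrite ?opprK. Qed.

Lemma hform_sgn2 m (F : 'rV[k]_4 -> k) : hform m F -> hform m (fun v => F (sg v)).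
Proof.
rewrite -{2}[m]muln1 => Fm; apply: (hform_comp Fm) => j.
apply: (@hform_ext _ _ _ (fun v => (if (j == s) || (j == t) then -1 else 1) * v 0 j)).
  by move=> v; rewrite mxE; case: (_ || _); rewrite ?mulN1r ?mul1r.
by apply: hformZ; exact: hform_coord.
Qed.

(* [b^4] symmetrizes to [b^4 + b'^4] and [b^2 b'^2] to [2 b^2 b'^2], where [b'] is the
   translate of [b]; they vanish together only where [b] and [b'] do. *)
Lemma quartic m (a b : 'rV[k]_4 -> k) v : hform m a -> hform m b -> b v != 0 ->
  exists D N, [/\ hform (4 * m) D, hform (4 * m) N, D v + D (sg v) != 0,
    forall w, b w = 0 -> b (sg w) = 0 -> D w + D (sg w) = 0 &
    forall w f, (b w != 0 -> f = a w / b w) ->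
      (b (sg w) != 0 -> f = a (sg w) / b (sg w)) ->
      f * (D w + D (sg w)) = N w + N (sg w)].
Proof.
move=> am bm bv.
have bm' := hform_sgn2 bm.
(* The extra factor y makes the equation valid also where the denominator vanishes, so the two
   translates can be added without case distinctions. *)
have clear x y f : (y != 0 -> f = x / y) -> f * y ^+ 2 = x * y :> k.
  have [->|y0 ->//] := eqVneq y 0; first by rewrite expr0n !mulr0.
  by rewrite expr2 mulrA mulfVK.
have [z|nz] := eqVneq (b v ^+ 4 + b (sg v) ^+ 4) 0; last first.
  exists (fun w => b w ^+ 4), (fun w => a w * b w ^+ 3); split=> //.
  - by rewrite mulnC; exact: hformX.
  - rewrite (_ : 4 * m = m + m * 3)%N; last by lia.
    by apply: hformM => //; exact: hformX.
  - by move=> w -> ->; rewrite expr0n addr0.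
  move=> w f /clear h /clear h'.
  transitivity ((f * b w ^+ 2) * b w ^+ 2 + (f * b (sg w) ^+ 2) * b (sg w) ^+ 2); first by ring.
  by rewrite h h'; ring.
(* The first candidate denominator vanishes at v while b does not; hence b is non-zero at the
   translate too, and the second candidate is non-zero as 2 is invertible. *)
have bv' : b (sg v) != 0.
  apply: contra_neq bv => b0; move/eqP: z; rewrite b0 expr0n addr0.
  by rewrite expf_eq0 => /eqP.
exists (fun w => b w ^+ 2 * b (sg w) ^+ 2), (fun w => a w * b w * b (sg w) ^+ 2); split.
- rewrite (_ : 4 * m = m * 2 + m * 2)%N; last by lia.
  by apply: hformM; exact: hformX.
- rewrite (_ : 4 * m = (m + m) + m * 2)%N; last by lia.
  by apply: hformM; [exact: hformM|exact: hformX].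
- rewrite sgn2K [X in _ + X]mulrC -mulr2n -mulr_natl.
  by rewrite !mulf_neq0 ?expf_neq0.
- by move=> w -> ->; rewrite expr0n !mul0r addr0.
move=> w f /clear h /clear h'; rewrite sgn2K -h -h'; ring.
Qed.
End Quartic.

Section Glue.
Variables (k : closedFieldType) (alpha beta gamma : k).
Hypothesis hk : (2%:R : k) != 0.
Hypothesis habc : alpha + beta + gamma + alpha * beta * gamma = 0.
Hypothesis hne : forall t, t \in [:: alpha; beta; gamma] -> t \notin [:: 0; 1; -1].
Variables (i : sqrtN1 k) (G : groupLaw alpha gamma) (xi : Gam -> curve alpha gamma).
Hypothesis hxi : forall d p, cpt (ga G p (xi d)) = gam_pt d (cpt p).
Hypothesis hE2 : forall q, ga G q q = go G <-> exists d, q = xi d.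
Local Notation E := (curve alpha gamma).
Local Notation C := (curve_space alpha gamma).
Local Notation Y := (locus_space beta i G).
Local Notation e := (ev alpha gamma).
Local Notation plvd d := (plv i 0 (rr d) (ss d) (tt d)).
Local Notation sg d := (sgn2 (ss d) (tt d)).
Local Notation Lv := (Lv habc hne i).

Let einj : injective e := ev_inj habc hne.
Let und d : uniq [:: 0; rr d; ss d; tt d] := cyc_uniq (cycd d).

Lemma locus_Lv d p : d != gam1 -> @locus k alpha beta gamma i G (Lv d p).
Proof. by move=> d1; apply/(locusP hk habc hne i hxi hE2); exists d => //; exists p. Qed.

Definition phi d (d1 : d != gam1) (p : E) : Y := exist _ (Lv d p) (locus_Lv p d1).

Lemma locus_eq (y y' : Y) : sval y = sval y' -> y = y'.
Proof. by case: y y' => L h [L' h'] /= LL; subst; congr exist; exact: Prop_irrelevance. Qed.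

Lemma phi_surj (y : Y) : exists d (d1 : d != gam1) p, y = phi d1 p.
Proof.
have /(locusP hk habc hne i hxi hE2)[d d1 [p yE]] := svalP y.
by exists d, d1, p; apply: locus_eq.
Qed.

Lemma phi_eqP d (d1 : d != gam1) p q : phi d1 p = phi d1 q <-> coset G (xi d) p q.
Proof.
rewrite -(Lv_eqP habc hne i hxi p q d1); split=> [/(congr1 sval)//|pq].
exact: locus_eq.
Qed.

Lemma phi_ga d (d1 : d != gam1) p : phi d1 (ga G p (xi d)) = phi d1 p.
Proof. by apply/esym/phi_eqP; right. Qed.

Lemma phi_index d (d1 : d != gam1) d' (d1' : d' != gam1) p q :
  phi d1 p = phi d1' q -> d' = d.
Proof. by move=> /(congr1 sval); exact: (Lv_disjoint d1 d1'). Qed.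

(** Turns a symmetrized form on E into a form on the Grassmannian. The power of [c] compensates for
    the basis chosen by [plucker]. *)
Lemma even_form d m F : hform (4 * m) F -> exists2 H, hform (2 * m) H &
  forall p c, plucker (Lv d p) = c *: plvd d (ccoord p) ->
    H (plucker (Lv d p)) = c ^+ (2 * m) * (F (ccoord p) + F (sg d (ccoord p))).
Proof.
move=> /(red_sym hk einj i (und d))[H Hm HE]; exists H => // p c ->.
by rewrite (hform_scale _ _ Hm) HE //; exact: ccoord_cone.
Qed.

Lemma phi_closed d (d1 : d != gam1) (Z : Y -> Prop) :
  ks_closed Z -> @ks_closed _ C (fun p => Z (phi d1 p)).
Proof.
move=> /pvar_separate sep; apply/pvar_separate => q /sep[m [F [Fm FZ Fq]]].
have FE p : exists2 c, c != 0 & F (plucker (Lv d p)) = c * F (plvd d (ccoord p)).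
  have [c c0 ->] := plucker_Lv habc hne i d p.
  by exists (c ^+ m); [exact: expf_neq0|exact: hform_scale].
exists (m * 2)%N, (fun v => F (plvd d v)); split.
- exact: (plv_comp i (und d) Fm).
- move=> p /FZ; have [c c0 ->] := FE p => /eqP.
  by rewrite mulf_eq0 (negPf c0) => /eqP.
by move: Fq; have [c c0 ->] := FE q; rewrite mulf_eq0 negb_or => /andP[].
Qed.

Lemma phi_regular d (d1 : d != gam1) (U : Y -> Prop) f :
  ks_regular U f -> @ks_regular _ C (fun p => U (phi d1 p)) (fun p => f (phi d1 p)).
Proof.
move=> /pvar_regularP reg; apply/pvar_regularP => q /reg[m [A [B [Am Bm Bq fE]]]].
exists (m * 2)%N, (fun v => A (plvd d v)), (fun v => B (plvd d v)); split.
- exact: (plv_comp i (und d) Am).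
- exact: (plv_comp i (und d) Bm).
- move: Bq; have [c c0 ->] := plucker_Lv habc hne i d q.
  by rewrite (hform_scale _ _ Bm) mulf_eq0 negb_or => /andP[].
move=> p Up Bp; have := fE _ Up; have [c c0 ->] := plucker_Lv habc hne i d p.
rewrite (hform_scale _ _ Am) (hform_scale _ _ Bm) => ->.
  by rewrite -mulf_div divff ?mul1r // expf_neq0.
by rewrite mulf_neq0 // expf_neq0.
Qed.

(** A form separating a point of E from the preimage of Z is symmetrized, which keeps it zero on
    this translation-stable preimage, then descended, and multiplied by [sepF] to vanish on the
    other two curves. *)
Lemma glue_closed (Z : Y -> Prop) :
  (forall d (d1 : d != gam1), @ks_closed _ C (fun p => Z (phi d1 p))) -> ks_closed Z.
Proof.
move=> cl; apply/pvar_separate => y; have [d [d1 [q ->]]] := phi_surj y => {y}.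
have /pvar_separate sep := cl d d1.
move=> /sep[m [b [bm bZ bq]]].
(* Only the denominator is wanted, so the numerator is taken to be the zero form. *)
have [D [_ [Dm _ Dq D0 _]]] := quartic (ss d) (tt d) hk (hform0 k 4 m) bm bq.
have [H Hm HE] := even_form d Dm.
have [x [y xy]] := sepF_neq0 habc hne i d q.
exists (2 + 2 * m)%N, (fun z => sepF d x y z * H z); split.
- by apply: hformM => //; exact: hform_sepF.
- move=> z; have [d' [d1' [p ->]]] := phi_surj z => Zp.
  have [dd|dd] := eqVneq d' d; last by rewrite (sepF_eq0 habc hne i x y p d1 d1' dd) mul0r.
  subst d'; have [c c0 cE] := plucker_Lv habc hne i d p.
  rewrite (HE p c cE) D0 ?mulr0 //.
    by apply: bZ; rewrite (bool_irrelevance d1 d1').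
  (* The form b must vanish at the translate as well; it does because [phi] has the same value
     there. *)
  have [c' c0' pE] := ccoord_ga hxi p d1.
  have := bZ (ga G p (xi d)); rewrite phi_ga (bool_irrelevance d1 d1') pE => /(_ Zp)/eqP.
  by rewrite (hform_scale _ _ bm) mulf_eq0 expf_eq0 (negPf c0') andbF => /eqP.
have [c c0 cE] := plucker_Lv habc hne i d q.
by rewrite mulf_neq0 // (HE q c cE) mulf_neq0 // expf_neq0.
Qed.

(** The pulled back function takes one value at a point and at its translate, so near the given
    point it equals the quotient of the symmetrized numerator and denominator of [quartic], and both
    descend by [even_form]. *)
Lemma glue_regular (U : Y -> Prop) f :
  (forall d (d1 : d != gam1),
    @ks_regular _ C (fun p => U (phi d1 p)) (fun p => f (phi d1 p))) -> ks_regular U f.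
Proof.
move=> reg; apply/pvar_regularP => y; have [d [d1 [q ->]]] := phi_surj y => {y}.
have /pvar_regularP := reg d d1 => /[apply] -[m [a [b [am bm bq fE]]]].
have [D [N [Dm Nm Dq _ DN]]] := quartic (ss d) (tt d) hk am bm bq.
have [H Hm HE] := even_form d Dm; have [K Km KE] := even_form d Nm.
have [x [y xy]] := sepF_neq0 habc hne i d q.
exists (2 + 2 * m)%N, (fun z => sepF d x y z * K z), (fun z => sepF d x y z * H z); split.
- by apply: hformM => //; exact: hform_sepF.
- by apply: hformM => //; exact: hform_sepF.
- have [c c0 cE] := plucker_Lv habc hne i d q.
  by rewrite mulf_neq0 // (HE q c cE) mulf_neq0 // expf_neq0.
move=> z; have [d' [d1' [p ->]]] := phi_surj z => Up.
(* On the other curves the factor [sepF] makes the denominator zero, so the condition is void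
   there. *)
have [dd|dd] := eqVneq d' d; last first.
  by rewrite (sepF_eq0 habc hne i x y p d1 d1' dd) mul0r eqxx.
subst d'; rewrite (bool_irrelevance d1' d1) in Up *.
have [c c0 cE] := plucker_Lv habc hne i d p.
rewrite mulf_eq0 negb_or => /andP[s0]; rewrite (HE p c cE) (KE p c cE) => h0.
rewrite -mulf_div divff // mul1r -mulf_div divff ?expf_neq0 // mul1r.
move: h0; rewrite mulf_eq0 negb_or => /andP[_ h0].
apply: (canRL (mulfK h0)); apply: DN; first exact: fE.
have [c' c0' pE] := ccoord_ga hxi p d1.
move=> b0; have := fE (ga G p (xi d)); rewrite phi_ga pE.
rewrite (hform_scale _ _ am) (hform_scale _ _ bm) => /(_ Up) ->.
  by rewrite -mulf_div divff ?mul1r // expf_neq0.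
by rewrite mulf_neq0 // expf_neq0.
Qed.

End Glue.

(** * Quotient classes and the parametrization *)

Lemma class_of_surj (T : Type) (R : T -> T -> Prop) (C : classes R) : exists x, C = class_of R x.
Proof. by case: C => P [x PE]; exists x; subst P; congr exist; exact: Prop_irrelevance. Qed.

Lemma class_of_eq (T : Type) (R : T -> T -> Prop) x y :
  (forall z, R x z <-> R y z) -> class_of R x = class_of R y.
Proof.
move=> xy; have xyE : R x = R y by apply/funext => z; exact/propext.
rewrite /class_of; move: (ex_intro _ x _) (ex_intro _ y _); rewrite xyE => h h'.
by congr exist; exact: Prop_irrelevance.
Qed.

Theorem theorem11p11 (k : closedFieldType) (hk : 2%N \notin [pchar k])
  (alpha beta gamma : k)
  (habc : alpha + beta + gamma + alpha * beta * gamma = 0)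
  (hne : forall t, t \in [:: alpha; beta; gamma] -> t \notin [:: 0; 1; -1])
  (i : sqrtN1 k)
  (G : groupLaw alpha gamma)
  (xi : Gam -> curve alpha gamma)
  (hxi : forall d p, cpt (ga G p (xi d)) = gam_pt d (cpt p))
  (hE2 : forall q, ga G q q = go G <-> exists d, q = xi d) :
  [/\ (* each equivariant module in question has a line *)
      forall (z : tors2 G) (M : eqModule alpha beta gamma i),
        of_type z M -> exists! L, has_line M L,
      (* two of them are isomorphic iff they have the same line *)
      forall (z w : tors2 G) (M N : eqModule alpha beta gamma i) L L',
        of_type z M -> of_type w N -> has_line M L -> has_line N L' ->
        (eq_isom M N <-> L = L'),
      (* the lines form a closed subvariety of G(1,3) *)
      @ks_closed k (pvar (@plucker k)) (@locus k alpha beta gamma i G)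
    & (* isomorphic to the disjoint union of the curves E/<z>, the curve E/<z>
         corresponding to the modules of type z *)
      exists f : ks_sum (@curve_quot k alpha gamma G) ->
                 locus_space beta i G,
        ks_iso f /\
        forall (z : tors2 G) (L : gr k 2 4),
          (exists C : curve_quot z, sval (f (existT _ z C)) = L) <->
          (exists M : eqModule alpha beta gamma i, of_type z M /\ has_line M L)].
Proof.
have h2 : (2%:R : k) != 0 by move: hk; rewrite inE.
have iso_lines (M : eqModule alpha beta gamma i) L : has_line M L -> exists c c', is_line c c' (val L) /\
    eq_isom (@line_mod k alpha beta gamma i c c') M.
  move=> ML; have [c [c' [_ [_ [_ _ Lc _]]]]] := ML.
  by exists c, c'; split=> //; exact: (has_line_isom h2 ML Lc).
have isom_refl (M : eqModule alpha beta gamma i) L : has_line M L -> eq_isom M M.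
  by move=> /iso_lines[c [c' [_ iso]]]; exact: eq_isom_trans (eq_isom_sym iso) iso.
split.
- move=> z M zM; have [d d1 zd] := tors2_idx hxi hE2 z.
  have [p Mp] := of_type_Lv h2 habc hne hxi hE2 d1 zd zM.
  exists (Lv habc hne i d p); split=> // L ML.
  exact: (has_line_unique h2 (isom_refl _ _ Mp) Mp ML).
- move=> z w M N L L' _ _ ML NL; split=> [iso|LL]; first exact: (has_line_unique h2 iso ML NL).
  subst L'; have [c [c' [Lc isoM]]] := iso_lines _ _ ML.
  exact: eq_isom_trans (eq_isom_sym isoM) (has_line_isom h2 NL Lc).
- exact: (locus_closed h2 habc hne i hxi hE2).
have /choice[idx idxP] (z : tors2 G) : exists d, d != gam1 /\ sval z = xi d.
  by have [d d1 zd] := tors2_idx hxi hE2 z; exists d.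
have d1 z : idx z != gam1 by case: (idxP z).
have zd z : sval z = xi (idx z) by case: (idxP z).
pose X := ks_sum (@curve_quot k alpha gamma G).
pose Y := locus_space beta i G.
pose pt z p : X := existT _ z (class_of (coset G (sval z)) p).
pose ph z p : Y := phi h2 habc hne i hxi hE2 (d1 z) p.
have ptE (x : X) : exists z p, x = pt z p.
  by case: x => z C; have [p ->] := class_of_surj C; exists z, p.
have phE z p q : ph z p = ph z q <-> coset G (sval z) p q.
  by rewrite zd; exact: phi_eqP.
(* A class carries no representative; [f] is chosen as the common value of [ph] on the class. *)
have /choice[f fP] (x : X) : exists y, forall p, sval (projT2 x) p -> y = ph (projT1 x) p.
  by have [z [q ->]] := ptE x; exists (ph z q) => p /= /phE.
have fE z p : f (pt z p) = ph z p by apply: fP; left.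
have f_inj : injective f.
  move=> x y; have [z [p ->]] := ptE x; have [w [q ->]] := ptE y; rewrite !fE => pq.
  have zw : z = w by apply: tors2_inj; rewrite !zd (phi_index pq).
  subst w; congr existT; apply: class_of_eq => x'.
  by rewrite -!phE pq.
have phz d (d1' : d != gam1) : exists z, forall p, phi h2 habc hne i hxi hE2 d1' p = ph z p.
  have [z zE] := tors2_of h2 habc hne hxi hE2 d1'; exists z => p; apply: locus_eq.
  have zE' : idx z = d; last by rewrite /= zE'.
  by apply: (xi_inj h2 habc hne hxi); rewrite -zd.
have /choice[g gK] (y : Y) : exists x, f x = y.
  have [d [d1' [p ->]]] := phi_surj h2 habc hne hxi hE2 y.
  by have [z ->] := phz d d1'; exists (pt z p).
have fK : cancel f g by move=> x; apply: f_inj; rewrite gK.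
have fZ (A : Type) (Z : Y -> A) z : (fun p => Z (f (pt z p))) = (fun p => Z (ph z p)).
  by apply/funext => p; rewrite fE.
have gZ (A : Type) (Z : X -> A) z : (fun p => Z (g (ph z p))) = (fun p => Z (pt z p)).
  by apply/funext => p; rewrite -fE fK.
exists f; split.
  exists g; split=> //; split.
  - move=> Z Zc z; change (@ks_closed _ (curve_space alpha gamma) (fun p => Z (f (pt z p)))).
    by rewrite fZ; exact: phi_closed.
  - move=> U h _ Uh z.
    change (@ks_regular _ (curve_space alpha gamma) (fun p => U (f (pt z p)))
      (fun p => h (f (pt z p)))).
    by rewrite !fZ; exact: phi_regular.
  (* The inverse is tested after pulling back along each [phi], where it becomes the quotient map of
     E; the descent lemmas do the rest. *)
  - move=> Z Zc; apply: (@glue_closed k alpha beta gamma h2 habc hne i G xi hxi hE2 (fun y => Z (g y))) => d d1'.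
    have [z zE] := phz d d1'.
    rewrite (_ : (fun p => _) = (fun p => Z (g (ph z p)))); last by apply/funext => p; rewrite zE.
    by rewrite gZ; exact: Zc.
  move=> U h _ Uh; apply: (@glue_regular k alpha beta gamma h2 habc hne i G xi hxi hE2 (fun y => U (g y)) (fun y => h (g y))) => d d1'.
  have [z zE] := phz d d1'.
  rewrite (_ : (fun p => U _) = (fun p => U (g (ph z p)))); last by apply/funext => p; rewrite zE.
  rewrite (_ : (fun p => h _) = (fun p => h (g (ph z p)))); last by apply/funext => p; rewrite zE.
  by rewrite !gZ; exact: Uh.
move=> z L; split=> [[C <-]|[M [zM ML]]].
  have [p ->] := class_of_surj C; rewrite -/(pt z p) fE.
  exists (Mv beta i (idx z) p); split; last exact: has_line_Mv.
  exact: (of_type_Mv h2 habc hne i hxi hE2).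
have [p Mp] := of_type_Lv h2 habc hne hxi hE2 (d1 z) (zd z) zM.
exists (class_of (coset G (sval z)) p); rewrite -/(pt z p) fE.
exact: (has_line_unique h2 (isom_refl _ _ ML) Mp ML).
Qed.
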